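(* For $n\in\mathbb{N}$ let $N(a_1,a_2,a_3,a_4,b_1,b_2;n)$ be the number of $(x_1,\dots,x_8)\in\mathbb{Z}^8$ with $n=\sum_{i=1}^4a_ix_i^2+b_1(x_5^2+x_5x_6+x_6^2)+b_2(x_7^2+x_7x_8+x_8^2)$. Let $(a_1,a_2,a_3,a_4)\in\{(1,1,1,3),(1,2,2,3),(1,3,3,3)\}$ and $(b_1,b_2)\in\{(1,1),(1,2),(1,4),(2,2),(2,4),(4,4)\}$. Then for every $n\in\mathbb{N}$, $$N(a_1,a_2,a_3,a_4,b_1,b_2;n)=\sum_{i=1}^{16}\gamma_iC_i(n),$$ where $C_i(n)$ are the Fourier coefficients of the functions $h_i$ in the context and $(\gamma_1,\dots,\gamma_{16})$ is the vector assigned to $(a_1a_2a_3a_4,b_1b_2)$ in the table in the context.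
   Context: $q=e^{2\pi iz}$, $\eta(z)=q^{1/24}\prod_{n\ge1}(1-q^n)$. Characters: $\chi_{12}(n)=\left(\frac{12}{n}\right)$, $\chi_{-3}(n)=\left(\frac{-3}{n}\right)$, $\chi_{-4}(n)=\left(\frac{-4}{n}\right)$, $\mathbf 1$ trivial. For primitive $\chi,\psi$ with $\chi$ of conductor $M$: $E_{4,\chi,\psi}(z)=c_0+\sum_{n\ge1}\big(\sum_{d\mid n}\psi(d)\chi(n/d)d^3\big)q^n$, $c_0=0$ if $M>1$, $c_0=-B_{4,\psi}/8$ if $M=1$ (generalized Bernoulli number; for $E_{4,\mathbf 1,\chi_{12}}$ this gives $c_0=23$). Eta-quotients: $v_1=\eta^{-1}(2z)\eta^4(3z)\eta^2(4z)\eta^5(6z)\eta^{-2}(12z)$, $v_2=\eta^4(3z)\eta^3(4z)\eta^{-2}(6z)\eta^3(12z)$, $v_3=\eta^2(2z)\eta^4(3z)\eta^{-1}(4z)\eta^{-4}(6z)\eta^7(12z)$, $v_4=\eta^4(z)\eta^{-1}(4z)\eta^{-2}(6z)\eta^7(12z)$. Set $h_1=E_{4,\mathbf 1,\chi_{12}}(z)$, $h_2=E_{4,\chi_{12},\mathbf 1}(z)$, $h_3=E_{4,\chi_{-4},\chi_{-3}}(z)$, $h_4=E_{4,\chi_{-3},\chi_{-4}}(z)$, $h_5,\dots,h_8$ the same four functions at $2z$, $h_{8+j}=v_j(z)$, $h_{12+j}=v_j(2z)$ ($1\le j\le4$); $h_i(z)=\sum_{n\ge0}C_i(n)q^n$.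 Table of $(\gamma_1,\dots,\gamma_{16})$ (all entries are over 23; listed are the numerators $23\gamma_i$): (1113,11): 1, 288, 32, 9, 0, 0, 0, 0, 84, 720, 336, 864, 0, 0, 0, 0. (1113,12): 1, 144, -16, -9, 0, 0, 0, 0, 156, -48, -168, -456, 0, 0, 0, 0. (1113,14): 1, 72, 8, 9, 0, 0, 0, 0, 186, 600, -228, 372, 0, 0, 0, 0. (1113,22): 1, 72, 8, 9, 0, 0, 0, 0, 48, 48, 48, 96, 0, 0, 0, 0. (1113,24): 1, 36, -4, -9, 0, 0, 0, 0, 114, 84, -120, -156, 0, 0, 0, 0. (1113,44): 1, 18, 2, 9, 0, 0, 0, 0, 108, 156, -162, 42, 0, 0, 0, 0. (1223,11): 0, 144, 16, 0, 1, 0, 0, -9, 162, 264, -1188, 420, 192, 864, -4704, -5760. (1223,12): 0, 72, -8, 0, 1, 0, 0, 9, 120, 96, 336, -384, -240, -912, 4368, 2784. (1223,14): 0, 36, 4, 0, 1, 0, 0, -9, 144, 480, -504, 312, -360, 1416, -1944, -1344. (1223,22): 0, 36, 4, 0, 1, 0, 0, -9, 6, -72, -228, 36, 192, -240, -1392, -1344. (1223,24): 0, 18, -2, 0, 1, 0, 0, 9, 30, 24, 84, -96, 36, -360, 504, 576. (1223,44): 0, 9, 1, 0, 1, 0, 0, -9, 36, 120, -126, 78, -84, 312, -840, -240. (1333,11): 1, 96, -32, -3, 0, 0, 0, 0, 260, 352, -544, -352, 0, 0, 0, 0. (1333,12): 1, 48, 16, 3, 0, 0, 0, 0, 116, 160,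 -40, 104, 0, 0, 0, 0. (1333,14): 1, 24, -8, -3, 0, 0, 0, 0, 170, 16, -292, -340, 0, 0, 0, 0. (1333,22): 1, 24, -8, -3, 0, 0, 0, 0, 32, 16, -16, -64, 0, 0, 0, 0. (1333,24): 1, 12, 4, 3, 0, 0, 0, 0, 26, 76, 32, 116, 0, 0, 0, 0. (1333,44): 1, 6, -2, -3, 0, 0, 0, 0, 44, -68, -22, -130, 0, 0, 0, 0. *)

(* Defs.v *)
From mathcomp Require Import all_boot all_order all_algebra.
Set Implicit Arguments. Unset Strict Implicit. Unset Printing Implicit Defensive.
Import Order.TTheory GRing.Theory Num.Theory.
Local Open Scope ring_scope.

Definition qform (a1 a2 a3 a4 b1 b2 : nat) (x : 'I_8 -> int) : int :=
  a1%:Z * x (inord 0) ^+ 2 + a2%:Z * x (inord 1) ^+ 2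
  + a3%:Z * x (inord 2) ^+ 2 + a4%:Z * x (inord 3) ^+ 2
  + b1%:Z * (x (inord 4) ^+ 2 + x (inord 4) * x (inord 5) + x (inord 5) ^+ 2)
  + b2%:Z * (x (inord 6) ^+ 2 + x (inord 6) * x (inord 7) + x (inord 7) ^+ 2).

Definition box_vec (r : nat) (y : {ffun 'I_8 -> 'I_(2 * r).+1}) : 'I_8 -> int :=
  fun i => (nat_of_ord (y i))%:Z - r%:Z.

(* N(a1,a2,a3,a4,b1,b2;n) = #{ x in Z^8 : qform x = n }.  Every solution lies
   in the box [-n, n]^8 (each a_i, b_j >= 1 and x^2+xy+y^2 >= 3x^2/4), so
   counting over that box counts all integer solutions. *)
Definition Nrep (a1 a2 a3 a4 b1 b2 n : nat) : nat :=
  #|[set y : {ffun 'I_8 -> 'I_(2 * n).+1} |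
      qform a1 a2 a3 a4 b1 b2 (box_vec y) == n%:Z]|.

Definition chi_one (n : nat) : int := 1.
Definition chi12 (n : nat) : int :=
  if (n %% 12 == 1)%N || (n %% 12 == 11)%N then 1
  else if (n %% 12 == 5)%N || (n %% 12 == 7)%N then -1 else 0.
Definition chim3 (n : nat) : int :=
  if (n %% 3 == 1)%N then 1 else if (n %% 3 == 2)%N then -1 else 0.
Definition chim4 (n : nat) : int :=
  if (n %% 4 == 1)%N then 1 else if (n %% 4 == 3)%N then -1 else 0.

(* Bernoulli polynomial B_4 and generalized Bernoulli number B_{4,psi}
   for a character psi of conductor f:  B_{4,psi} = f^3 sum_{a=1}^f psi(a) B_4(a/f). *)
Definition bern4 (x : rat) : rat := x ^+ 4 - 2 * x ^+ 3 + x ^+ 2 - 1 / 30.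
Definition genbern4 (psi : nat -> int) (f : nat) : rat :=
  (f%:R) ^+ 3 * \sum_(1 <= a < f.+1) (psi a)%:~R * bern4 (a%:R / f%:R).

(* Coefficients of E_{4,chi,psi}; chi has conductor M, psi has conductor f. *)
Definition eis4 (chi : nat -> int) (M : nat) (psi : nat -> int) (f : nat)
  (n : nat) : rat :=
  if n == 0%N then (if M == 1%N then - genbern4 psi f / 8 else 0)
  else \sum_(d <- divisors n) ((psi d * chi (n %/ d)%N)%:~R * (d%:R) ^+ 3).

(* Formal power series in q with integer coefficients, truncated modulo
   q^(N+1): represented by the list of their first N+1 coefficients. *)
Definition tser := seq int.
Definition tone (N : nat) : tser := mkseq (fun k => (k == 0%N)%:Z) N.+1.
Definition tmul (N : nat) (s t : tser) : tser :=
  mkseq (fun k => \sum_(0 <= i < k.+1) nth 0 s i * nth 0 t (k - i)%N) N.+1.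
(* 1 - q^d  and its inverse  sum_{j>=0} q^{dj}  (d >= 1), mod q^(N+1) *)
Definition t1mX (N d : nat) : tser := mkseq (fun k => (k == 0%N)%:Z - (k == d)%:Z) N.+1.
Definition tgeom (N d : nat) : tser := mkseq (fun k => (d %| k)%:Z) N.+1.
Definition tfac (N d : nat) (r : int) : tser :=
  match r with
  | Posz k => iter k (tmul N (t1mX N d)) (tone N)
  | Negz k => iter k.+1 (tmul N (tgeom N d)) (tone N)
  end.
(* coefficient of q^n in  prod_{(m,r) in l} prod_{k>=1} (1 - q^{mk})^r,
   computed modulo q^(n+1) (for m >= 1 the factors with k > n are
   = 1 mod q^(n+1), so only k = 1..n are taken). *)
Definition etaprod_coef (l : seq (nat * int)) (n : nat) : int :=
  nth 0 (foldr (tmul n) (tone n)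
     [seq foldr (tmul n) (tone n) [seq tfac n (p.1 * k)%N p.2 | k <- iota 1 n] | p <- l])
    n.
(* coefficient of q^n in  prod_{(m,r) in l} eta(m z)^r
   = q^{s/24} prod ...  with s = sum m r *)
Definition etaq_coef (l : seq (nat * int)) (n : nat) : rat :=
  let t : int := 24 * n%:Z - \sum_(p <- l) p.1%:Z * p.2 in
  if (0 <= t) && (24 %| absz t)%N then (etaprod_coef l (absz t %/ 24)%N)%:~R
  else 0.

Definition v1 : seq (nat * int) := [:: (2, -1); (3, 4); (4, 2); (6, 5); (12, -2)].
Definition v2 : seq (nat * int) := [:: (3, 4); (4, 3); (6, -2); (12, 3)].
Definition v3 : seq (nat * int) := [:: (2, 2); (3, 4); (4, -1); (6, -4); (12, 7)].
Definition v4 : seq (nat * int) := [:: (1, 4); (4, -1); (6, -2); (12, 7)].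

Definition at2z (c : nat -> rat) (n : nat) : rat := if odd n then 0 else c n./2.

Definition Ccoef (i n : nat) : rat :=
  match i with
  | 1 => eis4 chi_one 1 chi12 12 n
  | 2 => eis4 chi12 12 chi_one 1 n
  | 3 => eis4 chim4 4 chim3 3 n
  | 4 => eis4 chim3 3 chim4 4 n
  | 5 => at2z (eis4 chi_one 1 chi12 12) n
  | 6 => at2z (eis4 chi12 12 chi_one 1) n
  | 7 => at2z (eis4 chim4 4 chim3 3) n
  | 8 => at2z (eis4 chim3 3 chim4 4) n
  | 9 => etaq_coef v1 n
  | 10 => etaq_coef v2 n
  | 11 => etaq_coef v3 n
  | 12 => etaq_coef v4 n
  | 13 => at2z (etaq_coef v1) n
  | 14 => at2z (etaq_coef v2) n
  | 15 => at2z (etaq_coef v3) n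
  | 16 => at2z (etaq_coef v4) n
  | _ => 0
  end.

Definition gamma_num (a1 a2 a3 a4 b1 b2 : nat) : seq int :=
  match a1, a2, a3, a4, b1, b2 with
  | 1, 1, 1, 3, 1, 1 => [:: 1; 288; 32; 9; 0; 0; 0; 0; 84; 720; 336; 864; 0; 0; 0; 0]
  | 1, 1, 1, 3, 1, 2 => [:: 1; 144; -16; -9; 0; 0; 0; 0; 156; -48; -168; -456; 0; 0; 0; 0]
  | 1, 1, 1, 3, 1, 4 => [:: 1; 72; 8; 9; 0; 0; 0; 0; 186; 600; -228; 372; 0; 0; 0; 0]
  | 1, 1, 1, 3, 2, 2 => [:: 1; 72; 8; 9; 0; 0; 0; 0; 48; 48; 48; 96; 0; 0; 0; 0]
  | 1, 1, 1, 3, 2, 4 => [:: 1; 36; -4; -9; 0; 0; 0; 0; 114; 84; -120; -156; 0; 0; 0; 0]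
  | 1, 1, 1, 3, 4, 4 => [:: 1; 18; 2; 9; 0; 0; 0; 0; 108; 156; -162; 42; 0; 0; 0; 0]
  | 1, 2, 2, 3, 1, 1 => [:: 0; 144; 16; 0; 1; 0; 0; -9; 162; 264; -1188; 420; 192; 864; -4704; -5760]
  | 1, 2, 2, 3, 1, 2 => [:: 0; 72; -8; 0; 1; 0; 0; 9; 120; 96; 336; -384; -240; -912; 4368; 2784]
  | 1, 2, 2, 3, 1, 4 => [:: 0; 36; 4; 0; 1; 0; 0; -9; 144; 480; -504; 312; -360; 1416; -1944; -1344]
  | 1, 2, 2, 3, 2, 2 => [:: 0; 36; 4; 0; 1; 0; 0; -9; 6; -72; -228; 36; 192; -240; -1392; -1344]
  | 1, 2, 2, 3, 2, 4 => [:: 0; 18; -2; 0; 1; 0; 0; 9; 30; 24; 84; -96; 36; -360; 504; 576]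
  | 1, 2, 2, 3, 4, 4 => [:: 0; 9; 1; 0; 1; 0; 0; -9; 36; 120; -126; 78; -84; 312; -840; -240]
  | 1, 3, 3, 3, 1, 1 => [:: 1; 96; -32; -3; 0; 0; 0; 0; 260; 352; -544; -352; 0; 0; 0; 0]
  | 1, 3, 3, 3, 1, 2 => [:: 1; 48; 16; 3; 0; 0; 0; 0; 116; 160; -40; 104; 0; 0; 0; 0]
  | 1, 3, 3, 3, 1, 4 => [:: 1; 24; -8; -3; 0; 0; 0; 0; 170; 16; -292; -340; 0; 0; 0; 0]
  | 1, 3, 3, 3, 2, 2 => [:: 1; 24; -8; -3; 0; 0; 0; 0; 32; 16; -16; -64; 0; 0; 0; 0]
  | 1, 3, 3, 3, 2, 4 => [:: 1; 12; 4; 3; 0; 0; 0; 0; 26; 76; 32; 116; 0; 0; 0; 0]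
  | 1, 3, 3, 3, 4, 4 => [:: 1; 6; -2; -3; 0; 0; 0; 0; 44; -68; -22; -130; 0; 0; 0; 0]
  | _, _, _, _, _, _ => [::]
  end.

Definition gamma (a1 a2 a3 a4 b1 b2 i : nat) : rat :=
  (nth 0 (gamma_num a1 a2 a3 a4 b1 b2) i.-1)%:~R / 23.

(* Main.v *)
Require Import Defs.
From HB Require Import structures.
From mathcomp Require Import all_boot all_order all_algebra algC.
From mathcomp Require Import classical_sets boolp fsbigop.
From mathcomp Require Import zify ring.
Import Order.TTheory GRing.Theory Num.Theory.
Local Open Scope ring_scope.
Set Implicit Arguments. Unset Strict Implicit. Unset Printing Implicit Defensive.

(** The proof is elementary and uses no modular forms.  Put A = phi(q), C = phi(-q),
    B = phi(q^3), D = phi(-q^3), r = A/B, and let a(q) be the theta series of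
    x^2 + xy + y^2.  The theta relations of levels 2 and 3, and an invariance
    argument under q -> q^2 applied to logarithmic derivatives, express A^2, B^2, C^2,
    D^2, AB, CD, a(q), a(q^2), a(q^4), as well as the values at q^2 of these series,
    as t times polynomials in r and mu, where t = B^2/(8r) and
    mu^2 = (3 - r^2)(1 + r^2).  By the products for phi and psi the eta quotients are
    polynomials in the same theta functions.

    For the Eisenstein series, let t_k = z q^(a + bk) with k in Z, e_k = 1/(1 - t_k) and
    f_k = e_k^2 - e_k.  Since e_i e_j is a combination of e_i and e_j with coefficients
    depending on j - i only, the regularized sums E, F of e_k, f_k satisfy a relation
    E^2 + (1 - 2a/b) E = F + (weight 2 terms), and the sums R of f_k + 6 f_k^2 at two
    values of (z, a) satisfy R_1 - R_2 = (F_1 - F_2)(6 (F_1 + F_2) + 1 - 24 S(q^b)).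
    For z a twelfth root of unity the differences R_1 - R_2 and F_1 - F_2 are multiples
    of an E_{4,chi,psi} and of its weight 2 analogue; the latter then factors into
    weight 1 series, that is, into theta functions.

    Both sides of the 18 identities thus become t^4 times elements of Q[r, mu], and the
    theorem reduces to polynomial identities. *)

(** The obstacle is that neither a weight 4 Eisenstein series with character nor its weight 2
    analogue is visibly a product of theta functions. Only differences factor. The correction term
    in the relation for R depends on b alone, so subtracting at two points removes it and leaves a
    difference of squares; in weight 2, E_1^2 - E_2^2 = (E_1 - E_2)(E_1 + E_2) is a product of two
    weight 1 series. The two points are conjugate (z and z^5, or x and x^-1) or, at z = 1, the
    classes 1 and 5 modulo 12, so that a single series H survives in R_1 - R_2. The remaining
    divisor sums S(q^j) are combinations of A^4, B^4, C^4, D^4 and a(q)^2. Formal power series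
    replace analysis: they form an integral domain, so factors cancel, a square root is fixed by its
    constant term, and an equation linking q and q^2 is settled by comparing lowest terms. The
    points require a primitive twelfth root of unity, hence coefficients in a field K; it is [algC]
    at the end, and the identity descends to the rationals because [ratr] is injective. *)

(** * Formal power series: ring, substitution q -> q^j, derivation q d/dq *)

Record fps (K : Type) := Fps { cf : nat -> K }.

HB.instance Definition _ (K : Type) := gen_eqMixin (fps K).
HB.instance Definition _ (K : Type) := gen_choiceMixin (fps K).

Lemma fpsP (K : Type) (f g : fps K) : (forall n, cf f n = cf g n) -> f = g.
Proof. by case: f g => [f] [g] /= /funext ->. Qed.

Arguments cf {K} f n%_nat_scope.

Section FpsRing.
Variable K : fieldType.
Implicit Types f g h : fps K.

Definition fps_zero : fps K := Fps (fun=> 0).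
Definition fps_one : fps K := Fps (fun n => (n == 0%N)%:R).
Definition fps_add f g := Fps (fun n => cf f n + cf g n).
Definition fps_opp f := Fps (fun n => - cf f n).
Definition fps_mul f g := Fps (fun n => \sum_(i < n.+1) cf f i * cf g (n - i)%N).

(** Each coefficient of a product involves finitely many terms, so ring laws are transferred from
    truncations in [{poly K}] instead of being proved on double sums. *)
Definition tpoly N f : {poly K} := \poly_(i < N.+1) cf f i.

Lemma coef_tpoly N f n : (n <= N)%N -> (tpoly N f)`_n = cf f n.
Proof. by move=> le; rewrite coef_poly ltnS le. Qed.

Lemma cf_mul_tpoly N f g n : (n <= N)%N ->
  cf (fps_mul f g) n = (tpoly N f * tpoly N g)`_n.
Proof.
move=> le; rewrite coefM; apply: eq_bigr => i _.
by rewrite !coef_tpoly // ?(leq_trans (leq_subr _ _)) // (leq_trans _ le) // -ltnS.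
Qed.

Lemma coef_mul_eqn (p p' r r' : {poly K}) n :
  (forall i, (i <= n)%N -> p`_i = p'`_i) ->
  (forall i, (i <= n)%N -> r`_i = r'`_i) -> (p * r)`_n = (p' * r')`_n.
Proof.
move=> pE rE; rewrite !coefM; apply: eq_bigr => i _.
by rewrite pE ?rE ?leq_subr // -ltnS.
Qed.

Fact fps_addA : associative fps_add.
Proof. by move=> f g h; apply: fpsP => n /=; rewrite addrA. Qed.
Fact fps_addC : commutative fps_add.
Proof. by move=> f g; apply: fpsP => n /=; rewrite addrC. Qed.
Fact fps_add0 : left_id fps_zero fps_add.
Proof. by move=> f; apply: fpsP => n /=; rewrite add0r. Qed.
Fact fps_addN : left_inverse fps_zero fps_opp fps_add.
Proof. by move=> f; apply: fpsP => n /=; rewrite addNr. Qed.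

HB.instance Definition _ :=
  GRing.isZmodule.Build (fps K) fps_addA fps_addC fps_add0 fps_addN.

Fact fps_mulC : commutative fps_mul.
Proof.
by move=> f g; apply: fpsP => n; rewrite !(@cf_mul_tpoly n) // mulrC.
Qed.
Fact fps_mulA : associative fps_mul.
Proof.
move=> f g h; apply: fpsP => n; rewrite !(@cf_mul_tpoly n) //.
transitivity ((tpoly n f * (tpoly n g * tpoly n h))`_n).
  apply: coef_mul_eqn => // i le; rewrite coef_tpoly //.
  by rewrite (@cf_mul_tpoly n).
rewrite mulrA; apply: coef_mul_eqn => // i le; rewrite coef_tpoly //.
by rewrite (@cf_mul_tpoly n).
Qed.
Fact fps_mul1 : left_id fps_one fps_mul.
Proof.
move=> f; apply: fpsP => n /=; rewrite big_ord_recl /= mul1r subn0.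
by rewrite big1 ?addr0 // => i _; rewrite mul0r.
Qed.
Fact fps_mulDl : left_distributive fps_mul fps_add.
Proof.
move=> f g h; apply: fpsP => n /=; rewrite -big_split /=.
by apply: eq_bigr => i _; rewrite mulrDl.
Qed.
Fact fps_one_neq0 : fps_one != fps_zero.
Proof. by apply/eqP => /(congr1 (@cf _)) /(congr1 (@^~ 0%N)) /eqP /=; rewrite oner_eq0. Qed.

HB.instance Definition _ := GRing.Zmodule_isComNzRing.Build (fps K)
  fps_mulA fps_mulC fps_mul1 fps_mulDl fps_one_neq0.

Lemma cf0 n : cf (0 : fps K) n = 0. Proof. by []. Qed.
Lemma cf1 n : cf (1 : fps K) n = (n == 0%N)%:R. Proof. by []. Qed.
Lemma cfD f g n : cf (f + g) n = cf f n + cf g n. Proof. by []. Qed.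
Lemma cfN f n : cf (- f) n = - cf f n. Proof. by []. Qed.
Lemma cfB f g n : cf (f - g) n = cf f n - cf g n. Proof. by []. Qed.
Lemma cfM f g n : cf (f * g) n = \sum_(i < n.+1) cf f i * cf g (n - i)%N.
Proof. by []. Qed.
Lemma cfM_tpoly N f g n : (n <= N)%N ->
  cf (f * g) n = (tpoly N f * tpoly N g)`_n.
Proof. exact: cf_mul_tpoly. Qed.
Lemma cf_sum (I : Type) (r : seq I) (P : pred I) (F : I -> fps K) n :
  cf (\sum_(i <- r | P i) F i) n = \sum_(i <- r | P i) cf (F i) n.
Proof. by elim/big_rec2: _ => // i y x _ <-. Qed.
Lemma cfMn f k n : cf (f *+ k) n = cf f n *+ k.
Proof. by elim: k => [|k IH]; rewrite ?mulr0n // !mulrS cfD IH. Qed.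
Lemma cf0M f g : cf (f * g) 0 = cf f 0 * cf g 0.
Proof. by rewrite cfM big_ord_recl big_ord0 addr0. Qed.
Lemma cf0X f k : cf (f ^+ k) 0 = cf f 0 ^+ k.
Proof. by elim: k => [|k IH]; rewrite ?expr0 // !exprS cf0M IH. Qed.
Lemma cf0nat k : cf (k%:R : fps K) 0 = k%:R.
Proof. by rewrite cfMn cf1. Qed.

(** Congruence modulo q^N, in the role of a topology: an infinite sum or product is compared with
    its partial sums or products up to this relation, for every N. *)
Definition eqm N f g := forall n, (n < N)%N -> cf f n = cf g n.

Arguments eqm N%_nat_scope f g.

Lemma eqm_refl N f : eqm N f f. Proof. by []. Qed.
Lemma eqm_sym N f g : eqm N f g -> eqm N g f.
Proof. by move=> e n lt; rewrite e. Qed.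
Lemma eqm_trans N g f h : eqm N f g -> eqm N g h -> eqm N f h.
Proof. by move=> e e' n lt; rewrite e ?e'. Qed.
Lemma eqm_le M N f g : (M <= N)%N -> eqm N f g -> eqm M f g.
Proof. by move=> le e n lt; apply: e; apply: leq_trans le. Qed.
Lemma eqmP f g : (forall N, eqm N f g) -> f = g.
Proof. by move=> e; apply: fpsP => n; apply: (e n.+1). Qed.
Lemma eqmD N f f' g g' : eqm N f f' -> eqm N g g' -> eqm N (f + g) (f' + g').
Proof. by move=> e e' n lt; rewrite !cfD e ?e'. Qed.
Lemma eqmN N f f' : eqm N f f' -> eqm N (- f) (- f').
Proof. by move=> e n lt; rewrite !cfN e. Qed.
Lemma eqmB N f f' g g' : eqm N f f' -> eqm N g g' -> eqm N (f - g) (f' - g').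
Proof. by move=> e e'; apply/eqmD/eqmN. Qed.
Lemma eqmM N f f' g g' : eqm N f f' -> eqm N g g' -> eqm N (f * g) (f' * g').
Proof.
move=> e e' n lt; rewrite !cfM; apply: eq_bigr => i _.
by rewrite e ?e' // ?(leq_ltn_trans (leq_subr _ _)) // (leq_ltn_trans _ lt) // -ltnS.
Qed.
Lemma eqmX N f f' k : eqm N f f' -> eqm N (f ^+ k) (f' ^+ k).
Proof. by move=> e; elim: k => // k IH; rewrite !exprS; apply: eqmM. Qed.
Lemma eqm0M M N f g : eqm M f 0 -> eqm N g 0 -> eqm (M + N) (f * g) 0.
Proof.
move=> f0 g0 n lt; rewrite cfM big1 // => i _.
have [ltM|geM] := ltnP i M; first by rewrite f0 // mul0r.
by rewrite g0 ?mulr0 //; have := ltn_ord i; lia.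
Qed.
Lemma eqm0X N f k : eqm N f 0 -> eqm (N * k) (f ^+ k) 0.
Proof.
move=> f0; elim: k => [|k IH]; first by rewrite muln0 => n.
by rewrite mulnS exprS; apply: eqm0M.
Qed.
(* 1/f as c times the geometric series in g = 1 - c f. *)
Definition fps_inv f : fps K :=
  let c := (cf f 0)^-1 in
  let g := Fps (fun n => (n == 0%N)%:R - c * cf f n) in
  Fps (fun n => c * cf (\sum_(k < n.+1) g ^+ k) n).
Definition fps_unit : pred (fps K) := [pred f | cf f 0 != 0].
Definition fps_inv_tot f := if fps_unit f then fps_inv f else f.

Fact fps_mulVr : {in fps_unit, left_inverse 1 fps_inv_tot *%R}.
Proof.
move=> f f0; rewrite /fps_inv_tot ifT //; move: f0; rewrite inE => f0.
rewrite /fps_inv; set c := (cf f 0)^-1.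
pose g := Fps (fun n => (n == 0%N)%:R - c * cf f n).
rewrite -/g.
have g0 : eqm 1 g 0 by case=> // _; rewrite /g /= /c mulVf // subrr.
pose C := Fps (fun n => (n == 0%N)%:R * c).
have CE h n : cf (C * h) n = c * cf h n.
  rewrite cfM big_ord_recl /= mul1r subn0.
  by rewrite big1 ?addr0 // => i _; rewrite !mul0r.
have fE : C * f = 1 - g by apply: fpsP => n; rewrite CE /= opprB addrC subrK.
apply: eqmP => N.
(* Modulo q^N all the geometric sums agree with the one cut at N, since g^k = O(q^k); multiplied by
   1 - g it telescopes to 1 - g^N. *)
apply: (@eqm_trans _ (C * (\sum_(k < N) g ^+ k) * f)).
  apply: eqmM => // n lt; rewrite CE [LHS]/=; congr (_ * _).
  rewrite -!(big_mkord xpredT (fun k => g ^+ k)) (@big_cat_nat _ _ _ n.+1 0 N) //.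
  rewrite cfD [X in _ = _ + X]cf_sum [X in _ = _ + X]big_nat_cond.
  rewrite [X in _ = _ + X]big1 ?addr0 // => i /andP[/andP[le _] _].
  by have := @eqm0X _ _ i g0 n; rewrite mul1n => /(_ le).
rewrite mulrAC fE -opprB mulNr -subrX1 opprB => n lt.
have := @eqm0X _ _ N g0 n; rewrite mul1n => /(_ lt) e.
by rewrite cfB e cf0 subr0.
Qed.

Fact fps_unitPl f g : g * f = 1 -> fps_unit f.
Proof.
move=> /(congr1 (fun h => cf h 0)); rewrite cf0M => e /=.
by apply: contra_eq_neq e => ->; rewrite mulr0 eq_sym oner_neq0.
Qed.
Fact fps_inv_out : {in [predC fps_unit], fps_inv_tot =1 id}.
Proof. by move=> f nu; rewrite /fps_inv_tot ifF //; apply/negbTE. Qed.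

HB.instance Definition _ := GRing.ComNzRing_hasMulInverse.Build (fps K)
  fps_mulVr fps_unitPl fps_inv_out.

Lemma unit_fps f : (f \is a GRing.unit) = (cf f 0 != 0). Proof. by []. Qed.

Lemma fps_low f : f != 0 -> exists2 n, cf f n != 0 & eqm n f 0.
Proof.
move=> f0; have ex : exists n, cf f n != 0.
  apply: contra_notP (negP f0) => /forallNP all0; apply/eqP/fpsP => n.
  by apply/eqP; rewrite -[_ == _]negbK; apply/negP/all0.
case: (ex_minnP ex) => n n0 nmin; exists n => // m lt.
by apply/eqP; apply: contraTT lt; rewrite -leqNgt; apply: nmin.
Qed.

Lemma cf_mul_low f g m n : eqm m f 0 -> eqm n g 0 ->
  cf (f * g) (m + n) = cf f m * cf g n.
Proof.
move=> f0 g0; rewrite cfM (bigD1 (inord m)) //= inordK ?ltnS ?leq_addr //.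
rewrite addKn big1 ?addr0 // => i /eqP ne.
have [lt|ge] := ltnP i m; first by rewrite f0 // mul0r.
rewrite g0 ?mulr0 // ltn_subLR; last by rewrite -ltnS.
rewrite ltn_add2r ltn_neqAle ge andbT; apply/eqP => e; apply: ne.
by apply: val_inj; rewrite /= inordK ?e // ltnS -e leq_addr.
Qed.

Fact fps_idomain : GRing.integral_domain_axiom (fps K).
Proof.
move=> f g fg0; apply/norP => -[/fps_low[m fm f0] /fps_low[n gn g0]].
have := cf_mul_low f0 g0; rewrite fg0 cf0 => /esym/eqP.
by rewrite mulf_eq0 (negbTE fm) (negbTE gn).
Qed.

HB.instance Definition _ := GRing.ComUnitRing_isIntegral.Build (fps K) fps_idomain.

Definition fC (c : K) : fps K := Fps (fun n => (n == 0%N)%:R * c).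

Lemma cfC c n : cf (fC c) n = (n == 0%N)%:R * c. Proof. by []. Qed.
Lemma cfCM c f n : cf (fC c * f) n = c * cf f n.
Proof.
rewrite cfM big_ord_recl cfC mul1r subn0.
by rewrite big1 ?addr0 // => i _; rewrite cfC !mul0r.
Qed.
Fact fC_additive : {morph fC : x y / x - y}.
Proof. by move=> x y; apply: fpsP => n; rewrite /= mulrBr. Qed.
Fact fC_multiplicative : monoid_morphism fC.
Proof.
split; first by apply: fpsP => n; rewrite cfC mulr1.
by move=> x y; apply: fpsP => n; rewrite cfCM !cfC mulrCA.
Qed.
HB.instance Definition _ :=
  GRing.isZmodMorphism.Build K (fps K) fC fC_additive.
HB.instance Definition _ :=
  GRing.isMonoidMorphism.Build K (fps K) fC fC_multiplicative.

Definition fX k : fps K := Fps (fun n => (n == k)%:R).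
Arguments fX k%_nat_scope.
Lemma cfXM k f n : cf (fX k * f) n = if (k <= n)%N then cf f (n - k)%N else 0.
Proof.
rewrite cfM; case: leqP => [le|lt].
  rewrite (bigD1 (inord k)) //= inordK ?ltnS // eqxx mul1r big1 ?addr0 // => i ne.
  by case: eqP => [e|]; [rewrite -e inord_val eqxx in ne|rewrite mul0r].
by rewrite big1 // => i _; rewrite /=; case: eqP => e; rewrite ?mul0r //; have := ltn_ord i; lia.
Qed.
Lemma fX0 : fX 0 = 1. Proof. by []. Qed.
Lemma fXD (j k : nat) : fX (j + k)%N = fX j * fX k.
Proof.
apply: fpsP => n; rewrite cfXM /=; case: leqP => le.
  by have -> : (n == j + k)%N = (n - j == k)%N by lia.
by have -> : (n == j + k)%N = false by lia.
Qed.
Lemma fXM j k : fX (j * k) = fX j ^+ k.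
Proof. by elim: k => [|k IH]; rewrite ?muln0 // mulnS exprS fXD IH. Qed.
Lemma eqm_fX k f : eqm k (fX k * f) 0.
Proof. by move=> n lt; rewrite cfXM leqNgt lt. Qed.
Lemma fX_neq0 k : fX k != 0.
Proof. by apply/eqP => /(congr1 (fun f => cf f k)) /eqP; rewrite /= eqxx oner_eq0. Qed.

(** The Euler operator q d/dq: unlike d/dq it keeps f = O(q^N), and it commutes with q -> q^j up to
    the factor j. *)
Definition fD f := Fps (fun n => n%:R * cf f n).
Fact fD_additive : {morph fD : f g / f - g}.
Proof. by move=> f g; apply: fpsP => n; rewrite /= mulrBr. Qed.
HB.instance Definition _ :=
  GRing.isZmodMorphism.Build (fps K) (fps K) fD fD_additive.
Lemma fDM f g : fD (f * g) = fD f * g + f * fD g.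
Proof.
apply: fpsP => n /=; rewrite mulr_sumr -big_split /=; apply: eq_bigr => i _.
have /subnKC {1}<- : (i <= n)%N by rewrite -ltnS.
by rewrite natrD; ring.
Qed.
Lemma fDC c : fD (fC c) = 0.
Proof. by apply: fpsP => -[|n] /=; rewrite !mul0r ?mulr0. Qed.
Lemma fD1 : fD 1 = 0.
Proof. by rewrite -(rmorph1 fC) fDC. Qed.
Lemma fDX f k : fD (f ^+ k.+1) = k.+1%:R * f ^+ k * fD f.
Proof.
elim: k => [|k IH]; first by rewrite !mul1r.
by rewrite exprS fDM IH exprS -[k.+2]addn1 natrD; ring.
Qed.

Definition fsub j f := Fps (fun n => if (j %| n)%N then cf f (n %/ j) else 0).
Arguments fsub j%_nat_scope f.
Lemma fsub_tpoly j N f n : (0 < j)%N -> (n <= N)%N ->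
  (tpoly N f \Po 'X^j)`_n = cf (fsub j f) n.
Proof.
move=> j0 le; rewrite coef_comp_poly_Xn //=; case: ifP => // _.
by rewrite coef_tpoly // (leq_trans (leq_div _ _)).
Qed.
Lemma fsubE j f n : (0 < j)%N -> cf (fsub j f) (j * n) = cf f n.
Proof. by move=> j0; rewrite /= dvdn_mulr // mulKn. Qed.
Lemma fsub1 f : fsub 1 f = f.
Proof. by apply: fpsP => n; rewrite /= dvd1n divn1. Qed.
Lemma cf_fsub0 j f : cf (fsub j f) 0 = cf f 0.
Proof. by rewrite /= dvdn0 div0n. Qed.
Lemma fsub_fsub i j f : (0 < i)%N -> (0 < j)%N -> fsub i (fsub j f) = fsub (i * j) f.
Proof.
move=> i0 j0; apply: fpsP => n /=.
have [/dvdnP[m ->]|nd] := boolP (i %| n)%N; last first.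
  by case: ifP => // /(dvdn_trans (dvdn_mulr j (dvdnn i))) d; rewrite d in nd.
by rewrite mulnK // [(m * i)%N]mulnC dvdn_pmul2l // divnMl.
Qed.
Fact fsub_additive j : {morph fsub j : f g / f - g}.
Proof. by move=> f g; apply: fpsP => n; rewrite /=; case: ifP; rewrite ?subr0. Qed.
HB.instance Definition _ j :=
  GRing.isZmodMorphism.Build (fps K) (fps K) (fsub j) (@fsub_additive j).
Fact fsub_multiplicative j : monoid_morphism (fsub j.+1).
Proof.
split=> [|f g]; apply: fpsP => n.
  rewrite /=; case: ifP => [/dvdnP[m ->]|]; last by case: n => //; rewrite dvdn0.
  by rewrite mulnK // muln_eq0 orbF.
rewrite [RHS](@cfM_tpoly n) // /=.
transitivity ((((tpoly n f * tpoly n g) \Po 'X^(j.+1))`_n)); last first.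
  rewrite rmorphM /=; apply: coef_mul_eqn => i le; rewrite coef_tpoly //.
    by rewrite (@fsub_tpoly _ n).
  by rewrite (@fsub_tpoly _ n).
rewrite coef_comp_poly_Xn //; case: ifP => // _.
by rewrite -(@cfM_tpoly n) // leq_div.
Qed.
HB.instance Definition _ j :=
  GRing.isMonoidMorphism.Build (fps K) (fps K) (fsub j.+1) (@fsub_multiplicative j).
Lemma fsubM j f g : (0 < j)%N -> fsub j (f * g) = fsub j f * fsub j g.
Proof. by case: j => // j _; rewrite rmorphM. Qed.
Lemma fsubXn j f k : (0 < j)%N -> fsub j (f ^+ k) = fsub j f ^+ k.
Proof. by case: j => // j _; rewrite rmorphXn. Qed.
Lemma fsub_fC j c : (0 < j)%N -> fsub j (fC c) = fC c.
Proof.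
move=> j0; apply: fpsP => -[|n] /=; first by rewrite dvdn0 div0n.
rewrite mul0r; case: ifP => // /dvdnP[[|m] e]; first by rewrite mul0n in e.
by rewrite e mulnK // mul0r.
Qed.
Lemma fsub_fX j k : (0 < j)%N -> fsub j (fX k) = fX (j * k).
Proof.
move=> j0; apply: fpsP => n /=; case: ifP => [/dvdnP[m ->]|nd].
  by rewrite mulnK // [(m * j)%N]mulnC eqn_pmul2l.
by case: eqP => // e; rewrite e dvdn_mulr in nd.
Qed.
Lemma fD_fsub j f : (0 < j)%N -> fD (fsub j f) = j%:R * fsub j (fD f).
Proof.
move=> j0; apply: fpsP => n; rewrite mulr_natl cfMn /=.
case: ifP => [/dvdnP[m ->]|]; last by rewrite mulr0 mul0rn.
by rewrite mulnK // natrM mulrAC mulr_natr.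
Qed.
Lemma eqm_fsub j N f g : (0 < j)%N -> eqm N f g -> eqm (j * N) (fsub j f) (fsub j g).
Proof.
move=> j0 e n lt /=; case: ifP => // /dvdnP[m nE].
by rewrite nE mulnK //; apply: e; move: lt; rewrite nE mulnC ltn_pmul2l.
Qed.
Lemma eqm_fsub1 j N f g : (0 < j)%N -> eqm N f g -> eqm N (fsub j f) (fsub j g).
Proof. by move=> j0 /(eqm_fsub j0); apply: eqm_le; rewrite leq_pmull. Qed.

End FpsRing.

Arguments eqm_trans {K N} g {f h}.

(** * Generating series of weighted integer-valued forms *)

Section WeightedTheta.
Variable K : numFieldType.

Section General.
Variable I : choiceType.
Implicit Types (w : I -> K) (Q : I -> int).

(** The theta series with terms w(i) q^(Q i). A sum over an infinite support is 0 by default;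
    [posfinite] rules this out. *)
Definition gsum w Q : fps K :=
  Fps (fun n => \sum_(i \in [set i | Q i = n%:Z]%classic) w i).

Definition posfinite Q := (forall i, 0 <= Q i) /\
  forall n : nat, exists r : seq I, forall i, Q i <= n%:Z -> i \in r.

Lemma cf_gsum w Q (r : seq I) n : uniq r ->
  (forall i, Q i = n%:Z -> i \in r) ->
  cf (gsum w Q) n = \sum_(i <- r) (Q i == n%:Z)%:R * w i.
Proof.
move=> ur rP /=.
transitivity (\sum_(i \in [set i | Q i = n%:Z]%classic) (Q i == n%:Z)%:R * w i).
  by apply: eq_fsbigr => i /set_mem /= ->; rewrite eqxx mul1r.
apply: fsbig_fwiden => //.
by move=> i [_ /= /eqP ne]; rewrite (negbTE ne) mul0r.
Qed.

Lemma posfinite_enum Q n : posfinite Q ->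
  exists2 r : seq I, uniq r & forall i, Q i <= n%:Z -> i \in r.
Proof.
by case=> _ /(_ n)[r rP]; exists (undup r); rewrite ?undup_uniq // => i /rP; rewrite mem_undup.
Qed.

Lemma gsumD w w' Q : posfinite Q ->
  gsum (fun i => w i + w' i) Q = gsum w Q + gsum w' Q.
Proof.
move=> pQ; apply: fpsP => n; have [r ur rP] := posfinite_enum n pQ.
have rP' i : Q i = n%:Z -> i \in r by move=> e; rewrite rP // e.
rewrite cfD !(cf_gsum _ ur rP') -big_split /=.
by apply: eq_bigr => i _; rewrite mulrDr.
Qed.

Lemma gsumZ c w Q : gsum (fun i => c * w i) Q = fC c * gsum w Q.
Proof. by apply: fpsP => n; rewrite cfCM /= mulr_fsumr. Qed.

Lemma eq_gsum w w' Q Q' : w =1 w' -> Q =1 Q' -> gsum w Q = gsum w' Q'.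
Proof. by move=> /funext -> /funext ->. Qed.

Lemma gsumN w Q : gsum (fun i => - w i) Q = - gsum w Q.
Proof.
rewrite -[RHS]mul1r mulrN -mulNr -(rmorph1 (@fC K)) -rmorphN -gsumZ.
by apply: eq_gsum => // i; rewrite mulN1r.
Qed.

Lemma fsub_gsum j w Q : (0 < j)%N ->
  fsub j (gsum w Q) = gsum w (fun i => j%:Z * Q i).
Proof.
move=> j0; apply: fpsP => n /=; case: ifP => [/dvdnP[m ->]|nd].
  rewrite mulnK //; apply: eq_fsbigl; apply/seteqP; split=> i /=.
    by move=> ->; rewrite PoszM mulrC.
  by rewrite PoszM mulrC => /mulIf; apply; rewrite eqz_nat -lt0n.
rewrite fsbig1 // => i /= e; case/negP: (negbT nd).
by have := dvdz_mulr (Q i) (dvdzz j%:Z); rewrite e.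
Qed.

Lemma fX_gsum k w Q : posfinite Q ->
  fX K k * gsum w Q = gsum w (fun i => k%:Z + Q i).
Proof.
move=> [Q0 _]; apply: fpsP => n; rewrite cfXM /=; case: leqP => le.
  by apply: eq_fsbigl; apply/seteqP; split=> i /=; lia.
by rewrite fsbig1 // => i /= e; have := Q0 i; lia.
Qed.

End General.

(** Only the support of w has to be reached. Changes of variables onto a sublattice or a coset thus
    apply directly once a weight such as 1 + (-1)^(x+y) vanishes off it. *)
Lemma gsum_reindex (I J : choiceType) (h : J -> I) (w : I -> K) (Q : I -> int) :
  injective h -> (forall i, w i != 0 -> exists j, h j = i) ->
  gsum w Q = gsum (w \o h) (Q \o h).
Proof.
move=> hI hS; apply: fpsP => n /=.
rewrite -(@fsbig_image _ _ _ _ _ [set j | Q (h j) = n%:Z]%classic h w); last first.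
  by move=> x y _ _; apply: hI.
apply/esym/fsbig_widen => [_ [j /= e <-] //|i [/= e ne]].
by apply/eqP; apply: contra_notT ne => /hS[j hj]; exists j; rewrite /= ?hj.
Qed.

Lemma posfinite_pair (I J : choiceType) (Q : I -> int) (Q' : J -> int) :
  posfinite Q -> posfinite Q' -> posfinite (fun p : I * J => Q p.1 + Q' p.2).
Proof.
move=> [Q0 Qf] [Q0' Qf']; split=> [p|n]; first by rewrite addr_ge0.
have [r rP] := Qf n; have [r' rP'] := Qf' n.
exists (allpairs pair r r') => -[i j] /= le.
by have i0 := Q0 i; have j0 := Q0' j; apply: allpairs_f; [apply: rP|apply: rP']; lia.
Qed.

Lemma gsumM (I J : choiceType) (w : I -> K) (w' : J -> K) Q Q' :
  posfinite Q -> posfinite Q' ->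
  gsum w Q * gsum w' Q' =
  gsum (fun p : I * J => w p.1 * w' p.2) (fun p => Q p.1 + Q' p.2).
Proof.
move=> pQ pQ'; apply: fpsP => n.
have [r ur rP] := posfinite_enum n pQ; have [r' ur' rP'] := posfinite_enum n pQ'.
have i0 := proj1 pQ; have j0 := proj1 pQ'.
rewrite (@cf_gsum _ _ _ (allpairs pair r r') n); first last.
- move=> [i j] /= e; have := i0 i; have := j0 j => ? ?.
  by apply: allpairs_f; [apply: rP|apply: rP']; lia.
- by apply: allpairs_uniq => // -[i j] [i' j'] _ _.
rewrite cfM big_allpairs_dep.
(* The Cauchy product is expanded with indicators; after exchanging sums, a pair (i, j) with Q i +
   Q' j = n meets exactly one k, namely Q i. *)
transitivity (\sum_(k < n.+1) \sum_(i <- r) \sum_(j <- r')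
    ((Q i == k%:Z) && (Q' j == (n - k)%:Z))%:R * (w i * w' j)).
  apply: eq_bigr => k _; have lk : (k <= n)%N by rewrite -ltnS.
  rewrite (cf_gsum _ ur); last by move=> i e; apply: rP; rewrite e lez_nat.
  rewrite (cf_gsum _ ur'); last by move=> j e; apply: rP'; rewrite e lez_nat leq_subr.
  rewrite big_distrl /=; apply: eq_bigr => i _.
  rewrite big_distrr /=; apply: eq_bigr => j _.
  by rewrite -mulnb natrM; ring.
rewrite exchange_big /=; apply: eq_bigr => i _.
rewrite exchange_big /=; apply: eq_bigr => j _.
rewrite -mulr_suml -natr_sum; congr (_%:R * _).
have := i0 i; have := j0 j => hj hi; case: eqP => e.
  have lt : (`|Q i| < n.+1)%N by lia.
  rewrite (bigD1 (Ordinal lt)) //= big1 => [|k /eqP ne].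
    by rewrite (_ : _ && _ = true) //; lia.
  apply/eqP; rewrite eqb0; apply/negP => /andP[/eqP e1 _]; apply: ne.
  by apply: val_inj; rewrite /= e1.
rewrite big1 // => k _; apply/eqP; rewrite eqb0; apply/negP => /andP[/eqP e1 /eqP e2].
by apply: e; rewrite e1 e2; have := ltn_ord k; lia.
Qed.

Lemma posfinite_int (Q : int -> int) :
  (forall x, 0 <= Q x) -> (forall x, `|x| <= Q x + 1) -> posfinite Q.
Proof.
move=> Q0 Qx; split=> // n.
exists [seq k%:Z - n.+1%:Z | k <- iota 0 (2 * n + 3)] => x le.
apply/mapP; exists (absz (x + n.+1%:Z)); rewrite ?mem_iota.
  by have := Qx x; lia.
by have := Qx x; lia.
Qed.

End WeightedTheta.

Arguments gsum {K I} w Q.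

(** * The theta series and the hexagonal form *)

Section ThetaSeries.
Variable K : numFieldType.

Definition one_wt (I : Type) (i : I) : K := 1.
Definition sgn (x : int) : K := if (2 %| x)%Z then 1 else -1.
Arguments one_wt {I} i.

Definition sqz (x : int) : int := x ^+ 2.
Definition trz (x : int) : int := x ^+ 2 + x.

(* The thetas of the text are A = phi(q), C = phi(-q), 2 psi(q^2) = trig and
   the hexagonal theta function a(q) = hexa. *)
Definition phi : fps K := gsum one_wt sqz.
Definition phim : fps K := gsum sgn sqz.
Definition trig : fps K := gsum one_wt trz.
Definition hexz (p : int * int) : int := p.1 ^+ 2 + p.1 * p.2 + p.2 ^+ 2.
Definition hexa : fps K := gsum one_wt hexz.

Lemma posfinite_sqz1 : posfinite sqz.
Proof. by apply: posfinite_int => x; rewrite /sqz; nia. Qed.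
Lemma posfinite_trz1 : posfinite trz.
Proof. by apply: posfinite_int => x; rewrite /trz; nia. Qed.
Lemma posfinite_hexz : posfinite hexz.
Proof.
split=> [[x y]|n]; first by rewrite /hexz /=; nia.
pose r := [seq k%:Z - (2 * n)%:Z | k <- iota 0 (4 * n + 1)].
have rP (x : int) : `|x| <= (2 * n)%:Z -> x \in r.
  move=> le; apply/mapP; exists (absz (x + (2 * n)%:Z)); rewrite ?mem_iota; lia.
exists (allpairs pair r r) => -[x y]; rewrite /hexz /= => le.
have hx : `|x| <= x ^+ 2 by nia.
have hy : `|y| <= y ^+ 2 by nia.
(* With Q = x^2 + x y + y^2 these squares are 4 Q - 3 x^2 and 4 Q - 3 y^2, which bounds both
   coordinates. *)
have h1 : 0 <= (x + 2 * y) ^+ 2 by rewrite sqr_ge0.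
have h2 : 0 <= (2 * x + y) ^+ 2 by rewrite sqr_ge0.
by apply: allpairs_f; apply: rP; nia.
Qed.

End ThetaSeries.

Arguments one_wt {K I} i.

(** * Theta relations of levels 2 and 3 from lattice decompositions *)

Section LatticeIdentities.
Variable K : numFieldType.
Local Notation phi := (phi K).
Local Notation phim := (phim K).
Local Notation trig := (trig K).
Local Notation hexa := (hexa K).
Local Notation sgn := (sgn K).

Lemma posfinite_scale (I : choiceType) c (Q : I -> int) :
  (0 < c)%N -> posfinite Q -> posfinite (fun i => c%:Z * Q i).
Proof.
move=> c0 [Q0 Qf]; split=> [i|n]; first exact: mulr_ge0.
by have [r rP] := Qf n; exists r => i le; apply: rP; have := Q0 i; nia.
Qed.

Lemma posfinite_shift (I : choiceType) (k : nat) (Q : I -> int) :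
  posfinite Q -> posfinite (fun i => k%:Z + Q i).
Proof.
move=> [Q0 Qf]; split=> [i|n]; first exact: addr_ge0.
by have [r rP] := Qf n; exists r => i le; apply: rP; lia.
Qed.

Lemma posfinite_pair2 (I J : choiceType) c c' (Q : I -> int) (Q' : J -> int) :
  (0 < c)%N -> (0 < c')%N -> posfinite Q -> posfinite Q' ->
  posfinite (fun p : I * J => c%:Z * Q p.1 + c'%:Z * Q' p.2).
Proof. by move=> c0 c0' pQ pQ'; exact: posfinite_pair (posfinite_scale c0 pQ) (posfinite_scale c0' pQ'). Qed.

Lemma fsub_gsumM (I J : choiceType) (w : I -> K) (w' : J -> K) c c'
    (Q : I -> int) (Q' : J -> int) :
  (0 < c)%N -> (0 < c')%N -> posfinite Q -> posfinite Q' ->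
  fsub c (gsum w Q) * fsub c' (gsum w' Q') =
  gsum (fun p => w p.1 * w' p.2) (fun p => c%:Z * Q p.1 + c'%:Z * Q' p.2).
Proof.
by move=> c0 c0' pQ pQ'; rewrite !fsub_gsum // gsumM //; apply: posfinite_scale.
Qed.

Lemma gsum_const (I : choiceType) (Q : I -> int) w :
  (forall i, w i = 2) -> gsum w Q = 2 * gsum (@one_wt K I) Q.
Proof.
move=> w2; have -> : 2 = fC 2 :> fps K by rewrite rmorph_nat.
by rewrite -gsumZ; apply: eq_gsum => // i; rewrite w2 mulr1.
Qed.

Let sgnE x y : sgn (x + y) = sgn x * sgn y.
Proof.
rewrite /sgn; case: ifP => e1; case: ifP => e2; case: ifP => e3; rewrite ?mulr1 ?mul1r ?mulrNN ?mul1r //; exfalso; lia.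
Qed.
Let sgn_refl x y : - sgn (-1 - x + y) = sgn (x + y).
Proof. by rewrite /sgn; case: ifP => e1; case: ifP => e2; rewrite ?opprK //; exfalso; lia. Qed.
Let sgn_even x : sgn (2 * x) = 1. Proof. by rewrite /sgn dvdz_mulr. Qed.
Let sgn_odd x : sgn (2 * x + 1) = -1.
Proof. by rewrite /sgn; case: ifP => //; lia. Qed.
Let wt_even x : 1 + sgn x != 0 -> exists u, x = 2 * u.
Proof.
by rewrite /sgn; case: ifP => [/dvdzP[u ->]|]; [exists u; rewrite mulrC|rewrite subrr eqxx].
Qed.
Let wt_odd x : 1 - sgn x != 0 -> exists u, x = 2 * u + 1.
Proof.
rewrite /sgn; case: ifP => e; first by rewrite subrr eqxx.
by exists ((x - 1) %/ 2)%Z; lia.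
Qed.
Let wt_even2 x : 1 + sgn (2 * x) = 2. Proof. by rewrite sgn_even. Qed.
Let wt_odd2 x : 1 - sgn (2 * x + 1) = 2. Proof. by rewrite sgn_odd opprK. Qed.

Let two_neq0 : 2 != 0 :> fps K.
Proof. by apply/eqP => /(congr1 (fun f => cf f 0)) /eqP; rewrite cf0nat pnatr_eq0. Qed.

(** Multiplication by 1 + i up to a reflection: it doubles x^2 + y^2, and its image is the
    sublattice x + y even. *)
Let rot (p : int * int) := (p.1 + p.2, p.1 - p.2).
Let rotI : injective rot.
Proof. by case=> [x y] [x' y'] [e1 e2]; congr pair; lia. Qed.
Let swap (p : int * int) := (p.2, p.1).
Let swapI : injective swap. Proof. by case=> [x y] [x' y'] [-> ->]. Qed.
(** x -> -1 - x fixes x^2 + x and changes the parity of x, so the two parity classes in a product of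
    [trig] series contribute equally. *)
Let refl (p : int * int) := (-1 - p.1, p.2).
Let reflI : injective refl. Proof. by case=> [x y] [x' y'] [e1 ->]; congr pair; lia. Qed.

#[local] Hint Resolve posfinite_sqz1 posfinite_trz1 posfinite_hexz : core.
Let oneM (p : int * int) : one_wt p.1 * one_wt p.2 = 1 :> K.
Proof. exact: mulr1. Qed.
Let one2 (x y : int) : one_wt x * one_wt y = 1 :> K.
Proof. exact: mulr1. Qed.

Let parity_split (s Q : int * int -> int) : posfinite Q ->
  2 * gsum (fun p => one_wt p.1 * one_wt p.2 : K) Q =
  gsum (fun p => 1 + sgn (s p)) Q + gsum (fun p => 1 - sgn (s p)) Q.
Proof.
move=> pQ; rewrite -gsumD //.
have -> : 2 = fC 2 :> fps K by rewrite rmorph_nat.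
by rewrite -gsumZ; apply: eq_gsum => // p; rewrite oneM; ring.
Qed.

(** The weights add up to 1 + (-1)^(x+y), twice the indicator of the sublattice that [rot]
    parametrizes. *)
Lemma phi_sqr_add_phim_sqr : phi ^+ 2 + phim ^+ 2 = 2 * fsub 2 phi ^+ 2.
Proof.
rewrite !expr2 -[in LHS](fsub1 phi) -[in LHS](fsub1 phim) !fsub_gsumM //.
rewrite -gsumD; last exact: posfinite_pair2.
rewrite (@gsum_reindex _ _ _ rot _ _ rotI); last first.
  move=> [x y] /=; rewrite one2 -sgnE => /wt_even[u /= e].
  by exists (u, x - u); congr pair => /=; lia.
rewrite gsum_const => [|[x y] /=]; last first.
  by rewrite mulr1 -sgnE -(wt_even2 x); congr (1 + sgn _); ring.
by congr (_ * _); apply: eq_gsum => -[x y] /=; rewrite ?one2 // /sqz; ring.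
Qed.

(** Symmetrizing under [swap] turns the weight (-1)^y into ((-1)^x + (-1)^y)/2, which vanishes off x
    + y even and becomes (-1)^(u+v) after [rot]. *)
Lemma phi_mul_phim : phi * phim = fsub 2 phim ^+ 2.
Proof.
apply: (mulfI two_neq0); rewrite expr2 -(fsub1 phi) -(fsub1 phim).
rewrite [phim]lock -lock !fsub_fsub // !fsub_gsumM //.
rewrite mulr_natl mulr2n.
rewrite [X in X + _ = _](@gsum_reindex _ _ _ swap _ _ swapI); last by move=> [x y]; exists (y, x).
rewrite (@eq_gsum _ _ _ (fun p => sgn p.1) _ (fun p => 1%N%:Z * sqz p.1 + 1%N%:Z * sqz p.2)); first last.
- by move=> p /=; rewrite addrC.
- by move=> p /=; rewrite mul1r.
rewrite -gsumD; last exact: posfinite_pair2.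
rewrite (@gsum_reindex _ _ _ rot _ _ rotI); last first.
  move=> [x y] /=; rewrite mul1r => ne.
  have /dvdzP[u e] : (2 %| x + y)%Z.
    apply: contraNT ne => nd; apply/eqP; rewrite /sgn.
    by case: ifP => e1; case: ifP => e2; rewrite ?subrr ?addNr //; exfalso; lia.
  by exists (u, x - u); congr pair => /=; lia.
have -> : 2 = fC 2 :> fps K by rewrite rmorph_nat.
rewrite -gsumZ; apply: eq_gsum => -[x y] /=; last by rewrite /sqz; ring.
rewrite mul1r /sgn; case: ifP => e1; case: ifP => e2; case: ifP => e3; case: ifP => e4; try ring; exfalso; lia.
Qed.

(** Here the odd coset survives, parametrized by (u + v + 1, u - v), where x^2 + y^2 = 1 + 2 (u^2 +
    u) + 2 (v^2 + v). *)
Lemma phi_sqr_sub_phim_sqr :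
  phi ^+ 2 - phim ^+ 2 = 2 * fX K 1 * fsub 2 trig ^+ 2.
Proof.
rewrite !expr2 -[in LHS](fsub1 phi) -[in LHS](fsub1 phim) !fsub_gsumM //.
rewrite -gsumN -gsumD; last exact: posfinite_pair2.
pose h (p : int * int) := (p.1 + p.2 + 1, p.1 - p.2).
rewrite (@gsum_reindex _ _ _ h); first last.
- move=> [x y] /=; rewrite one2 -sgnE => /wt_odd[u /= e].
  by exists (u, x - u - 1); congr pair => /=; lia.
- by move=> [x y] [x' y'] [e1 e2]; congr pair; lia.
rewrite gsum_const => [|[x y] /=]; last first.
  by rewrite mulr1 -sgnE -(wt_odd2 x); congr (1 - sgn _); ring.
rewrite -mulrA fX_gsum; last exact: posfinite_pair2.
by congr (_ * _); apply: eq_gsum => -[x y] /=; rewrite ?one2 // /sqz /trz; ring.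
Qed.

(** By [refl] the class x + y even carries half of the sum; there (x, y) = (u + v, u - v), and the
    form becomes 2 (u^2 + u) + 2 v^2. *)
Lemma trig_sqr : trig ^+ 2 = 2 * fsub 2 phi * fsub 2 trig.
Proof.
apply: (mulfI two_neq0); rewrite expr2 -[in LHS](fsub1 trig) fsub_gsumM //.
rewrite (parity_split (fun p => p.1 + p.2)); last exact: posfinite_pair2.
rewrite [X in _ + X](@gsum_reindex _ _ _ refl _ _ reflI); last first.
  by move=> [x y] _; exists (-1 - x, y); congr pair => /=; lia.
rewrite [X in _ + X = _](@eq_gsum _ _ _ (fun p => 1 + sgn (p.1 + p.2)) _
  (fun p => 1%N%:Z * trz p.1 + 1%N%:Z * trz p.2)); first last.
- by move=> [x y] /=; rewrite /trz; ring.
- by move=> [x y] /=; rewrite sgn_refl.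
rewrite -[LHS]mulr2n -[LHS]mulr_natl; congr (_ * _).
rewrite (@gsum_reindex _ _ _ rot _ _ rotI); last first.
  move=> [x y] /= /wt_even[u /= e].
  by exists (u, x - u); congr pair => /=; lia.
rewrite gsum_const => [|[x y] /=]; last first.
  by rewrite -(wt_even2 x); congr (1 + sgn _); ring.
rewrite -mulrA [fsub 2 phi * _]mulrC fsub_gsumM //.
by congr (_ * _); apply: eq_gsum => -[x y] /=; rewrite ?one2 // /sqz /trz; ring.
Qed.

(** Split by the parity of y: with x = u - v and y = 2 v or 2 v + 1, the form is u^2 + 3 v^2 or 1 +
    (u^2 + u) + 3 (v^2 + v). *)
Lemma hexa_phi_trig : hexa = phi * fsub 3 phi + fX K 1 * trig * fsub 3 trig.
Proof.
apply: (mulfI two_neq0).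
rewrite -mulrA -[in RHS](fsub1 phi) -[in RHS](fsub1 trig) !fsub_fsub // !fsub_gsumM //.
rewrite fX_gsum; last exact: posfinite_pair2.
transitivity (2 * gsum (fun p : int * int => one_wt p.1 * one_wt p.2 : K) hexz).
  by congr (_ * _); apply: eq_gsum => // p; rewrite oneM.
rewrite (parity_split (fun p => p.2)) // mulrDr.
pose h (p : int * int) := (p.1 - p.2, 2 * p.2).
pose h' (p : int * int) := (p.1 - p.2, 2 * p.2 + 1).
rewrite (@gsum_reindex _ _ _ h); first last.
- move=> [x y] /= /wt_even[u /= e].
  by exists (x + u, u); congr pair => /=; lia.
- by move=> [x y] [x' y'] [e1 e2]; congr pair; lia.
rewrite [X in _ + X](@gsum_reindex _ _ _ h'); first last.
- move=> [x y] /= /wt_odd[u /= e].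
  by exists (x + u, u); congr pair => /=; lia.
- by move=> [x y] [x' y'] [e1 e2]; congr pair; lia.
rewrite [X in X + _ = _]gsum_const => [|[x y] /=]; last exact: wt_even2.
rewrite [X in _ + X = _]gsum_const => [|[x y] /=]; last exact: wt_odd2.
by congr (_ * _ + _ * _); apply: eq_gsum => -[x y] /=; rewrite ?one2 // /sqz /trz /hexz /=; ring.
Qed.

(* Multiplication by a cube root of unity carries half of the points
   s + 1/2 + (t + 1/2) sqrt(-3) to the points x + y sqrt(-3) with x + y odd. *)
Lemma phi_phim_trig :
  phi * fsub 3 phi = phim * fsub 3 phim + fX K 1 * trig * fsub 3 trig.
Proof.
apply/eqP; rewrite addrC -subr_eq; apply/eqP; apply: (mulfI two_neq0).
rewrite -mulrA -(fsub1 phi) -(fsub1 phim) -(fsub1 trig) !fsub_fsub // !fsub_gsumM //.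
rewrite fX_gsum; last exact: posfinite_pair2.
rewrite (parity_split (fun p => p.1 + p.2)); last first.
  by apply: (posfinite_shift 1); apply: posfinite_pair2.
rewrite [X in _ = _ + X](@gsum_reindex _ _ _ refl _ _ reflI); last first.
  by move=> [x y] _; exists (-1 - x, y); congr pair => /=; lia.
rewrite [X in _ = _ + X](@eq_gsum _ _ _ (fun p => 1 + sgn (p.1 + p.2)) _
  (fun p => 1%N%:Z + (1%N%:Z * trz p.1 + 3%N%:Z * trz p.2))); first last.
- by move=> [x y] /=; rewrite /trz; ring.
- by move=> [x y] /=; rewrite sgn_refl.
rewrite -[RHS]mulr2n -[RHS]mulr_natl; congr (_ * _).
rewrite -gsumN -gsumD; last exact: posfinite_pair2.
pose h (p : int * int) := (2 * p.1 + p.2 + 1, p.2).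
pose h' (p : int * int) := (p.1 + 2 * p.2, p.1).
rewrite (@gsum_reindex _ _ _ h); first last.
- move=> [x y] /=; rewrite one2 -sgnE => /wt_odd[u /= e].
  by exists (u - y, y); congr pair => /=; lia.
- by move=> [x y] [x' y'] [e1 e2]; congr pair; lia.
rewrite [RHS](@gsum_reindex _ _ _ h'); first last.
- move=> [x y] /= /wt_even[u /= e].
  by exists (y, u - y); congr pair => /=; lia.
- by move=> [x y] [x' y'] [e1 e2]; congr pair; lia.
rewrite [LHS]gsum_const => [|[x y] /=]; last first.
  by rewrite mulr1 -sgnE -(wt_odd2 (x + y)); congr (1 - sgn _); ring.
rewrite [RHS]gsum_const => [|[x y] /=]; last first.
  by rewrite -(wt_even2 (x + y)); congr (1 + sgn _); ring.
by congr (_ * _); apply: eq_gsum => -[x y] //=; rewrite /sqz /trz; ring.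
Qed.

(** The pairs with x + y even are (v + 2 u, v), on which x^2 + 3 y^2 = 4 (u^2 + u v + v^2). *)
Lemma hexa_sub4 : 2 * fsub 4 hexa = phi * fsub 3 phi + phim * fsub 3 phim.
Proof.
rewrite -[in RHS](fsub1 phi) -[in RHS](fsub1 phim) !fsub_fsub // !fsub_gsumM //.
rewrite -gsumD; last exact: posfinite_pair2.
pose h (p : int * int) := (p.2 + 2 * p.1, p.2).
rewrite (@gsum_reindex _ _ _ h); first last.
- move=> [x y] /=; rewrite one2 -sgnE => /wt_even[u /= e].
  by exists (u - y, y); congr pair => /=; lia.
- by move=> [x y] [x' y'] [e1 e2]; congr pair; lia.
rewrite gsum_const => [|[x y] /=]; last first.
  by rewrite mulr1 -sgnE -(wt_even2 (x + y)); congr (1 + sgn _); ring.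
rewrite fsub_gsum //.
by congr (_ * _); apply: eq_gsum => -[x y] //=; rewrite /sqz /hexz /=; ring.
Qed.

End LatticeIdentities.

(** * Equalities from polynomial certificates *)

(** Here and in the variants below, the cofactors c_i certify that a - b lies in the ideal generated
    by the l_i - r_i; what is left to check is a plain [ring] identity. *)
Lemma lincomb1 (R : comNzRingType) (l1 r1 c1 a b : R) :
  l1 = r1 ->
  a - b = c1 * (l1 - r1) -> a = b.
Proof. by move=> -> /eqP; rewrite !subrr !mulr0 ?addr0 subr_eq0 => /eqP. Qed.

Lemma lincomb2 (R : comNzRingType) (l1 r1 c1 l2 r2 c2 a b : R) :
  l1 = r1 -> l2 = r2 ->
  a - b = c1 * (l1 - r1) + c2 * (l2 - r2) -> a = b.
Proof. by move=> -> -> /eqP; rewrite !subrr !mulr0 ?addr0 subr_eq0 => /eqP. Qed.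

Lemma lincomb3 (R : comNzRingType) (l1 r1 c1 l2 r2 c2 l3 r3 c3 a b : R) :
  l1 = r1 -> l2 = r2 -> l3 = r3 ->
  a - b = c1 * (l1 - r1) + c2 * (l2 - r2) + c3 * (l3 - r3) -> a = b.
Proof. by move=> -> -> -> /eqP; rewrite !subrr !mulr0 ?addr0 subr_eq0 => /eqP. Qed.

Lemma lincomb4 (R : comNzRingType) (l1 r1 c1 l2 r2 c2 l3 r3 c3 l4 r4 c4 a b : R) :
  l1 = r1 -> l2 = r2 -> l3 = r3 -> l4 = r4 ->
  a - b = c1 * (l1 - r1) + c2 * (l2 - r2) + c3 * (l3 - r3) + c4 * (l4 - r4) -> a = b.
Proof. by move=> -> -> -> -> /eqP; rewrite !subrr !mulr0 ?addr0 subr_eq0 => /eqP. Qed.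

Lemma lincomb5 (R : comNzRingType) (l1 r1 c1 l2 r2 c2 l3 r3 c3 l4 r4 c4 l5 r5 c5 a b : R) :
  l1 = r1 -> l2 = r2 -> l3 = r3 -> l4 = r4 -> l5 = r5 ->
  a - b = c1 * (l1 - r1) + c2 * (l2 - r2) + c3 * (l3 - r3) + c4 * (l4 - r4) + c5 * (l5 - r5) -> a = b.
Proof. by move=> -> -> -> -> -> /eqP; rewrite !subrr !mulr0 ?addr0 subr_eq0 => /eqP. Qed.

(** * Rigidity under q -> q^2 and logarithmic derivatives *)

Section FpsChar0.
Variable K : numFieldType.
Implicit Types f g : fps K.

Lemma fps_natr_neq0 n : n.+1%:R != 0 :> fps K.
Proof. by apply/eqP => /(congr1 (fun f => cf f 0)) /eqP; rewrite cf0nat pnatr_eq0. Qed.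

Lemma fps_neq0 f n : cf f n != 0 -> f != 0.
Proof. by apply: contra_neq => ->; rewrite cf0. Qed.

Lemma fps_eq_sqr f g : f ^+ 2 = g ^+ 2 -> cf (f + g) 0 != 0 -> f = g.
Proof.
move=> /eqP; rewrite eqf_sqr => /orP[/eqP //|/eqP ->].
by rewrite addNr cf0 eqxx.
Qed.

Lemma cf_fD f n : cf (fD f) n = n%:R * cf f n. Proof. by []. Qed.
Lemma cf1M f g : cf (f * g) 1 = cf f 0 * cf g 1 + cf f 1 * cf g 0.
Proof. by rewrite cfM !big_ord_recl big_ord0 addr0. Qed.

Lemma eqm_fsub0 j N f : (0 < j)%N -> eqm N f 0 -> eqm (j * N) (fsub j f) 0.
Proof. by move=> j0 /(eqm_fsub j0) e n /e ->; rewrite raddf0. Qed.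

(** If f had order k >= 2, then f(q^2) g would have order 2 k + 1, as g has order 1, while f g(q^2)
    has order k + 2 < 2 k + 1. So a quotient invariant under q -> q^2 is known from its leading
    coefficients. *)
Lemma fsub2_proportional f g :
  eqm 2 f 0 -> eqm 1 g 0 -> cf g 1 != 0 ->
  fsub 2 f * g = f * fsub 2 g -> f = 0.
Proof.
move=> f2 g1 gn e; apply/eqP; apply: contraT => /fps_low[k fk f0].
have k2 : (1 < k)%N by rewrite ltnNge; apply: contra fk => le; rewrite f2.
have := eqm0M (eqm_fsub0 (isT : (0 < 2)%N) f0) g1 => /(_ (k + 2)%N).
have g2 : eqm 2 (fsub 2 g) 0 by have := eqm_fsub0 (isT : (0 < 2)%N) g1.
have -> : (k + 2 < 2 * k + 1)%N by lia.
rewrite e (cf_mul_low f0 g2) (@fsubE _ 2 g 1) // cf0 => /(_ isT) /eqP.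
by rewrite mulf_eq0 (negbTE fk) (negbTE gn).
Qed.

Definition dl f : fps K := fD f / f.

Lemma fD_dl f : cf f 0 != 0 -> fD f = dl f * f.
Proof. by move=> f0; rewrite /dl divrK // unit_fps. Qed.
Lemma dlE f g : cf f 0 != 0 -> fD f = g * f -> dl f = g.
Proof. by move=> f0 e; rewrite /dl e mulrK // unit_fps. Qed.
Lemma dlM f g : cf f 0 != 0 -> cf g 0 != 0 -> dl (f * g) = dl f + dl g.
Proof.
move=> f0 g0; apply: dlE; first by rewrite cf0M mulf_neq0.
by rewrite fDM !fD_dl //; ring.
Qed.
Lemma dlX f k : cf f 0 != 0 -> dl (f ^+ k) = k%:R * dl f.
Proof.
move=> f0; elim: k => [|k IH]; first by apply: dlE; rewrite ?cf1 ?oner_eq0 // fD1; ring.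
by rewrite exprS dlM ?cf0X ?expf_neq0 // IH -[k.+1]addn1 natrD; ring.
Qed.
Lemma dl_fsub j f : (0 < j)%N -> cf f 0 != 0 -> dl (fsub j f) = j%:R * fsub j (dl f).
Proof.
by move=> j0 f0; apply: dlE; rewrite ?cf_fsub0 // fD_fsub // fD_dl // fsubM // mulrA.
Qed.

End FpsChar0.

Arguments fps_neq0 {K f} n.
Arguments dl {K} f.

(** * Differential relations and the modular equation of degree 3 *)

Section ThetaDifferential.
Variable K : numFieldType.
Local Notation A := (phi K).
Local Notation C := (phim K).
Local Notation T := (trig K).
Local Notation B := (fsub 3 (phi K)).
Local Notation D := (fsub 3 (phim K)).
Local Notation T3 := (fsub 3 (trig K)).
Local Notation q := (fX K 1).

Let cf_sq w n : (n <= 1)%N ->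
  cf (gsum w sqz : fps K) n = (n == 0%N)%:R * w 0 + (n == 1%N)%:R * (w 1 + w (-1)).
Proof.
move=> le; rewrite (@cf_gsum _ _ _ _ [:: 0; 1; -1]) //; last first.
  by move=> x; rewrite /sqz !inE => e; nia.
by case: n le => [|[|//]] _; rewrite !big_cons big_nil /sqz /=; ring.
Qed.

Lemma phi0 : cf A 0 = 1. Proof. by rewrite cf_sq //= /one_wt; ring. Qed.
Lemma phi1 : cf A 1 = 2. Proof. by rewrite cf_sq //= /one_wt; ring. Qed.
Lemma phim0 : cf C 0 = 1. Proof. by rewrite cf_sq //= /sgn /=; ring. Qed.
Lemma phim1 : cf C 1 = -2. Proof. by rewrite cf_sq //= /sgn /=; ring. Qed.
Lemma trig0 : cf T 0 = 2.
Proof.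
rewrite (@cf_gsum _ _ _ _ [:: 0; -1]) //; last first.
  by move=> x; rewrite /trz !inE => e; nia.
by rewrite !big_cons big_nil /trz /one_wt /=; ring.
Qed.
Lemma hexa0 : cf (hexa K) 0 = 1.
Proof.
rewrite (@cf_gsum _ _ _ _ [:: (0, 0)]) //; last first.
  move=> [x y]; rewrite /hexz !inE /= => e.
  have h1 : 0 <= (x + 2 * y) ^+ 2 by rewrite sqr_ge0.
  have h2 : 0 <= (2 * x + y) ^+ 2 by rewrite sqr_ge0.
  by apply/eqP; congr pair; nia.
by rewrite !big_cons big_nil /hexz /one_wt /=; ring.
Qed.
Let A0 : cf A 0 != 0. Proof. by rewrite phi0 oner_eq0. Qed.
Let C0 : cf C 0 != 0. Proof. by rewrite phim0 oner_eq0. Qed.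
Let T0 : cf T 0 != 0. Proof. by rewrite trig0 pnatr_eq0. Qed.
Let nz (n : nat) := fps_natr_neq0 K n.

(** Jacobi's identity theta_3^4 - theta_4^4 = theta_2^4, as the product of the two relations between
    squares. *)
Lemma phi4_sub_phim4 : A ^+ 4 - C ^+ 4 = q * T ^+ 4.
Proof.
have h1 := phi_sqr_add_phim_sqr K; have h3 := phi_sqr_sub_phim_sqr K.
have h4 := trig_sqr K.
rewrite (_ : A ^+ 4 - C ^+ 4 = (A ^+ 2 - C ^+ 2) * (A ^+ 2 + C ^+ 2)); last by ring.
rewrite h1 h3 (_ : T ^+ 4 = T ^+ 2 * T ^+ 2); last by ring.
by rewrite h4; ring.
Qed.

Lemma phi4_neq_phim4 : A ^+ 4 - C ^+ 4 != 0.
Proof.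
rewrite phi4_sub_phim4 mulf_neq0 ?fX_neq0 // expf_neq0 //.
exact: (fps_neq0 0%N).
Qed.

(* With W = A' C - A C' one has N = 2 A C W and 4 N(q^2) = (A^2 - C^2) W, so
   that N / M is invariant under q -> q^2. *)
Lemma dl_phi_sub_dl_phim : 4 * (dl A - dl C) = A ^+ 4 - C ^+ 4.
Proof.
pose W := fD A * C - A * fD C.
pose N := fD (A ^+ 2) * C ^+ 2 - A ^+ 2 * fD (C ^+ 2).
pose M := A ^+ 2 * C ^+ 2 * (A ^+ 4 - C ^+ 4).
have NE : N = 2 * A * C * W by rewrite /N /W !fDX; ring.
have h1 := phi_sqr_add_phim_sqr K; have h2 := phi_mul_phim K.
have N2 : 4 * fsub 2 N = (A ^+ 2 - C ^+ 2) * W.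
  have Ds : fD (A * C) = 2 * fsub 2 (fD (C ^+ 2)).
    by rewrite h2 -fsubXn // fD_fsub.
  have Da : 2 * fD A * A + 2 * fD C * C = 4 * fsub 2 (fD (A ^+ 2)).
    have := congr1 (@fD K) h1; rewrite -fsubXn // raddfD /= fDM fD_fsub // !fDX.
    rewrite (_ : fD 2 = 0); last by rewrite -(rmorph_nat (@fC K)) fDC.
    by rewrite !expr1 => h; apply: (lincomb1 (c1 := 1) h); ring.
  rewrite /N raddfB /= (fsubM _ (C ^+ 2)) // (fsubM (A ^+ 2)) // !fsubXn // -h2.
  rewrite (_ : 4 * _ = (4 * fsub 2 (fD (A ^+ 2))) * (A * C) -
    (2 * fsub 2 A ^+ 2) * (2 * fsub 2 (fD (C ^+ 2)))); last by ring.
  by rewrite -Da -h1 -Ds fDM /W; ring.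
have M2 : 8 * fsub 2 M = (A ^+ 2 + C ^+ 2) * (A * C) * (A ^+ 2 - C ^+ 2) ^+ 2.
  rewrite /M (fsubM (A ^+ 2 * _)) // (fsubM (A ^+ 2)) // raddfB /= !fsubXn //.
  rewrite (_ : 8 * _ = (2 * fsub 2 A ^+ 2) * fsub 2 C ^+ 2 *
    ((2 * fsub 2 A ^+ 2) ^+ 2 - 4 * (fsub 2 C ^+ 2) ^+ 2)); last by ring.
  by rewrite -h1 -h2; ring.
have prop : fsub 2 (2 * N - M) * M = (2 * N - M) * fsub 2 M.
  apply: (mulfI (nz 7)); rewrite raddfB /= (fsubM _ N) // rmorph_nat.
  rewrite (_ : 8 * _ = (4 * (4 * fsub 2 N) - 8 * fsub 2 M) * M); last by ring.
  rewrite (_ : 8 * ((2 * N - M) * _) = (2 * N - M) * (8 * fsub 2 M)); last by ring.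
  by rewrite N2 M2 NE /M; ring.
have ME : M = q * (A ^+ 2 * C ^+ 2 * T ^+ 4) by rewrite /M phi4_sub_phim4; ring.
(* M = 16 q + O(q^2) and N = 8 q + O(q^2), so 2 N - M = O(q^2), as [fsub2_proportional] requires. *)
have cM n : (n <= 1)%N -> cf M n = (n == 1%N)%:R * 16.
  rewrite ME cfXM; case: n => [|[|//]] _; first by rewrite mul0r.
  rewrite [RHS]mul1r; transitivity (cf (A ^+ 2 * C ^+ 2 * T ^+ 4) 0); first by [].
  by rewrite (cf0M (_ * _)) (cf0M (A ^+ 2)) !cf0X phi0 phim0 trig0; ring.
have cN n : (n <= 1)%N -> cf N n = (n == 1%N)%:R * 8.
  rewrite NE /W; case: n => [|[|//]] _.
    by rewrite [RHS]mul0r cf0M cfB !cf0M !cf_fD; ring.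
  by rewrite [RHS]mul1r cf1M cfB !cf1M !cf0M cfB !cf0M !cf_fD cf0nat phi0 phi1 phim0 phim1; ring.
have e : 2 * N - M = 0.
  apply: (fsub2_proportional _ _ _ prop).
  - move=> n lt; rewrite cfB mulr_natl cfMn cN // cM // cf0 -mulr_natl; ring.
  - by move=> n lt; rewrite cM ?(ltnW lt) //; case: n lt => //= _; rewrite mul0r.
  - by rewrite cM // mul1r pnatr_eq0.
have := e; rewrite NE /W !fD_dl // /M.
have AC0 : A ^+ 2 * C ^+ 2 != 0 by rewrite mulf_neq0 // expf_neq0 // (fps_neq0 0%N).
move=> h; apply: (mulfI AC0); apply: (lincomb1 (c1 := 1) h); ring.
Qed.

Let fD_q : fD q = q.
Proof. by apply: fpsP => -[|[|n]] /=; rewrite ?mulr0 ?mul1r. Qed.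

(** Logarithmic derivative of q T^4 = A^4 - C^4, with dl A eliminated by [dl_phi_sub_dl_phim]. *)
Lemma dl_trig : 1 + 4 * dl T = A ^+ 4 + 4 * dl C.
Proof.
apply: (mulfI phi4_neq_phim4).
have h : fD (A ^+ 4 - C ^+ 4) = (A ^+ 4 - C ^+ 4) * (1 + 4 * dl T).
  by rewrite phi4_sub_phim4 fDM fDX (fD_dl T0) fD_q; ring.
rewrite -h raddfB /= !fDX !fD_dl //.
apply: (lincomb1 (c1 := A ^+ 4) dl_phi_sub_dl_phim); ring.
Qed.

Let dl3 f g : f = g :> fps K -> fsub 3 f = fsub 3 g. Proof. by move=> ->. Qed.

Lemma dl_phi3_sub_dl_phim3 : 4 * (dl B - dl D) = 3 * (B ^+ 4 - D ^+ 4).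
Proof.
rewrite !dl_fsub // -mulrBr mulrCA; congr (_ * _).
have := dl3 dl_phi_sub_dl_phim.
by rewrite (fsubM 4) // !raddfB /= !fsubXn // rmorph_nat.
Qed.

Lemma dl_trig3 : 3 + 4 * dl T3 = 3 * B ^+ 4 + 4 * dl D.
Proof.
rewrite !dl_fsub //; have := dl3 dl_trig.
rewrite !raddfD /= !(fsubM 4) // fsubXn // !rmorph_nat rmorph1 => h.
apply: (lincomb1 (c1 := 3) h); ring.
Qed.

Let B0 : cf B 0 != 0. Proof. by rewrite cf_fsub0. Qed.
Let D0 : cf D 0 != 0. Proof. by rewrite cf_fsub0. Qed.
Let T30 : cf T3 0 != 0. Proof. by rewrite cf_fsub0. Qed.

Let AB_sub_CD : A * B - C * D = q * T * T3.
Proof. by rewrite phi_phim_trig; ring. Qed.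

(** Fourth power of AB - CD = q T T(q^3), where T^4 and T(q^3)^4 are replaced through Jacobi's
    identity at q and q^3. *)
Lemma cubic_pow4 : (A * B - C * D) ^+ 4 = (A ^+ 4 - C ^+ 4) * (B ^+ 4 - D ^+ 4).
Proof.
have h := dl3 phi4_sub_phim4.
rewrite raddfB /= (fsubM q) // !fsubXn // fsub_fX // in h.
rewrite AB_sub_CD phi4_sub_phim4 h (_ : fX K (3 * 1) = q ^+ 3); first by ring.
by rewrite -fXM.
Qed.

(** Logarithmic derivative of AB - CD = q T T(q^3). All derivatives reduce to dl C and dl D, and
    these cancel, so that an algebraic relation remains. *)
Lemma cubic_deriv : A * B * (C ^+ 4 + 3 * D ^+ 4) = C * D * (A ^+ 4 + 3 * B ^+ 4).
Proof.
have h : fD (A * B - C * D) = (A * B - C * D) * (1 + dl T + dl T3).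
  by rewrite AB_sub_CD !fDM (fD_dl T0) (fD_dl T30) fD_q; ring.
rewrite raddfB /= !fDM !fD_dl // in h.
have h1 := dl_phi_sub_dl_phim; have h2 := dl_phi3_sub_dl_phim3.
have h3 := dl_trig; have h4 := dl_trig3.
apply: (lincomb5 (c1 := -4) (c2 := A * B) (c3 := A * B)
  (c4 := C * D - A * B) (c5 := C * D - A * B) h h1 h2 h3 h4).
ring.
Qed.

End ThetaDifferential.

(** * Parametrization by [rho], [tau] and [mu] *)

Section Parametrization.
Variable K : numFieldType.
Local Notation A := (phi K).
Local Notation C := (phim K).
Local Notation B := (fsub 3 (phi K)).
Local Notation D := (fsub 3 (phim K)).
Local Notation a := (hexa K).
Local Notation A2 := (fsub 2 (phi K)).
Local Notation C2 := (fsub 2 (phim K)).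
Local Notation B2 := (fsub 6 (phi K)).
Local Notation D2 := (fsub 6 (phim K)).
Let nz (n : nat) := fps_natr_neq0 K n.

Definition ct (f : fps K) : K := cf f 0.
Fact ct_additive : {morph ct : f g / f - g}. Proof. by []. Qed.
Fact ct_multiplicative : monoid_morphism ct.
Proof. by split=> [|f g]; rewrite /ct ?cf1 ?cf0M. Qed.
HB.instance Definition _ := GRing.isZmodMorphism.Build (fps K) K ct ct_additive.
HB.instance Definition _ := GRing.isMonoidMorphism.Build (fps K) K ct ct_multiplicative.

Lemma ctM f g : ct (f * g) = ct f * ct g. Proof. exact: rmorphM. Qed.
Lemma ctX f n : ct (f ^+ n) = ct f ^+ n. Proof. exact: rmorphXn. Qed.
Lemma ct_nat n : ct n%:R = n%:R. Proof. exact: rmorph_nat. Qed.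
Lemma ct_neq0 f : ct f != 0 -> f != 0.
Proof. by apply: contra_neq => ->; rewrite raddf0. Qed.
Lemma ct_fsub j f : ct (fsub j f) = ct f. Proof. exact: cf_fsub0. Qed.
Lemma ct_phi : ct A = 1. Proof. exact: phi0. Qed.
Lemma ct_phim : ct C = 1. Proof. exact: phim0. Qed.
Lemma ct_hexa : ct a = 1. Proof. exact: hexa0. Qed.
Let ctB : ct B = 1. Proof. by rewrite ct_fsub ct_phi. Qed.
Let ctD : ct D = 1. Proof. by rewrite ct_fsub ct_phim. Qed.
Let ctB' (f g : fps K) : ct (f - g) = ct f - ct g. Proof. by []. Qed.
Let ctD' (f g : fps K) : ct (f + g) = ct f + ct g. Proof. by []. Qed.
Let ctE := (ct_fsub, ct_phi, ct_phim, ct_hexa, ct_nat, ctX, ctM, ctB', ctD').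

Lemma eq_sqr_ct (f g : fps K) : f ^+ 2 = g ^+ 2 -> ct f = ct g -> ct f != 0 -> f = g.
Proof.
move=> e c0 c; apply: (fps_eq_sqr e); rewrite cfD; have := c0; rewrite /ct => <-.
by rewrite -mulr2n mulrn_eq0.
Qed.

(** For given p = AB and P = CD, [cubic_deriv] and [cubic_pow4] are linear in C^4 and D^4; this is
    Cramer's rule, with determinant p (A^4 - 3 B^4). *)
Let phim4_elim : let p := A * B in let P := C * D in
  p * (A ^+ 4 - 3 * B ^+ 4) * D ^+ 4 =
    P * (3 * p ^+ 4 - 6 * p ^+ 3 * P + 4 * p ^+ 2 * P ^+ 2 - 3 * B ^+ 8) /\
  p * (A ^+ 4 - 3 * B ^+ 4) * C ^+ 4 =
    P * (A ^+ 8 - 9 * p ^+ 4 + 18 * p ^+ 3 * P - 12 * p ^+ 2 * P ^+ 2).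
Proof.
have e1 := cubic_deriv K; have e2 := cubic_pow4 K.
move=> p P; split.
  by apply: (lincomb2 (c1 := - B ^+ 4) (c2 := p) e1 e2); rewrite /p /P; ring.
by apply: (lincomb2 (c1 := A ^+ 4) (c2 := - 3 * p) e1 e2); rewrite /p /P; ring.
Qed.

(** The product of the two Cramer solutions must be (CD)^4. The resulting equation factors; p - P =
    q T T(q^3) and F2, with constant term -4, do not vanish, so F1 = 0. *)
Lemma phi_phim_product :
  4 * (A * B * (C * D)) = (3 * B ^+ 2 - A ^+ 2) * (A ^+ 2 + B ^+ 2).
Proof.
have [hX hY] := phim4_elim; move: hX hY.
set p := A * B; set P := C * D.
set X := P * (_ - _); set Y := P * (_ - _) => hX hY.
have XY : X * Y = p ^+ 2 * (A ^+ 4 - 3 * B ^+ 4) ^+ 2 * P ^+ 4.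
  by rewrite -hX -hY /P; ring.
pose F1 := (3 * B ^+ 2 - A ^+ 2) * (A ^+ 2 + B ^+ 2) - 4 * P * p.
pose F2 := A ^+ 4 - 3 * B ^+ 4 + 2 * A ^+ 2 * B ^+ 2 - 4 * P * p.
have : 3 * (p * P) ^+ 2 * (p - P) ^+ 2 * F2 * F1 = 0.
  apply: (lincomb1 (c1 := -1) XY); rewrite /X /Y /F1 /F2 /p /P; ring.
move/eqP; rewrite mulf_eq0 => /orP[|]; last first.
  by move=> /eqP h; apply: (lincomb1 (c1 := -1) h); rewrite /F1 /p /P; ring.
apply: contraTeq => _; apply: mulf_neq0; first apply: mulf_neq0.
- apply: mulf_neq0; first exact: nz.
  by rewrite ct_neq0 // /p /P !ctE !mulr1 expr1n oner_eq0.
- rewrite expf_neq0 // /p /P phi_phim_trig addrAC subrr add0r.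
  rewrite mulf_neq0 ?mulf_neq0 ?fX_neq0 // ct_neq0 ?ct_fsub // /ct trig0 pnatr_eq0 //.
- rewrite ct_neq0 // /F2 /p /P !ctE (_ : _ - _ = - 4%:R); first by rewrite oppr_eq0 pnatr_eq0.
  by ring.
Qed.

Let S := 3 * B ^+ 2 - A ^+ 2.
Let U := A ^+ 2 + B ^+ 2.

(** With CD now known through A and B, the Cramer solutions become explicit and the determinant
    cancels. *)
Let phim_pow4 : 16 * (A * B) ^+ 2 * C ^+ 4 = S ^+ 3 * U /\
                16 * (A * B) ^+ 2 * D ^+ 4 = S * U ^+ 3.
Proof.
have n0 : A ^+ 4 - 3 * B ^+ 4 != 0.
  rewrite ct_neq0 // !ctE (_ : _ - _ = - 2%:R); first by rewrite oppr_eq0 pnatr_eq0.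
  by ring.
have [] := phim4_elim; set p := A * B; set P := C * D => hX hY.
have e : 4 * p * P = S * U by rewrite /S /U -phi_phim_product /p /P; ring.
split; apply: (mulfI n0).
  rewrite [LHS](_ : _ = 16 * p * (p * (A ^+ 4 - 3 * B ^+ 4) * C ^+ 4)); last by ring.
  rewrite hY [LHS](_ : _ = (4 * p * P) * (4 * A ^+ 8 - 36 * p ^+ 4 +
    18 * p ^+ 2 * (4 * p * P) - 3 * (4 * p * P) ^+ 2)); last by ring.
  by rewrite e /S /U /p; ring.
rewrite [LHS](_ : _ = 16 * p * (p * (A ^+ 4 - 3 * B ^+ 4) * D ^+ 4)); last by ring.
rewrite hX [LHS](_ : _ = (4 * p * P) * (12 * p ^+ 4 -
  6 * p ^+ 2 * (4 * p * P) + (4 * p * P) ^+ 2 - 12 * B ^+ 8)); last by ring.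
by rewrite e /S /U /p; ring.
Qed.

Lemma phim_sqr_ratio :
  C ^+ 2 * (A ^+ 2 + B ^+ 2) = D ^+ 2 * (3 * B ^+ 2 - A ^+ 2).
Proof.
have [hC hD] := phim_pow4.
have n0 : 16 * (A * B) ^+ 2 != 0.
  by rewrite ct_neq0 // !ctE !mulr1 expr1n mulr1 pnatr_eq0.
apply: eq_sqr_ct; last first.
- by rewrite !ctE !expr1n mul1r -mulr2n pnatr_eq0.
- by rewrite !ctE; ring.
apply: (mulfI n0); rewrite -/S -/U.
rewrite [LHS](_ : _ = (16 * (A * B) ^+ 2 * C ^+ 4) * U ^+ 2); last by ring.
rewrite hC [RHS](_ : _ = (16 * (A * B) ^+ 2 * D ^+ 4) * S ^+ 2); last by ring.
by rewrite hD; ring.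
Qed.

Definition rho : fps K := locked (A / B).
Definition tau : fps K := locked (B ^+ 2 / (8 * rho)).
(** Taking mu to be this theta quotient, and not a square root of (3 - r^2)(1 + r^2), settles its
    existence and its sign; the equation for mu^2 becomes a consequence. *)
Definition mu : fps K := locked (2 * (C2 * D2) / B ^+ 2).
Local Notation r := rho.
Local Notation t := tau.

Let uB n : B ^+ n \is a GRing.unit.
Proof. by rewrite unit_fps -/(ct _) !ctE expr1n oner_eq0. Qed.
Lemma phi_rho : A = r * B. Proof. by rewrite /rho -lock divrK // (uB 1). Qed.
Lemma ct_rho : ct r = 1.
Proof. by have /(congr1 ct) := phi_rho; rewrite !ctE mulr1 => <-. Qed.
Let u8r : 8 * r \is a GRing.unit.
Proof. by rewrite unit_fps -/(ct _) !ctE ct_rho mulr1 pnatr_eq0. Qed.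
Lemma phi3_sqr : B ^+ 2 = 8 * r * t. Proof. by rewrite /tau -lock mulrC divrK. Qed.
Lemma ct_tau : 8 * ct t = 1.
Proof.
have /(congr1 ct) := phi3_sqr; rewrite !ctE ct_rho => h.
by apply: (lincomb1 (c1 := -1) h); ring.
Qed.
Lemma phi_sqr : A ^+ 2 = 8 * r ^+ 3 * t.
Proof. by rewrite phi_rho exprMn phi3_sqr; ring. Qed.
Lemma phi_phi3 : A * B = 8 * r ^+ 2 * t.
Proof. by rewrite {1}phi_rho -mulrA -expr2 phi3_sqr; ring. Qed.

Lemma phim2_phim6 : C2 * D2 = 4 * r * t * mu.
Proof.
apply: (mulfI (nz 1)); rewrite [RHS](_ : _ = mu * B ^+ 2); last by rewrite phi3_sqr; ring.
by rewrite /mu -lock divrK.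
Qed.

Let B0 : B != 0. Proof. by rewrite ct_neq0 // ctB oner_eq0. Qed.
Lemma tau_neq0 : t != 0.
Proof.
by apply: contraTneq (oner_neq0 K) => t0; rewrite -ct_tau t0 /ct cf0 mulr0 eqxx.
Qed.
Lemma rho_neq0 : r != 0. Proof. by rewrite ct_neq0 // ct_rho oner_eq0. Qed.

Lemma ct_mu : ct mu = 2.
Proof.
have /(congr1 ct) := phim2_phim6; rewrite !ctE ct_rho => h.
have ht := ct_tau.
by apply: (lincomb2 (c1 := -2) (c2 := - ct mu) h ht); ring.
Qed.
Lemma mu_neq0 : mu != 0. Proof. by rewrite ct_neq0 // ct_mu pnatr_eq0. Qed.

(** phi(q) phi(-q) = phi(-q^2)^2 at q and q^3 gives (4 r t mu)^2 = ABCD, and [phi_phim_product]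
    evaluates ABCD. *)
Lemma mu_sqr : mu ^+ 2 = (3 - r ^+ 2) * (1 + r ^+ 2).
Proof.
have C2E := phi_mul_phim K.
have D2E := congr1 (fsub 3) C2E; rewrite fsubM // fsubXn // fsub_fsub // in D2E.
have e1 := phi_phim_product; have e2 := phim2_phim6.
have nt : 64 * (r * t) ^+ 2 != 0.
  exact: mulf_neq0 (nz 63) (expf_neq0 2 (mulf_neq0 rho_neq0 tau_neq0)).
apply: (mulfI nt).
transitivity (4 * (C2 * D2) ^+ 2); first by rewrite e2; ring.
transitivity (4 * (A * B * (C * D))); last by rewrite e1 phi_sqr phi3_sqr; ring.
rewrite exprMn -C2E -D2E; ring.
Qed.
Local Notation x := (rho ^+ 2).

(** C^4 is known, and modulo the equation of mu it is a perfect square; the constant term 1 selects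
    the root. The same device gives D^2 and A(q^2) B(q^2). *)
Lemma phim_sqr : C ^+ 2 = 2 * t * mu * (3 - x).
Proof.
apply: eq_sqr_ct; last first.
- by rewrite !ctE expr1n oner_eq0.
- rewrite !ctE ct_rho ct_mu; have h := ct_tau.
  by apply: (lincomb1 (c1 := -1) h); ring.
have [hC _] := phim_pow4.
have n0 : 16 * (A * B) ^+ 2 != 0.
  by rewrite ct_neq0 // !ctE !mulr1 expr1n mulr1 pnatr_eq0.
apply: (mulfI n0); rewrite -exprM hC /S /U phi_phi3 phi_sqr phi3_sqr; ring: mu_sqr.
Qed.

Lemma phim3_sqr : D ^+ 2 = 2 * t * mu * (1 + x).
Proof.
apply: eq_sqr_ct; last first.
- by rewrite !ctE expr1n oner_eq0.
- rewrite !ctE ct_rho ct_mu; have h := ct_tau.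
  by apply: (lincomb1 (c1 := -1) h); ring.
have [_ hD] := phim_pow4.
have n0 : 16 * (A * B) ^+ 2 != 0.
  by rewrite ct_neq0 // !ctE !mulr1 expr1n mulr1 pnatr_eq0.
apply: (mulfI n0); rewrite -exprM hD /S /U phi_phi3 phi_sqr phi3_sqr; ring: mu_sqr.
Qed.

Lemma phim_phim3 : C * D = 2 * t * mu ^+ 2.
Proof.
have n0 : 32 * x * t != 0.
  exact: mulf_neq0 (mulf_neq0 (nz 31) (expf_neq0 2 rho_neq0)) tau_neq0.
apply: (mulfI n0); have e := phi_phim_product.
transitivity (4 * (A * B * (C * D))); first by rewrite phi_phi3; ring.
by rewrite e phi_sqr phi3_sqr mu_sqr; ring.
Qed.

Lemma phi2_sqr : A2 ^+ 2 = t * (4 * r ^+ 3 + mu * (3 - x)).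
Proof.
by apply: (mulfI (nz 1)); rewrite -phi_sqr_add_phim_sqr phi_sqr phim_sqr; ring.
Qed.

Lemma phi6_sqr : B2 ^+ 2 = t * (4 * r + mu * (1 + x)).
Proof.
have h := congr1 (fsub 3) (phi_sqr_add_phim_sqr K).
rewrite raddfD /= (fsubM 2) // !fsubXn // fsub_fsub // rmorph_nat in h.
by apply: (mulfI (nz 1)); rewrite -h phi3_sqr phim3_sqr; ring.
Qed.

Lemma phi2_phi6 : A2 * B2 = t * (x ^+ 2 + 3 + 2 * r * mu).
Proof.
apply: eq_sqr_ct; last first.
- by rewrite !ctE mulr1 oner_eq0.
- rewrite !ctE ct_rho ct_mu; have h := ct_tau.
  by apply: (lincomb1 (c1 := -1) h); ring.
rewrite exprMn phi2_sqr phi6_sqr; ring: mu_sqr.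
Qed.

Lemma hexaE : a = 2 * t * (x ^+ 2 + 6 * x - 3).
Proof.
have e1 := hexa_phi_trig K; have e2 := phi_phim_trig K.
(* q T T(q^3) is eliminated between the two level 3 relations. *)
have e3 : a = 2 * (A * B) - C * D by apply: (lincomb2 (c1 := 1) (c2 := -1) e1 e2); ring.
by rewrite e3 phi_phi3 phim_phim3 mu_sqr; ring.
Qed.

Lemma hexa2E : fsub 2 a = 2 * t * (x ^+ 2 + 3).
Proof.
have e1 := hexa_phi_trig K; have e2 := phi_phim_trig K.
have e3 : a = 2 * (A * B) - C * D by apply: (lincomb2 (c1 := 1) (c2 := -1) e1 e2); ring.
have := congr1 (fsub 2) e3.
rewrite raddfB /= (fsubM 2) // (fsubM A) // (fsubM C) // !fsub_fsub // rmorph_nat => ->.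
by rewrite phi2_phi6 phim2_phim6; ring.
Qed.

Lemma hexa4E : fsub 4 a = t * (3 + 6 * x - x ^+ 2).
Proof.
apply: (mulfI (nz 1)).
by rewrite (hexa_sub4 K) phi_phi3 phim_phim3 mu_sqr; ring.
Qed.

Lemma hexa8E : 2 * fsub 8 a = t * (x ^+ 2 + 3 + 6 * r * mu).
Proof.
have := congr1 (fsub 2) (hexa_sub4 K).
rewrite raddfD /= (fsubM 2) // (fsubM A) // (fsubM C) // !fsub_fsub // rmorph_nat => ->.
by rewrite phi2_phi6 phim2_phim6; ring.
Qed.

(** Derivative of C^2 (A^2 + B^2) = D^2 (3 B^2 - A^2), with dl C and dl D eliminated through dl A -
    dl C and dl B - dl D. It links divisor sums at q to those at q^3, which a(q)^2 will require. *)
Lemma dl_rho : dl A - dl B = 2 * t ^+ 2 * mu ^+ 2 * (x - 1) * (x + 3).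
Proof.
have h := congr1 (@fD K) phim_sqr_ratio.
have dE (f : fps K) : ct f = 1 -> fD (f ^+ 2) = 2 * dl f * f ^+ 2.
  by move=> f1; rewrite fDX fD_dl -/(ct f) ?f1 ?oner_eq0 //; ring.
have fD3 : fD 3 = 0 :> fps K by rewrite -(rmorph_nat (@fC K)) fDC.
have {h} h : 2 * dl C * C ^+ 2 * (A ^+ 2 + B ^+ 2) + C ^+ 2 *
      (2 * dl A * A ^+ 2 + 2 * dl B * B ^+ 2) =
    2 * dl D * D ^+ 2 * (3 * B ^+ 2 - A ^+ 2) + D ^+ 2 *
      (6 * dl B * B ^+ 2 - 2 * dl A * A ^+ 2).
  move: h; rewrite !(fDM (_ ^+ 2)) (raddfD (@fD K)) (raddfB (@fD K)) /=.
  rewrite (fDM 3) fD3 !dE ?ct_fsub ?ct_phi ?ct_phim // => h.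
  by apply: (lincomb1 (c1 := 1) h); ring.
have n0 : 3 + 6 * x - x ^+ 2 != 0.
  rewrite ct_neq0 // !ctE ct_rho (_ : _ - _ = 8%:R); first by rewrite pnatr_eq0.
  by ring.
have n1 : 32 * (t * r) * (t * mu) != 0.
  exact: mulf_neq0 (mulf_neq0 (nz 31) (mulf_neq0 tau_neq0 rho_neq0)) (mulf_neq0 tau_neq0 mu_neq0).
have A4 : A ^+ 4 = (8 * r ^+ 3 * t) ^+ 2 by rewrite -phi_sqr -exprM.
have B4 : B ^+ 4 = (8 * r * t) ^+ 2 by rewrite -phi3_sqr -exprM.
have C4 : C ^+ 4 = (2 * t * mu * (3 - x)) ^+ 2 by rewrite -phim_sqr -exprM.
have D4 : D ^+ 4 = (2 * t * mu * (1 + x)) ^+ 2 by rewrite -phim3_sqr -exprM.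
have h1 := dl_phi_sub_dl_phim K; have h2 := dl_phi3_sub_dl_phim3 K.
rewrite A4 C4 in h1; rewrite B4 D4 in h2; rewrite phi_sqr phi3_sqr phim_sqr phim3_sqr in h.
apply: (mulfI (mulf_neq0 n1 n0)); move: h h1 h2.
move: (dl A) (dl B) (dl C) (dl D) => al be ga de h h1 h2.
apply: (lincomb3 (c1 := 1) (c2 := 8 * r * t * t * mu * mu ^+ 2)
  (c3 := - (8 * r * t * t * mu * mu ^+ 2)) h h1 h2).
ring: mu_sqr.
Qed.

End Parametrization.

(** * Euler's product and the products for theta functions *)

Section EulerProduct.
Variable K : numFieldType.
Local Notation X := (fX K).

Definition eul_upto n : fps K := \prod_(1 <= k < n.+1) (1 - X k).
(** The coefficient of q^n no longer changes after the n-th partial product, so the diagonal gives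
    the infinite product. *)
Definition eul : fps K := Fps (fun n => cf (eul_upto n) n).

Lemma eul_uptoS n : eul_upto n.+1 = eul_upto n * (1 - X n.+1).
Proof. by rewrite /eul_upto big_nat_recr. Qed.

Lemma eqm_one_subX N k : (N <= k)%N -> eqm N (1 - X k) 1.
Proof.
move=> le n lt; rewrite cfB (_ : cf (X k) n = 0) ?subr0 //=.
by case: eqP => //; lia.
Qed.

Lemma eqm_eul_upto m n : (m <= n)%N -> eqm m.+1 (eul_upto n) (eul_upto m).
Proof.
elim: n => [|n IH]; first by rewrite leqn0 => /eqP ->.
rewrite leq_eqVlt => /orP[/eqP -> //|le].
rewrite eul_uptoS -[eul_upto m]mulr1; apply: eqmM; first exact: IH.
by apply: eqm_one_subX.
Qed.

Lemma eqm_eul n : eqm n.+1 eul (eul_upto n).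
Proof. by move=> m lt; rewrite /= (eqm_eul_upto (m := m) (n := n)). Qed.

Lemma ct_eul_upto n : ct (eul_upto n) = 1.
Proof. by elim: n => [|n IH]; [rewrite /eul_upto big_geq // /ct cf1|rewrite eul_uptoS ctM IH mul1r /ct cfB cf1 /= subr0]. Qed.
Lemma ct_eul : ct eul = 1.
Proof. by rewrite -(ct_eul_upto 0). Qed.

Let u k : fps K := 1 - X k.
Let v k : fps K := 1 + X k.
Let ct_u k : ct (u k.+1) = 1. Proof. by rewrite /ct cfB /= subr0. Qed.
Let uu k : u k.+1 \is a GRing.unit.
Proof. by rewrite unit_fps -/(ct _) ct_u oner_eq0. Qed.
Let uv k : v k \is a GRing.unit.
Proof. by rewrite unit_fps /= /v; case: k => [|k] /=; rewrite ?addr0 ?oner_eq0 // -mulr2n pnatr_eq0. Qed.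

Let P n := \prod_(1 <= k < n.+1) (u k / v k).
Let PS n : P n.+1 = P n * (u n.+1 / v n.+1).
Proof. by rewrite /P big_nat_recr. Qed.
Let uP n : P n \is a GRing.unit.
Proof.
elim: n => [|n IH]; first by rewrite /P big_geq // unitr1.
by rewrite PS !unitrM IH uu unitrV uv.
Qed.

(* D. Shanks: this sum is a partial sum of the theta series phi(-q), while
   modulo q^(n+1) only its first term P n survives. *)
Let shanks n := \sum_(0 <= s < n.+1) (-1) ^+ s * 2 * (v s)^-1 * (P n / P s) * X (s * n.+1)%N.
(** Telescoping certificate: when n grows by one, the s-th summand of [shanks] changes by
    [tele n s.+1 - tele n s]. *)
Let tele n s : fps K := (-1) ^+ s * 2 * X (s * n.+1)%N * (P n / P s) * u s * ((v s)^-1 * (v n.+1)^-1).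

Let shanks_alg (R : comNzRingType) (e a b c G i j : R) :
  b * i = 1 - i -> c * j = 1 - j ->
  e * 2 * i * (G * ((1 - c) * j)) * (a * b) - e * 2 * i * G * a =
  (- e) * 2 * (a * c) * (G * j) - e * 2 * a * G * (1 - b) * (i * j).
Proof. by move=> h1 h2; ring: h1 h2. Qed.

Let XvV k : X k * (v k)^-1 = 1 - (v k)^-1.
Proof.
have h := divrr (uv k); rewrite {1}/v in h.
by apply: (lincomb1 (c1 := 1) h); ring.
Qed.

(** Since v 0 = 1 + q^0 = 2, the term s = 0 of [shanks n] is exactly P n. *)
Let half_v0 : 2 / v 0 = 1.
Proof.
have h := divrr (uv 0); rewrite {1}/v fX0 in h.
by apply: (lincomb1 (c1 := 1) h); ring.
Qed.

Let shanks_tele n s :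
  (-1) ^+ s * 2 * (v s)^-1 * (P n.+1 / P s) * X (s * n.+2)%N -
  (-1) ^+ s * 2 * (v s)^-1 * (P n / P s) * X (s * n.+1)%N =
  tele n s.+1 - tele n s.
Proof.
have e1 : P n / P s.+1 * u s.+1 * ((v s.+1)^-1 * (v n.+1)^-1) = P n / P s * (v n.+1)^-1.
  rewrite PS !invrM ?uP ?unitrM ?uu ?unitrV ?uv // invrK.
  have hu := divrr (uu s); have hv := divrr (uv s.+1).
  by ring: hu hv.
have e2 : P n.+1 / P s = P n / P s * ((1 - X n.+1) * (v n.+1)^-1).
  by rewrite PS -/(u n.+1); ring.
rewrite /tele exprS mulN1r e2.
rewrite (_ : s * n.+2 = s * n.+1 + s)%N; last by lia.
rewrite (_ : s.+1 * n.+1 = s * n.+1 + n.+1)%N; last by lia.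
rewrite !fXD (shanks_alg _ _ _ (XvV s) (XvV n.+1)); congr (_ - _).
by rewrite -e1; ring.
Qed.

Let tele0 n : tele n 0 = 0.
Proof. by rewrite /tele (_ : u 0 = 0) ?mulr0 ?mul0r // /u fX0 subrr. Qed.

Let shanksE n : shanks n = 1 + 2 * \sum_(1 <= s < n.+1) (-1) ^+ s * X (s ^ 2)%N.
Proof.
elim: n => [|n IH].
  rewrite /shanks big_nat1 [X in 2 * X]big_geq // mulr0 addr0 mul0n fX0 divrr ?uP //.
  by rewrite expr0 mul1r !mulr1 half_v0.
rewrite [X in 2 * X]big_nat_recr //= mulrDr addrA -IH.
rewrite {1}/shanks big_nat_recr //= divrr ?uP // mulr1.
apply/eqP; rewrite -subr_eq0; apply/eqP.
rewrite (_ : _ - _ = (\sum_(0 <= s < n.+1) (tele n s.+1 - tele n s)) +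
   ((-1) ^+ n.+1 * 2 * (v n.+1)^-1 * X (n.+1 * n.+2)%N -
   2 * ((-1) ^+ n.+1 * X (n.+1 ^ 2)%N))); last first.
  under [in RHS]eq_bigr do rewrite -shanks_tele.
  by rewrite sumrB /shanks; ring.
(* The surviving end of the telescoping sum and the new summand s = n + 1 combine into 2 (-1)^(n+1)
   q^((n+1)^2). *)
rewrite telescope_sumr // tele0 subr0 /tele.
have -> : (n.+1 * n.+2 = n.+1 * n.+1 + n.+1)%N by lia.
rewrite expnS expn1.
have e : P n / P n.+1 * u n.+1 = v n.+1.
  rewrite PS !invrM ?uP ?unitrM ?uu ?unitrV ?uv // invrK.
  have hu := divrr (uu n); have hv := divrr (uP n).
  by ring: hu hv.
have h := divrr (uv n.+1); have h' := XvV n.+1; rewrite fXD.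
set sa := (-1) ^+ n.+1 * 2 * X (n.+1 * n.+1)%N.
apply: (lincomb3 (c1 := sa * (v n.+1)^-1 * (v n.+1)^-1)
  (c2 := sa * (v n.+1)^-1) (c3 := sa) e h h').
by rewrite /sa; ring.
Qed.

Let eqm_shanks n : eqm n.+1 (shanks n) (P n).
Proof.
rewrite /shanks big_ltn // -[X in eqm _ _ X]addr0; apply: eqmD.
  rewrite mul0n fX0 mulr1 expr0 mul1r (_ : P 0 = 1) ?divr1; last by rewrite /P big_geq.
  by rewrite half_v0 mul1r.
move=> m lt; rewrite cf_sum big_nat_cond big1 // => s /andP[/andP[s0 _] _].
rewrite mulrC (@eqm_fX _ (s * n.+1)) // (leq_trans lt) // leq_pmull //.
Qed.

Let cf_signM k f m : cf ((-1) ^+ k * f : fps K) m = (-1) ^+ k * cf f m.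
Proof.
by elim: k f => [|k IH] f; rewrite ?expr0 ?mul1r // exprS -mulrA mulN1r cfN IH exprS mulN1r mulNr.
Qed.

Lemma phim_upto n : eqm n.+1 (phim K) (1 + 2 * \sum_(1 <= s < n.+1) (-1) ^+ s * X (s ^ 2)%N).
Proof.
move=> m lt.
pose l1 := [seq s%:Z | s <- index_iota 1 n.+1].
pose l2 := [seq - s%:Z | s <- index_iota 1 n.+1].
rewrite (@cf_gsum _ _ _ _ (0 :: l1 ++ l2)); first last.
- move=> x; rewrite /sqz => e; rewrite inE mem_cat.
  have le : (absz x <= n)%N by nia.
  case: x e le => [[|k]|k] // e le; apply/orP; right; apply/orP; [left|right]; apply/mapP.
    by exists k.+1; rewrite ?mem_index_iota.
  by exists k.+1; rewrite ?mem_index_iota ?NegzE.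
- rewrite /= mem_cat cat_uniq !map_inj_uniq ?iota_uniq ?andbT; first last.
  + by move=> x y [].
  + by move=> x y /oppr_inj [].
  rewrite negb_or -andbA; apply/and3P; split.
  + by apply/mapP => -[k]; rewrite mem_index_iota => /andP[k0 _] [e]; rewrite -e in k0.
  + by apply/mapP => -[k]; rewrite mem_index_iota => /andP[k0 _] /eqP; rewrite eq_sym oppr_eq0 => /eqP[e]; rewrite e in k0.
  + by apply/hasPn => x /mapP[k]; rewrite mem_index_iota => k0 ->; apply/mapP => -[j]; rewrite mem_index_iota; lia.
rewrite big_cons big_cat !big_map [in RHS]mulr_natl cfD cfMn cf_sum.
have sgnk (k : nat) : sgn K k%:Z = (-1) ^+ k.
  by rewrite /sgn -signr_odd; case: ifP; case: (boolP (odd k)) => //=; lia.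
have sgnN x : sgn K (- x) = sgn K x.
  by rewrite /sgn; case: ifP; case: ifP => //; lia.
have sqzk (k : nat) : (sqz k%:Z == m%:Z) = (m == k ^ 2)%N.
  by rewrite /sqz expr2 -PoszM eqz_nat eq_sym expnS expn1.
congr (_ + _); first by rewrite /sqz /sgn /= mulr1 eq_sym; case: m lt {sqzk}.
rewrite mulr2n; congr (_ + _); apply: eq_bigr => k _.
  by rewrite sgnk sqzk cf_signM mulrC.
by rewrite sgnN sgnk (_ : sqz (- _) = sqz k%:Z) ?sqzk ?cf_signM 1?mulrC // /sqz sqrrN.
Qed.

(** Factor by factor: (1 - q^k)/(1 + q^k) times 1 - q^(2k) is (1 - q^k)^2. *)
Let PE n : P n * fsub 2 (eul_upto n) = eul_upto n ^+ 2.
Proof.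
elim: n => [|n IH].
  by rewrite /P /eul_upto !big_geq // rmorph1 mul1r expr1n.
rewrite PS eul_uptoS (fsubM (eul_upto n)) // raddfB /= rmorph1 fsub_fX //.
rewrite (_ : 1 - X (2 * n.+1)%N = u n.+1 * v n.+1); last first.
  by rewrite mulnC fXM /u /v; ring.
have h := divrr (uv n.+1); rewrite exprMn -/(u n.+1).
by apply: (lincomb2 (c1 := u n.+1 ^+ 2) (c2 := P n * u n.+1 ^+ 2 * fsub 2 (eul_upto n)) IH h); ring.
Qed.

Lemma phim_eul : phim K * fsub 2 eul = eul ^+ 2.
Proof.
apply: eqmP => N; apply: (@eqm_le _ N N.+1) => //.
apply: (eqm_trans (P N * fsub 2 (eul_upto N))).
  apply: eqmM; last by apply: eqm_fsub1 => //; apply: eqm_eul.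
  by have h := @eqm_shanks N; rewrite shanksE in h; exact: (eqm_trans _ (@phim_upto N) h).
by rewrite PE; apply/eqm_sym/eqmX/eqm_eul.
Qed.

(** (g - 2)(g + 2) = 2 (g(q^2) - 2): if g - 2 had order k > 0, the left side would have order k and
    the right side order 2 k. *)
Lemma sqr_fsub2_const (g : fps K) : g ^+ 2 = 2 * fsub 2 g -> ct g = 2 -> g = 2.
Proof.
move=> e g2; apply/eqP; rewrite -subr_eq0; apply: contraT => /fps_low[k hk h0].
have k0 : (0 < k)%N.
  case: k hk {h0} => // /eqP[]; have -> : cf (g - 2) 0 = ct (g - 2) by [].
  by rewrite rmorphB rmorph_nat /= g2 subrr.
have eh : (g - 2) * (g + 2) = 2 * fsub 2 (g - 2).
  rewrite raddfB /= rmorph_nat; apply: (lincomb1 (c1 := 1) e); ring.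
have := cf_mul_low h0 (_ : eqm 0 (g + 2) 0); rewrite addn0 eh mulr_natl cfMn.
rewrite (eqm_fsub0 _ h0) ?cf0 ?mul0rn //; last by lia.
have -> : cf (g + 2) 0 = ct (g + 2) by [].
rewrite rmorphD rmorph_nat /= g2 => /(_ (fun n => ltac:(done))) /esym/eqP.
by rewrite mulf_eq0 (negbTE hk) -natrD pnatr_eq0.
Qed.

Lemma unit_eul j : fsub j eul \is a GRing.unit.
Proof. by rewrite unit_fps -/(ct _) ct_fsub ct_eul oner_eq0. Qed.

Lemma phi_eul : phi K * eul ^+ 2 * fsub 4 eul ^+ 2 = fsub 2 eul ^+ 5.
Proof.
have h := phi_mul_phim K; have h1 := phim_eul.
have h2 := congr1 (fsub 2) phim_eul.
rewrite (fsubM (phim K)) // fsubXn // fsub_fsub // in h2.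
rewrite -h1 [LHS](_ : _ = phi K * phim K * fsub 4 eul ^+ 2 * fsub 2 eul); last by ring.
by rewrite h -exprMn h2; ring.
Qed.

(** The quotient g of [trig K * fsub 2 eul] by [fsub 4 eul ^+ 2] satisfies g^2 = 2 g(q^2), by
    [trig_sqr] and [phi_eul] at q^2, hence g = 2. This replaces the triple product. *)
Lemma trig_eul : trig K * fsub 2 eul = 2 * fsub 4 eul ^+ 2.
Proof.
have [g gE] : exists g, g * fsub 4 eul ^+ 2 = trig K * fsub 2 eul.
  exists (trig K * fsub 2 eul / fsub 4 eul ^+ 2).
  by rewrite divrK // unitrX // unit_eul.
have g2E := congr1 (fsub 2) gE.
rewrite (fsubM g) // (fsubM (trig K)) // fsubXn // !fsub_fsub // in g2E.
have pE := congr1 (fsub 2) phi_eul.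
rewrite (fsubM (_ * _)) // (fsubM (phi K)) // !fsubXn // !fsub_fsub // in pE.
have tE := trig_sqr K.
have n0 : fsub 4 eul ^+ 4 * fsub 8 eul ^+ 2 != 0.
  by rewrite ct_neq0 // ctM !ctX !ct_fsub ct_eul !expr1n mulr1 oner_eq0.
rewrite -gE (_ : g = 2) //; apply: sqr_fsub2_const.
  apply: (mulIf n0).
  transitivity ((trig K * fsub 2 eul) ^+ 2 * fsub 8 eul ^+ 2); first by rewrite -gE; ring.
  transitivity (2 * fsub 4 eul ^+ 4 * (fsub 2 g * fsub 8 eul ^+ 2)); last by ring.
  rewrite g2E; apply: (lincomb2 (c1 := fsub 2 eul ^+ 2 * fsub 8 eul ^+ 2)
    (c2 := 2 * fsub 2 (trig K)) tE pE); ring.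
have := congr1 (@ct K) gE; rewrite !ctM ?ctX !ct_fsub ct_eul ?expr1n !mulr1 => ->.
exact: trig0.
Qed.

End EulerProduct.

(** * Products of pairs in a finite window *)

Section WindowAlgebra.
Variable R : comNzRingType.
Implicit Types e kap : nat -> R.

Lemma sum_sqr_pairs (f : nat -> R) M :
  (\sum_(0 <= i < M) f i) ^+ 2 =
  \sum_(0 <= i < M) f i ^+ 2 +
  2 * \sum_(0 <= j < M) \sum_(0 <= i < j) f i * f j.
Proof.
elim: M => [|M IH]; first by rewrite !big_geq //; ring.
by rewrite !(big_nat_recr M) //= sqrrD IH -mulr_suml; ring.
Qed.

(** Regroups the pairs i < j by k = j - i, on which alone the partial fraction coefficients
    depend. *)
Lemma sum_tri_diff (g : nat -> nat -> R) M :
  \sum_(0 <= j < M) \sum_(0 <= i < j) g i (j - i)%N =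
  \sum_(1 <= k < M) \sum_(0 <= i < M - k) g i k.
Proof.
elim: M => [|M IH]; first by rewrite !big_geq.
rewrite big_nat_recr //= IH; case: M {IH} => [|M]; first by rewrite !big_geq ?addr0.
rewrite [RHS](big_nat_recr M.+1) //= subSnn big_nat1.
under [X in _ = X + _]eq_big_nat => k /andP[_ lk].
  rewrite subSn ?(ltnW lk) // big_nat_recr //=; over.
rewrite big_split /= -addrA; congr (_ + _).
transitivity (\sum_(1 <= k < M.+2) g (M.+1 - k)%N k); last first.
  by rewrite big_nat_recr //= subnn.
rewrite big_add1 /= big_nat_rev /= add0n.
by apply: eq_big_nat => k lk; congr (g _ _); lia.
Qed.

Lemma sum_shift_telescope e M k : (k <= M)%N ->
  \sum_(0 <= i < M - k) (e i - e (i + k)%N) =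
  \sum_(0 <= i < k) e i - \sum_(M - k <= i < M) e i.
Proof.
move=> le; rewrite sumrB.
have h1 := @big_cat_nat _ 0 +%R (M - k) 0 M xpredT e (leq0n _) (leq_subr _ _).
have h2 := @big_cat_nat _ 0 +%R k 0 M xpredT e (leq0n _) le.
have h3 : \sum_(k <= i < M) e i = \sum_(0 <= i < M - k) e (i + k)%N.
  by rewrite -{1}[k]add0n big_addn.
by rewrite /= in h1 h2; apply: (lincomb3 (c1 := -1) (c2 := 1) (c3 := 1) h1 h2 h3); ring.
Qed.

Lemma sum_shift_add e M k : (k <= M)%N ->
  \sum_(0 <= i < M - k) (e i + e (i + k)%N) =
  2 * (\sum_(0 <= i < M) e i) - (\sum_(0 <= i < k) e i + \sum_(M - k <= i < M) e i).
Proof.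
move=> le; rewrite big_split /=.
have h1 := @big_cat_nat _ 0 +%R (M - k) 0 M xpredT e (leq0n _) (leq_subr _ _).
have h2 := @big_cat_nat _ 0 +%R k 0 M xpredT e (leq0n _) le.
have h3 : \sum_(k <= i < M) e i = \sum_(0 <= i < M - k) e (i + k)%N.
  by rewrite -{1}[k]add0n big_addn.
by rewrite /= in h1 h2; apply: (lincomb3 (c1 := -1) (c2 := -1) (c3 := -1) h1 h2 h3); ring.
Qed.

Lemma sum_pairs_diff e kap M :
  \sum_(0 <= j < M) \sum_(0 <= i < j) kap (j - i)%N * (e i - e j) =
  \sum_(1 <= k < M) kap k *
    (\sum_(0 <= i < k) e i - \sum_(M - k <= i < M) e i).
Proof.
transitivity (\sum_(0 <= j < M) \sum_(0 <= i < j)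
    kap (j - i)%N * (e i - e (i + (j - i))%N)).
  apply: eq_big_nat => j _; apply: eq_big_nat => i /andP[_ li].
  by rewrite subnKC // ltnW.
rewrite (sum_tri_diff (fun i k => kap k * (e i - e (i + k)%N))); apply: eq_big_nat => k /andP[_ lk].
by rewrite -mulr_sumr sum_shift_telescope // ltnW.
Qed.

Lemma sum_pairs_add e kap M :
  \sum_(0 <= j < M) \sum_(0 <= i < j) kap (j - i)%N * (e i + e j) =
  \sum_(1 <= k < M) kap k * (2 * (\sum_(0 <= i < M) e i) -
    (\sum_(0 <= i < k) e i + \sum_(M - k <= i < M) e i)).
Proof.
transitivity (\sum_(0 <= j < M) \sum_(0 <= i < j)
    kap (j - i)%N * (e i + e (i + (j - i))%N)).
  apply: eq_big_nat => j _; apply: eq_big_nat => i /andP[_ li].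
  by rewrite subnKC // ltnW.
rewrite (sum_tri_diff (fun i k => kap k * (e i + e (i + k)%N))); apply: eq_big_nat => k /andP[_ lk].
by rewrite -mulr_sumr sum_shift_add // ltnW.
Qed.

Lemma sum_pairs_left e M :
  \sum_(0 <= j < M) \sum_(0 <= i < j) e i = \sum_(0 <= i < M) (M - i.+1)%:R * e i.
Proof.
elim: M => [|M IH]; first by rewrite !big_geq.
rewrite !big_nat_recr //= IH subnn mul0r addr0 -big_split /=.
apply: eq_big_nat => i /andP[_ li].
by rewrite subSS -(subnSK li) -[(M - i.+1).+1]addn1 natrD; ring.
Qed.

(* For e_i = 1 / (1 - x c^i) one has e_i e_j = e_i + kap_(j - i) (e_i - e_j)
   with kap_k = c^k / (1 - c^k), and sum_i (e_i - e_(i + k)) telescopes. *)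
Lemma window_sum_sqr e kap M :
  (forall i j, (i < j)%N -> (j < M)%N ->
     e i * e j = e i + kap (j - i)%N * (e i - e j)) ->
  (\sum_(0 <= i < M) e i) ^+ 2 =
  \sum_(0 <= i < M) e i ^+ 2 + 2 * \sum_(0 <= i < M) (M - i.+1)%:R * e i +
  2 * \sum_(1 <= k < M) kap k *
    (\sum_(0 <= i < k) e i - \sum_(M - k <= i < M) e i).
Proof.
move=> h; rewrite sum_sqr_pairs -addrA; congr (_ + _); rewrite -mulrDr; congr (_ * _).
rewrite -sum_pairs_left -sum_pairs_diff -big_split; apply: eq_big_nat => j /andP[_ lj].
by rewrite -big_split; apply: eq_big_nat => i /andP[_ li] /=; rewrite h.
Qed.

(** Partial fractions at double poles: f_i f_j = lam_k (f_i + f_j) - lam_k (1 + 2 kap_k)(e_i - e_j)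
    with k = j - i. Up to window ends, the first part gives multiples of the sum of f, and the
    second telescopes. *)
Lemma window_sum_fun_sqr e kap M :
  let f i := e i ^+ 2 - e i in
  let lam k := kap k ^+ 2 + kap k in
  (forall i j, (i < j)%N -> (j < M)%N ->
     e i * e j = e i + kap (j - i)%N * (e i - e j)) ->
  (\sum_(0 <= i < M) f i) ^+ 2 =
  \sum_(0 <= i < M) f i ^+ 2 +
  2 * \sum_(1 <= k < M) lam k * (2 * (\sum_(0 <= i < M) f i) -
    (\sum_(0 <= i < k) f i + \sum_(M - k <= i < M) f i)) -
  2 * \sum_(1 <= k < M) lam k * (1 + 2 * kap k) *
    (\sum_(0 <= i < k) e i - \sum_(M - k <= i < M) e i).
Proof.
move=> f lam h; rewrite sum_sqr_pairs -addrA; congr (_ + _).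
rewrite -mulrN -mulrDr; congr (_ * _).
rewrite -(sum_pairs_add f lam) -(sum_pairs_diff e (fun k => lam k * (1 + 2 * kap k))).
rewrite -sumrN -big_split; apply: eq_big_nat => j /andP[_ lj] /=.
rewrite -sumrN -big_split; apply: eq_big_nat => i /andP[_ li] /=.
rewrite /f /lam; have := h i j li lj; move: (e i) (e j) (kap _) => x y k hh.
by ring: hh.
Qed.

End WindowAlgebra.

(** * Passage to two-sided infinite sums *)

Section InfiniteSums.
Variable K : numFieldType.
Implicit Types f g : nat -> fps K.

(** f_j = O(q^j) makes the diagonal definition of [fsum] agree with the infinite sum. *)
Definition small f := forall j, eqm j (f j) 0.
Definition fsum f : fps K := Fps (fun n => cf (\sum_(0 <= j < n.+1) f j) n).

Lemma eqm_fsum f N M : small f -> (N <= M)%N -> eqm N (fsum f) (\sum_(0 <= j < M) f j).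
Proof.
move=> sf le n lt /=; rewrite (@big_cat_nat _ _ _ n.+1 0 M) //; last exact: leq_trans le.
rewrite cfD [X in _ = _ + X]cf_sum [X in _ = _ + X]big_nat_cond.
by rewrite [X in _ = _ + X]big1 ?addr0 // => i /andP[/andP[li _] _]; apply: sf.
Qed.

Lemma eqm0_mulr n (f g : fps K) : eqm n f 0 -> eqm n (f * g) 0.
Proof. by move=> f0; rewrite -[n]addn0; apply: eqm0M. Qed.
Lemma smallM f g : small f -> small (fun j => g j * f j).
Proof. by move=> sf j; have := eqm0M (_ : eqm 0 (g j) 0) (sf j); apply. Qed.
Lemma smallD f g : small f -> small g -> small (fun j => f j + g j).
Proof. by move=> sf sg j n lt; rewrite cfD sf ?sg // addr0. Qed.
Lemma smallN f : small f -> small (fun j => - f j).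
Proof. by move=> sf j n lt; rewrite cfN sf // oppr0. Qed.

Lemma fsumD f g : small f -> small g -> fsum (fun j => f j + g j) = fsum f + fsum g.
Proof. by move=> sf sg; apply: fpsP => n; rewrite cfD /= big_split cfD. Qed.
Lemma fsumZ c f : small f -> fsum (fun j => c * f j) = c * fsum f.
Proof.
move=> sf; apply: eqmP => N; have sc := smallM (fun=> c) sf.
apply: (eqm_trans _ (eqm_fsum sc (leqnn N))); rewrite -mulr_sumr.
by apply: eqmM => //; apply/eqm_sym/eqm_fsum.
Qed.

Section Window.
Variables P N kap : nat -> fps K.
Hypotheses (sP : small P) (sN : small N) (sk : small kap).
(** Position i stands for the index k = i - n, -n <= k < n. For k >= 0 the term is 1 + P_k, tending
    to 1; for k = -1 - j it is N_j, tending to 0. Omitting the ones regularizes the two-sided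
    sum. *)
Let e n i := if (i < n)%N then N (n - i.+1)%N else 1 + P (i - n)%N.
Hypothesis pairs : forall n i j, (i < j)%N -> (j < n + n)%N ->
  e n i * e n j = e n i + kap (j - i)%N * (e n i - e n j).

Let split_window n (h : nat -> fps K -> fps K) :
  \sum_(0 <= i < n + n) h i (e n i) =
  \sum_(0 <= j < n) h (n - j.+1)%N (N j) + \sum_(0 <= j < n) h (n + j)%N (1 + P j).
Proof.
rewrite (@big_cat_nat _ _ _ n) ?leq_addr //=; congr (_ + _).
  rewrite big_nat_rev; apply: eq_big_nat => i /andP[_ li].
  by rewrite /e add0n ifT; [congr (h _ (N _)); lia|lia].
rewrite -{1}[n]add0n big_addn addnK; apply: eq_big_nat => i /andP[_ li].
by rewrite /e ltnNge leq_addl /= addnK addnC.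
Qed.

Let e_low n k i : (i < k)%N -> (k < n)%N -> forall c g, eqm k c 0 -> small g ->
  eqm n (c * g (n - i.+1)%N) 0.
Proof.
by move=> lik lkn c g c0 sg; apply: (@eqm_le _ _ (k + (n - i.+1))); [lia|apply: eqm0M].
Qed.

Let eqm_big0 n m1 m2 (g : nat -> fps K) :
  (forall i, (m1 <= i < m2)%N -> eqm n (g i) 0) -> eqm n (\sum_(m1 <= i < m2) g i) 0.
Proof.
move=> h m lt; rewrite cf_sum big_nat_cond big1 // => i /andP[li _]; exact: h.
Qed.

Let eqm_big n m1 m2 (f g : nat -> fps K) :
  (forall i, (m1 <= i < m2)%N -> eqm n (f i) (g i)) ->
  eqm n (\sum_(m1 <= i < m2) f i) (\sum_(m1 <= i < m2) g i).
Proof.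
move=> h m lt; rewrite !cf_sum; apply: eq_big_nat => i li; exact: h.
Qed.

(* Modulo q^n the window ends contribute sum_(i < k) e_i = 0 and
   sum_(2 n - k <= i < 2 n) e_i = k once multiplied by c_k = O(q^k). *)
Let window_ends n (c : nat -> fps K) : small c ->
  eqm n (\sum_(1 <= k < n + n) c k *
     (\sum_(0 <= i < k) e n i - \sum_(n + n - k <= i < n + n) e n i))
   (- fsum (fun k => k%:R * c k)).
Proof.
move=> sc; have skc := smallM (fun k => k%:R) sc.
apply: (eqm_trans (- \sum_(0 <= k < n + n) k%:R * c k)); last first.
  by apply/eqmN/eqm_sym/eqm_fsum; rewrite ?leq_addr.
case: n => [|n]; first by move=> m.
rewrite [X in eqm _ _ (- X)]big_ltn ?addSn // mul0r add0r -sumrN.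
apply: eqm_big => k /andP[k0 lk].
have [le|lt] := leqP n.+1 k.
  apply: (@eqm_le _ _ k) => //; apply: (eqm_trans 0).
    exact: eqm0_mulr.
  by apply: eqm_sym; apply: smallN skc k.
rewrite mulrBr -sub0r; apply: eqmB.
  rewrite mulr_sumr; apply: eqm_big0 => i /andP[_ li].
  by rewrite /e (ltn_trans li lt); apply: (e_low li lt).
rewrite mulr_sumr; apply: (eqm_trans (\sum_(n.+1 + n.+1 - k <= i < n.+1 + n.+1) c k)); last first.
  by rewrite sumr_const_nat mulr_natl (_ : _ - _ = k)%N //; lia.
apply: eqm_big => i /andP[li ui].
have -> : e n.+1 i = 1 + P (i - n.+1)%N by rewrite /e ltnNge; have -> : (n.+1 <= i)%N by lia.
rewrite mulrDr mulr1 -[X in eqm _ _ X]addr0; apply: eqmD => //.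
by apply: (@eqm_le _ _ (k + (i - n.+1))); [lia|apply: eqm0M].
Qed.

Let sum_natr n : 2 * \sum_(0 <= j < n) j%:R = n%:R ^+ 2 - n%:R :> fps K.
Proof.
elim: n => [|n IH]; first by rewrite big_geq //; ring.
by rewrite big_nat_recr //= mulrDr IH -[n.+1]addn1 natrD; ring.
Qed.

Let E := fsum P + fsum N.
Let F := fsum (fun j => P j ^+ 2 + P j) + fsum (fun j => N j ^+ 2 - N j).
Let T := fsum (fun j => j%:R * P j) - fsum (fun j => j.+1%:R * N j).

Let sP2 : small (fun j => P j ^+ 2 + P j).
Proof. by apply: smallD => //; apply: (smallM P). Qed.
Let sN2 : small (fun j => N j ^+ 2 - N j).
Proof. by apply: smallD; [apply: (smallM N)|apply: smallN]. Qed.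

Lemma window_square : E ^+ 2 + E = F - 2 * T - 2 * fsum (fun k => k%:R * kap k).
Proof.
apply: eqmP => n.
have eP := eqm_fsum sP (leqnn n); have eN := eqm_fsum sN (leqnn n).
have eP2 := eqm_fsum sP2 (leqnn n); have eN2 := eqm_fsum sN2 (leqnn n).
have ejP := eqm_fsum (smallM (fun j => j%:R) sP) (leqnn n).
have ejN := eqm_fsum (smallM (fun j => j.+1%:R) sN) (leqnn n).
have /= := window_sum_sqr (@pairs n).
rewrite (split_window n (fun _ x => x)) (split_window n (fun _ x => x ^+ 2)).
rewrite (split_window n (fun i x => (n + n - i.+1)%:R * x)).
set W := \sum_(1 <= k < n + n) _; have eW : eqm n W _ := window_ends sk.
set Pn := \sum_(0 <= j < n) P j in eP *; set Nn := \sum_(0 <= j < n) N j in eN *.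
set Fp := \sum_(0 <= j < n) _ in eP2; set Fn := \sum_(0 <= j < n) _ in eN2.
set jP := \sum_(0 <= j < n) _ in ejP; set jN := \sum_(0 <= j < n) _ in ejN.
have -> : \sum_(0 <= j < n) (1 + P j) = n%:R + Pn.
  by rewrite big_split /= sumr_const_nat subn0.
have -> : \sum_(0 <= j < n) N j ^+ 2 = Fn + Nn.
  by rewrite /Fn /Nn -big_split; apply: eq_bigr => j _ /=; ring.
have -> : \sum_(0 <= j < n) (1 + P j) ^+ 2 = n%:R + Pn + Fp.
  transitivity (\sum_(0 <= j < n) ((1 + P j) + (P j ^+ 2 + P j))).
    by apply: eq_bigr => j _; ring.
  by rewrite big_split /= big_split /= sumr_const_nat subn0.
have -> : \sum_(0 <= j < n) (n + n - (n - j.+1).+1)%:R * N j = (n%:R - 1) * Nn + jN.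
  rewrite /Nn mulr_sumr -big_split; apply: eq_big_nat => j /andP[_ lj] /=.
  have -> : (n + n - (n - j.+1).+1 = n + j)%N by lia.
  by rewrite natrD -[j.+1]addn1 natrD; ring.
have -> : \sum_(0 <= j < n) (n + n - (n + j).+1)%:R * (1 + P j) =
    n%:R * n%:R - n%:R - \sum_(0 <= j < n) j%:R + (n%:R - 1) * Pn - jP.
  transitivity (\sum_(0 <= j < n) (n%:R + (-1) + (- j%:R) + (n%:R - 1) * P j - j%:R * P j)).
    apply: eq_big_nat => j /andP[_ lj].
    have -> : n%:R = (n + n - (n + j).+1)%:R + j%:R + 1 :> fps K.
      have nE : (n = (n + n - (n + j).+1) + j + 1)%N by lia.
      by rewrite {1}nE !natrD.
    by ring.
  rewrite sumrB !big_split /= !sumr_const_nat subn0 sumrN -mulr_sumr /Pn /jP.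
  by rewrite -[n%:R *+ n]mulr_natl -[(-1) *+ n]mulr_natl; ring.
move=> h; have hs := sum_natr n.
(* The ones and the weights n + n - i - 1 of the window produce terms in n^2, n Pn and n Nn; all of
   them cancel, [hs] taking care of the sum of the j. *)
have ex : (Pn + Nn) ^+ 2 + (Pn + Nn) = (Fp + Fn) - 2 * (jP - jN) - 2 * (- W).
  by apply: (lincomb2 (c1 := 1) (c2 := -1) h hs); ring.
apply: (eqm_trans ((Pn + Nn) ^+ 2 + (Pn + Nn))).
  by apply: eqmD; [apply: eqmX|]; apply: eqmD.
have eW' : eqm n (fsum (fun k => k%:R * kap k)) (- W).
  by apply: eqm_sym; rewrite -[fsum _]opprK; apply: eqmN.
rewrite ex; apply: eqm_sym; apply: eqmB; last by apply: eqmM.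
by apply: eqmB; [apply: eqmD|apply: eqmM => //; apply: eqmB].
Qed.

Let lam k := kap k ^+ 2 + kap k.
Let slam : small lam.
Proof. by apply: smallD => //; apply: (smallM kap). Qed.

Hypothesis kap0 : kap 0 = 0.

Let window_sum_ends n (c f g h : nat -> fps K) :
  small c -> small f -> small g -> c 0%N = 0 ->
  (forall i, (i < n)%N -> h i = f (n - i.+1)%N) ->
  (forall i, (n <= i)%N -> h i = g (i - n)%N) ->
  eqm n (\sum_(1 <= k < n + n) c k * (2 * (\sum_(0 <= i < n + n) h i) -
     (\sum_(0 <= i < k) h i + \sum_(n + n - k <= i < n + n) h i)))
   (fsum c * (2 * \sum_(0 <= i < n + n) h i)).
Proof.
move=> sc sf sg c0; case: n => [|n] hf hg; first by move=> m.
apply: (eqm_trans ((\sum_(0 <= k < n.+1 + n.+1) c k) * (2 * \sum_(0 <= i < n.+1 + n.+1) h i))); last first.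
  by apply: eqmM => //; apply/eqm_sym/eqm_fsum; rewrite ?leq_addr.
rewrite [X in eqm _ _ (X * _)]big_ltn ?addSn // c0 add0r mulr_suml.
apply: eqm_big => k /andP[k0 lk].
rewrite mulrBr -[X in eqm _ _ X]subr0; apply: eqmB => //.
have [le|lt] := leqP n.+1 k; first by apply: (@eqm_le _ _ k) => //; apply: eqm0_mulr.
rewrite mulrDr -[X in eqm _ _ X]addr0; apply: eqmD; rewrite mulr_sumr; apply: eqm_big0 => i /andP[li ui].
  by rewrite hf ?(ltn_trans ui lt) //; apply: (e_low ui lt).
rewrite hg; last by lia.
by apply: (@eqm_le _ _ (k + (i - n.+1))); [lia|apply: eqm0M].
Qed.

(** The limit of [window_sum_fun_sqr], arranged around F plus 6 times the sum of the f_k^2 because f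
    + 6 f^2 is the combination with Lambert coefficients d^3 z^d. *)
Lemma window_quartic :
  F + 6 * (fsum (fun j => (P j ^+ 2 + P j) ^+ 2) + fsum (fun j => (N j ^+ 2 - N j) ^+ 2)) =
  F + 6 * F ^+ 2 - 24 * fsum lam * F -
  12 * fsum (fun k => k%:R * (lam k * (1 + 2 * kap k))).
Proof.
apply: eqmP => n.
have eP2 := eqm_fsum sP2 (leqnn n); have eN2 := eqm_fsum sN2 (leqnn n).
have sP4 : small (fun j => (P j ^+ 2 + P j) ^+ 2).
  by move=> j; rewrite expr2; apply: eqm0_mulr; apply: sP2.
have sN4 : small (fun j => (N j ^+ 2 - N j) ^+ 2).
  by move=> j; rewrite expr2; apply: eqm0_mulr; apply: sN2.
have eP4 := eqm_fsum sP4 (leqnn n); have eN4 := eqm_fsum sN4 (leqnn n).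
have /= := window_sum_fun_sqr (@pairs n); rewrite -/lam.
pose h i := e n i ^+ 2 - e n i; rewrite -/(h).
set WA := \sum_(1 <= k < n + n) _ => hh.
have eA : eqm n WA (fsum lam * (2 * \sum_(0 <= i < n + n) h i)).
  apply: (window_sum_ends slam sN2 sP2); first by rewrite /lam kap0 expr0n add0r.
    by move=> i li; rewrite /h /e li.
  by move=> i li; rewrite /h /e ltnNge li /=; ring.
move: hh; set WB := \sum_(1 <= k < n + n) _ => hh.
have eB : eqm n WB (- fsum (fun k => k%:R * (lam k * (1 + 2 * kap k)))).
  by apply: window_ends => k; apply: eqm0_mulr; apply: slam.
clearbody WA WB; move: hh eA; rewrite /h.
rewrite (split_window n (fun _ x => x ^+ 2 - x)) (split_window n (fun _ x => (x ^+ 2 - x) ^+ 2)).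
have -> : \sum_(0 <= j < n) ((1 + P j) ^+ 2 - (1 + P j)) = \sum_(0 <= j < n) (P j ^+ 2 + P j).
  by apply: eq_bigr => j _; ring.
have -> : \sum_(0 <= j < n) ((1 + P j) ^+ 2 - (1 + P j)) ^+ 2 = \sum_(0 <= j < n) (P j ^+ 2 + P j) ^+ 2.
  by apply: eq_bigr => j _; congr (_ ^+ 2); ring.
set Fp := \sum_(0 <= j < n) _ in eP2 *; set Fn := \sum_(0 <= j < n) _ in eN2 *.
set Qp := \sum_(0 <= j < n) _ in eP4 *; set Qn := \sum_(0 <= j < n) _ in eN4 *.
move=> hh eA; set Lam := fsum lam in eA *; set Xi := fsum _ in eB *.
apply: (eqm_trans (Fp + Fn + 6 * (Qp + Qn))).
  by apply: eqmD; [apply: eqmD|apply: eqmM => //; apply: eqmD].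
have -> : Fp + Fn + 6 * (Qp + Qn) = Fp + Fn + 6 * (Fp + Fn) ^+ 2 - 12 * WA - 12 * (- WB).
  by apply: (lincomb1 (c1 := -6) hh); ring.
have -> : 24 * Lam * F = 12 * (Lam * (2 * F)) by ring.
have eF : eqm n F (Fp + Fn) by apply: eqmD.
apply: eqm_sym; apply: eqmB; last first.
  by apply: eqmM => //; rewrite -[Xi]opprK; apply/eqmN/eqm_sym.
apply: eqmB; first by apply: eqmD => //; apply: eqmM => //; apply: eqmX.
apply: eqmM => //; apply: eqm_sym; apply: (eqm_trans _ eA).
by apply: eqmM => //; apply: eqmM => //; rewrite addrC; apply: eqm_sym.
Qed.

End Window.
End InfiniteSums.

(** * Double Lambert series *)

Section DoubleLambert.
Variable K : numFieldType.
Local Notation X := (fX K).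
Implicit Types (f : fps K) (g : nat -> nat -> K).

(** The series with terms g(m, d) q^(m d), m, d >= 1; the finite ranges lose nothing, since m d = n
    bounds both indices by n. *)
Definition LL g : fps K := Fps (fun n =>
  \sum_(1 <= m < n.+1) \sum_(1 <= d < n.+1) (m * d == n)%N%:R * g m d).

Lemma sum_nat_cut (F : nat -> K) n M : (n < M)%N ->
  (forall m, (n < m)%N -> F m = 0) ->
  \sum_(1 <= m < M) F m = \sum_(1 <= m < n.+1) F m.
Proof.
move=> lt F0; rewrite (@big_cat_nat _ _ _ n.+1 1 M) //= [X in _ + X]big_nat_cond.
by rewrite [X in _ + X]big1 ?addr0 // => i /andP[/andP[li _] _]; apply: F0.
Qed.

Lemma cf_LL g n M M' : (n < M)%N -> (n < M')%N -> cf (LL g) n =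
  \sum_(1 <= m < M) \sum_(1 <= d < M') (m * d == n)%N%:R * g m d.
Proof.
move=> lM lM'; rewrite (sum_nat_cut lM) /=.
  apply: eq_big_nat => m /andP[m0 _]; rewrite (sum_nat_cut lM') // => d ld.
  by have -> : (m * d == n)%N = false; [nia|rewrite mul0r].
move=> m lm; rewrite big_nat_cond big1 // => d /andP[/andP[d0 _] _].
by have -> : (m * d == n)%N = false; [nia|rewrite mul0r].
Qed.

Lemma eqm_LL g N M M' : (N <= M)%N -> (N <= M')%N ->
  eqm N (LL g) (\sum_(1 <= m < M) \sum_(1 <= d < M') fC (g m d) * X (m * d)).
Proof.
move=> lM lM' n lt; rewrite (@cf_LL g n M M') ?(leq_trans lt) // cf_sum.
apply: eq_bigr => m _; rewrite cf_sum; apply: eq_bigr => d _.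
by rewrite cfCM /= eq_sym mulrC.
Qed.

Lemma LL_swap g : LL g = LL (fun m d => g d m).
Proof.
apply: fpsP => n; rewrite /= exchange_big_nat /=.
by apply: eq_bigr => m _; apply: eq_bigr => d _; rewrite mulnC.
Qed.

Lemma eq_LL g g' : (forall m d, (0 < m)%N -> (0 < d)%N -> g m d = g' m d) -> LL g = LL g'.
Proof.
move=> e; apply: fpsP => n /=; apply: eq_big_nat => m /andP[m0 _].
by apply: eq_big_nat => d /andP[d0 _]; rewrite e.
Qed.

Lemma LLD g g' : LL (fun m d => g m d + g' m d) = LL g + LL g'.
Proof.
apply: fpsP => n; rewrite cfD /= -big_split; apply: eq_bigr => m _ /=.
by rewrite -big_split; apply: eq_bigr => d _ /=; rewrite mulrDr.
Qed.

Lemma LLZ c g : LL (fun m d => c * g m d) = fC c * LL g.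
Proof.
apply: fpsP => n; rewrite cfCM /= mulr_sumr; apply: eq_bigr => m _.
by rewrite mulr_sumr; apply: eq_bigr => d _; rewrite mulrCA.
Qed.

Lemma LLMn k g : LL (fun m d => k%:R * g m d) = k%:R * LL g.
Proof. by rewrite LLZ rmorph_nat. Qed.

Lemma LLN g : LL (fun m d => - g m d) = - LL g.
Proof.
rewrite -[RHS]mulN1r -(rmorph1 (@fC K)) -rmorphN -LLZ.
by apply: eq_LL => m d _ _; rewrite mulN1r.
Qed.

Lemma LLB g g' : LL (fun m d => g m d - g' m d) = LL g - LL g'.
Proof. by rewrite LLD LLN. Qed.

Lemma sum_reindex_image (V : nmodType) (idx : nat -> nat) (P : pred nat) (F : nat -> V) N M :
  injective idx ->
  (forall j, (j < N)%N -> (idx j < M)%N && P (idx j)) ->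
  (forall m, (m < M)%N -> P m -> exists2 j, (j < N)%N & m = idx j) ->
  \sum_(0 <= m < M | P m) F m = \sum_(0 <= j < N) F (idx j).
Proof.
move=> inj h1 h2; rewrite -big_filter -(big_map idx xpredT).
apply: perm_big; apply: uniq_perm; rewrite ?filter_uniq ?map_inj_uniq ?iota_uniq //.
move=> m; rewrite mem_filter mem_index_iota /=; apply/andP/mapP => [[Pm lm]|[j]].
  by have [j lj ->] := h2 m lm Pm; exists j; rewrite ?mem_index_iota.
by rewrite mem_index_iota => /h1/andP[? ?] ->.
Qed.

Lemma fsub_LL j g : (0 < j)%N ->
  fsub j (LL g) = LL (fun m d => (j %| d)%N%:R * g m (d %/ j)%N).
Proof.
move=> j0; apply: eqmP => N; have le : (N <= j * N)%N by rewrite leq_pmull.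
apply: (eqm_trans _ (eqm_fsub1 j0 (eqm_LL g (leqnn N) (leqnn N)))).
apply: eqm_sym; apply: (eqm_trans _ (eqm_LL _ (leqnn N) le)) => n _; congr (cf _ n).
rewrite raddf_sum; apply: eq_bigr => m _; rewrite raddf_sum /=.
case: N le => [|N] le; first by rewrite muln0 !big_geq.
transitivity (\sum_(0 <= d < j * N.+1 | (j %| d)%N && (0 < d)%N) fC (g m (d %/ j)%N) * X (m * d)).
  rewrite [RHS]big_ltn_cond ?muln_gt0 ?j0 // dvdn0 /= big_mkcond [RHS]big_mkcond /=.
  rewrite [RHS]big_nat_cond [LHS]big_nat_cond; apply: eq_bigr => d /andP[/andP[d0 _] _].
  by rewrite d0 andbT; case: ifP; rewrite ?mul0r ?rmorph0 ?mul0r ?mul1r.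
rewrite (@sum_reindex_image _ (fun i => j * i.+1)%N _ _ N); first last.
- move=> d ld /andP[/dvdnP[i di]]; rewrite di muln_gt0 => /andP[i0 _].
  exists i.-1; last by rewrite prednK // mulnC.
  by move: ld; rewrite di mulnC ltn_pmul2l //; case: i i0 {di}.
- by move=> i li; rewrite dvdn_mulr // muln_gt0 j0 ltn_pmul2l ?ltnS ?li.
- by move=> x y /eqP; rewrite eqn_pmul2l // => /eqP[].
rewrite big_add1 /=; apply: eq_bigr => i _.
by rewrite fsubM // fsub_fC // fsub_fX // mulKn //; congr (_ * X _); lia.
Qed.

End DoubleLambert.

(** * Geometric series, their derivatives and their sums over progressions *)

Section Geometric.
Variable K : numFieldType.
Local Notation X := (fX K).

Definition tm (z : K) s : fps K := fC z * X s.
Arguments tm z s%_nat_scope.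
Definition gm z s : fps K := tm z s / (1 - tm z s).
Arguments gm z s%_nat_scope.
(** The condition for 1 - z q^s to be a unit: its constant term vanishes only for s = 0 and z =
    1. *)
Definition reg (z : K) (s : nat) := (s == 0%N) ==> (z != 1).
Arguments reg z s%_nat_scope.

Lemma ct_tm z s : ct (tm z s) = (s == 0%N)%:R * z.
Proof. by rewrite /ct /tm cfCM /= mulrC eq_sym. Qed.
Lemma unit_tm z s : reg z s -> 1 - tm z s \is a GRing.unit.
Proof.
rewrite unit_fps (_ : cf _ 0 = 1 - ct (tm z s)) // ct_tm /reg.
by case: eqP => /= _; rewrite ?mul1r ?mul0r ?subr0 ?oner_eq0 // subr_eq0 eq_sym.
Qed.
Lemma gm_eq z s : reg z s -> (1 - tm z s) * gm z s = tm z s.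
Proof. by move=> /unit_tm u; rewrite mulrC divrK. Qed.
Lemma eqm_gm z s : eqm s (gm z s) 0.
Proof. by rewrite /gm /tm -mulrA mulrCA; apply: eqm_fX. Qed.
Lemma tmX z s d : tm z s ^+ d = fC (z ^+ d) * X (s * d).
Proof. by rewrite exprMn -rmorphXn -fXM. Qed.

(** Restricted to s > 0: at s = 0 powers of q no longer separate the terms, and [gm z 0] is the
    constant z/(1 - z), which is kept apart. *)
Definition lambert_coefs (h : nat -> fps K) (c : nat -> nat -> K) :=
  forall s N, (0 < s)%N -> eqm N (h s) (\sum_(1 <= d < N) fC (c s d) * X (s * d)).

Lemma eqm_divl N (u f g : fps K) : u \is a GRing.unit ->
  eqm N (u * f) (u * g) -> eqm N f g.
Proof.
move=> uu e; rewrite -[f](mulKr uu) -[g](mulKr uu); exact: eqmM.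
Qed.

Lemma reg_pos z s : (0 < s)%N -> reg z s. Proof. by case: s. Qed.

Lemma gm_coefs z : lambert_coefs (gm z) (fun _ d => z ^+ d).
Proof.
move=> s N s0; apply: (eqm_divl (unit_tm (reg_pos z s0))); rewrite (gm_eq (reg_pos z s0)).
case: N => [|N] //.
have -> : (1 - tm z s) * (\sum_(1 <= d < N.+1) fC (z ^+ d) * X (s * d)) = tm z s - tm z s ^+ N.+1.
  under eq_bigr do rewrite -tmX.
  elim: N => [|N IH]; first by rewrite big_geq // mulr0 subrr.
  by rewrite big_nat_recr //= mulrDr IH [tm z s ^+ N.+2]exprS; ring.
rewrite -[X in eqm _ X _]subr0; apply: eqmB => //; apply: eqm_sym.
by rewrite tmX mulrC => n lt; apply: eqm_fX; apply: leq_trans lt _; rewrite leq_pmull.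
Qed.

Let fD_tm z s : fD (tm z s) = s%:R * tm z s.
Proof.
rewrite /tm fDM fDC mul0r add0r mulrCA; congr (_ * _).
by apply: fpsP => n; rewrite mulr_natl cfMn /=; case: eqP => [->|]; rewrite ?mulr1 ?mulr0 ?mul0rn.
Qed.

Let fgm z s := gm z s ^+ 2 + gm z s.
Let fD_gm z s : reg z s -> fD (gm z s) = s%:R * fgm z s.
Proof.
move=> rz; have h := gm_eq rz; have uz := unit_tm rz.
have := congr1 (@fD K) h; rewrite fDM (raddfB (@fD K)) /= fD1 fD_tm => h2.
apply: (mulrI uz); rewrite /fgm.
apply: (lincomb2 (c1 := 1) (c2 := - s%:R * (1 + gm z s)) h2 h); ring.
Qed.

Let eqm_D N f g : eqm N f g -> eqm N (@fD K f) (fD g).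
Proof. by move=> e n lt; rewrite !cf_fD e. Qed.
Let eqm_nat N k f g : eqm N (k.+1%:R * f : fps K) (k.+1%:R * g) -> eqm N f g.
Proof.
move=> e n /e; rewrite !mulr_natl !cfMn => /eqP.
by rewrite -subr_eq0 -mulrnBl mulrn_eq0 /= subr_eq0 => /eqP.
Qed.

Let lambert_coefs_D h h' c : lambert_coefs h c ->
  (forall s, (0 < s)%N -> fD (h s) = s%:R * h' s) ->
  lambert_coefs h' (fun s d => d%:R * c s d).
Proof.
move=> hc hD s N s0; have := eqm_D (hc s N s0); rewrite hD // raddf_sum /=.
case: s s0 => // s _ e; apply: (@eqm_nat _ s); apply: (eqm_trans _ e) => n lt.
rewrite mulr_sumr; congr (cf _ n); apply: eq_bigr => d _.
rewrite fDM fDC mul0r add0r rmorphM /= rmorph_nat.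
have -> : fD (X (s.+1 * d)) = (s.+1 * d)%:R * X (s.+1 * d).
  apply: fpsP => k; rewrite mulr_natl cfMn /=.
  by case: eqP => [->|]; rewrite ?mulr1 ?mulr0 ?mul0rn.
by rewrite natrM; ring.
Qed.

Lemma gm1_coefs z : lambert_coefs (fun s => gm z s ^+ 2 + gm z s) (fun _ d => d%:R * z ^+ d).
Proof.
by apply: (lambert_coefs_D (gm_coefs z)) => s s0; apply/fD_gm/reg_pos.
Qed.

(** Put f = g^2 + g and D = q d/dq. Then D g = s f, D f = s (2 g + 1) f and D((2 g + 1) f) = s (f +
    6 f^2), while D multiplies the coefficient at q^(s d) by s d. *)
Lemma gm3_coefs z : lambert_coefs
  (fun s => gm z s ^+ 2 + gm z s + 6 * (gm z s ^+ 2 + gm z s) ^+ 2)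
  (fun _ d => d%:R ^+ 3 * z ^+ d).
Proof.
have h2 : lambert_coefs (fun s => (2 * gm z s + 1) * fgm z s) (fun _ d => d%:R * (d%:R * z ^+ d)).
  apply: (lambert_coefs_D (@gm1_coefs z)) => s s0.
  rewrite raddfD /= expr2 fDM !fD_gm ?reg_pos // /fgm; ring.
have h3 : lambert_coefs (fun s => fgm z s + 6 * fgm z s ^+ 2)
    (fun _ d => d%:R * (d%:R * (d%:R * z ^+ d))).
  apply: (lambert_coefs_D h2) => s s0.
  have e2 : fD 2 = 0 :> fps K by rewrite -(rmorph_nat (@fC K)) fDC.
  have ef : fD (fgm z s) = s%:R * ((2 * gm z s + 1) * fgm z s).
    by rewrite raddfD /= expr2 fDM !fD_gm ?reg_pos // /fgm; ring.
  by rewrite fDM raddfD /= fD1 fDM e2 ef fD_gm ?reg_pos // /fgm; ring.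
move=> s N s0; apply: (eqm_trans _ (h3 s N s0)) => n lt; congr (cf _ n).
by apply: eq_bigr => d _; congr (fC _ * _); ring.
Qed.

Lemma fsum_progression h c a b : (a < b)%N -> lambert_coefs h c ->
  (forall s, eqm s (h s) 0) ->
  fsum (fun j => h (a + b * j)%N) =
  (a == 0%N)%:R * h 0%N + LL (fun m d => (m %% b == a)%N%:R * c m d).
Proof.
move=> ab hc h0; have b0 : (0 < b)%N by apply: leq_trans ab.
apply: eqmP => N; case: N => [|N] //.
have sm : small (fun j => h (a + b * j)%N).
  by move=> j; apply: (@eqm_le _ _ (a + b * j)); [nia|apply: h0].
apply: (eqm_trans _ (eqm_fsum sm (leqnn N.+1))).
have le : (N.+1 <= b * N.+1)%N by rewrite leq_pmull.
apply: eqm_sym; apply: (eqm_trans _ (eqmD (@eqm_refl _ _ _) (eqm_LL _ le (leqnn N.+1)))).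
move=> n lt; rewrite -(@sum_reindex_image _ (fun j => a + b * j)%N
    (fun m => m %% b == a)%N h N.+1 (b * N.+1)); first last.
- move=> m lm /eqP mE; exists (m %/ b)%N; last by rewrite {1}(divn_eq m b) mE addnC mulnC.
  by rewrite ltn_divLR // mulnC.
- by move=> j lj; rewrite addnC mulnC modnMDl modn_small // eqxx andbT; nia.
- by move=> x y /addnI /eqP; rewrite eqn_pmul2l // => /eqP.
rewrite [X in _ = cf X _]big_ltn_cond ?muln_gt0 ?b0 // mod0n.
have -> (V : fps K) : (if 0%N == a then h 0%N + V else V) = (a == 0%N)%:R * h 0%N + V.
  by rewrite eq_sym; case: eqP; rewrite ?mul1r ?mul0r ?add0r.
move: n lt; apply: eqmD => //.
rewrite [X in eqm _ _ X]big_mkcond; move=> n lt; rewrite !cf_sum.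
apply: eq_big_nat => m /andP[m0 _]; case: ifP => _; last first.
  by rewrite cf_sum cf0 big1 // => d _; rewrite mul0r rmorph0 mul0r.
rewrite (hc m N.+1 m0 n lt); congr (cf _ n).
by apply: eq_bigr => d _; rewrite mul1r.
Qed.

Lemma fsum_progression_neg h c a b : (a < b)%N -> lambert_coefs h c ->
  (forall s, eqm s (h s) 0) ->
  fsum (fun j => h (b * j.+1 - a)%N) = LL (fun m d => ((m + a) %% b == 0)%N%:R * c m d).
Proof.
move=> ab hc h0; have b0 : (0 < b)%N by apply: leq_trans ab.
apply: eqmP => N; case: N => [|N] //.
have sm : small (fun j => h (b * j.+1 - a)%N).
  by move=> j; apply: (@eqm_le _ _ (b * j.+1 - a)); [nia|apply: h0].
apply: (eqm_trans _ (eqm_fsum sm (leqnn N.+1))).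
have le : (N.+1 <= (b * N.+1).+1)%N by rewrite leqW // leq_pmull.
apply: eqm_sym; apply: (eqm_trans _ (eqm_LL _ le (leqnn N.+1))).
move=> n lt; transitivity (cf (\sum_(0 <= m < (b * N.+1).+1 | (0 < m)%N && ((m + a) %% b == 0)%N) h m) n).
  have -> : \sum_(0 <= m < (b * N.+1).+1 | (0 < m)%N && ((m + a) %% b == 0)%N) h m =
      \sum_(1 <= m < (b * N.+1).+1) (if ((m + a) %% b == 0)%N then h m else 0).
    by rewrite big_mkcond big_ltn //= add0r; apply: eq_big_nat => m /andP[-> _].
  rewrite !cf_sum; apply: eq_big_nat => m /andP[m0 _]; case: ifP => _; last first.
    by rewrite cf_sum cf0 big1 // => d _; rewrite mul0r rmorph0 mul0r.
  rewrite (hc m N.+1 m0 n lt); congr (cf _ n).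
  by apply: eq_bigr => d _; rewrite mul1r.
have [N' le' ->] : exists2 N', (N.+1 <= N')%N &
    \sum_(0 <= m < (b * N.+1).+1 | (0 < m)%N && ((m + a) %% b == 0)%N) h m =
    \sum_(0 <= j < N') h (b * j.+1 - a)%N.
  exists ((b * N.+1 + a) %/ b)%N; first by rewrite mulnC divnMDl // leq_addr.
  apply: sum_reindex_image => [x y|j lj|m lm /andP[m0 dm]].
  - by move=> e; nia.
  - rewrite subnK; last by nia.
    by rewrite modnMr eqxx andbT; move: lj; rewrite leq_divRL //; nia.
  - move: dm => /dvdnP[i di]; exists i.-1; last by case: i di => [|i] /= di; lia.
    by rewrite prednK; [rewrite leq_divRL //; lia|case: i di => //; lia].
by apply/esym; rewrite -(eqm_fsum sm (leqnn N.+1) lt) (eqm_fsum sm le' lt).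
Qed.

End Geometric.

Arguments tm {K} z s%_nat_scope.
Arguments gm {K} z s%_nat_scope.
Arguments reg {K} z s%_nat_scope.

(** * Square and quartic relations for two-sided Lambert sums *)

Section LambertIdentities.
Variable K : numFieldType.
Local Notation X := (fX K).

Definition sigma_series : fps K := LL (fun _ d => d%:R).
Local Notation S := sigma_series.

Variables (z : K) (a b : nat).

(* With t_k = z q^(a + b k), k in Z, these are the regularized sums of
   e = 1/(1 - t), of f = e^2 - e, of f + 6 f^2 and of b k e. *)
Definition lamE : fps K := (a == 0%N)%:R * gm z 0 +
  LL (fun m d => (m %% b == a)%N%:R * z ^+ d - ((m + a) %% b == 0)%N%:R * z^-1 ^+ d).
Definition lamF : fps K := (a == 0%N)%:R * (gm z 0 ^+ 2 + gm z 0) +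
  LL (fun m d => d%:R * ((m %% b == a)%N%:R * z ^+ d + ((m + a) %% b == 0)%N%:R * z^-1 ^+ d)).
Definition lamR : fps K :=
  (a == 0%N)%:R * (gm z 0 ^+ 2 + gm z 0 + 6 * (gm z 0 ^+ 2 + gm z 0) ^+ 2) +
  LL (fun m d => d%:R ^+ 3 * ((m %% b == a)%N%:R * z ^+ d + ((m + a) %% b == 0)%N%:R * z^-1 ^+ d)).
Definition lamU : fps K :=
  LL (fun m d => m%:R * ((m %% b == a)%N%:R * z ^+ d + ((m + a) %% b == 0)%N%:R * z^-1 ^+ d)).

Hypotheses (z0 : z != 0) (ab : (a < b)%N) (rz : reg z a).
Let b0 : (0 < b)%N. Proof. exact: leq_trans ab. Qed.
Let P j := gm z (a + b * j)%N.
Let N j := - gm z^-1 (b * j.+1 - a)%N.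
Let kap k : fps K := gm 1 (b * k)%N.
Let e n i := if (i < n)%N then N (n - i.+1)%N else 1 + P (i - n)%N.

Let fC1 : fC 1 = 1 :> fps K. Proof. exact: rmorph1. Qed.
Let sP : small P. Proof. by move=> j; apply: (@eqm_le _ _ (a + b * j)); [nia|apply: eqm_gm]. Qed.
Let sgN : small (fun j => gm z^-1 (b * j.+1 - a)%N).
Proof. by move=> j; apply: (@eqm_le _ _ (b * j.+1 - a)); [nia|apply: eqm_gm]. Qed.
Let sN : small N. Proof. exact: smallN. Qed.
Let sk : small kap. Proof. by move=> j; apply: (@eqm_le _ _ (b * j)); [nia|apply: eqm_gm]. Qed.
(** 1 - t vanishes at t = 1 and the inverse of 0 is 0 by convention, so the term k = 0 drops out of
    the sums over all k. *)
Let kap0 : kap 0 = 0.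
Proof. by rewrite /kap muln0 /gm /tm fC1 fX0 mul1r subrr invr0 mulr0. Qed.
Let regP j : reg z (a + b * j).
Proof. by case: j => [|j]; [rewrite muln0 addn0|apply: reg_pos; nia]. Qed.

(** t_k has a negative exponent for k < 0, so e_k is written al / (al - be) with t_k = be / al and
    both series without negative powers. In this form [hc] says t_j = c t_i with c = q^(b (j -
    i)). *)
Let pairs n i j : (i < j)%N -> (j < n + n)%N ->
  e n i * e n j = e n i + kap (j - i)%N * (e n i - e n j).
Proof.
move=> lij lj.
pose al i := if (i < n)%N then tm z^-1 (b * (n - i) - a) else 1.
pose be i := if (i < n)%N then 1 else tm z (a + b * (i - n)).
have ue k : al k - be k != 0 /\ (al k - be k) * e n k = al k.
  rewrite /al /be /e; case: ltnP => lk.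
    have r1 : reg z^-1 (b * (n - k) - a) by apply: reg_pos; nia.
    have h := gm_eq r1; have u := unit_tm r1; split.
      by rewrite -opprB oppr_eq0; apply: contraTneq u => ->; rewrite unitr0.
    by rewrite /N subnSK //; apply: (lincomb1 (c1 := 1) h); ring.
  have h := gm_eq (regP (k - n)); have u := unit_tm (regP (k - n)); split.
    by apply: contraTneq u => ->; rewrite unitr0.
  by apply: (lincomb1 (c1 := 1) h); rewrite /P; ring.
have [ui hi] := ue i; have [uj hj] := ue j.
pose c := X (b * (j - i))%N.
have r1 : reg (1 : K) (b * (j - i)) by apply: reg_pos; nia.
have hk := gm_eq r1; have uk := unit_tm r1; rewrite /tm fC1 mul1r -/c -/(kap _) in hk uk.
have hc : be j * al i = c * be i * al j.
  rewrite /al /be /c; case: (ltnP i n) => li; case: (ltnP j n) => lj'; rewrite ?mul1r ?mulr1.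
  - by rewrite /tm mulrCA -fXD; congr (_ * X _); nia.
  - rewrite /tm mulrACA -rmorphM mulfV // rmorph1 mul1r -fXD; congr (X _); nia.
  - by exfalso; lia.
  - by rewrite /tm mulrCA -fXD; congr (_ * X _); nia.
have c0 : 1 - c != 0 by apply: contraTneq uk => ->; rewrite unitr0.
apply: (mulfI (mulf_neq0 c0 (mulf_neq0 ui uj))).
move: (e n i) (e n j) (kap (j - i)%N) hi hj hk hc => x y k hi hj hk hc.
apply: (lincomb4
  (c1 := (1 - c) * (al j - be j) * y - (al j - be j))
  (c2 := (1 - c) * al i + c * (al i - be i))
  (c3 := - (x - y) * (al i - be i) * (al j - be j))
  (c4 := 1) hi hj hk hc).
ring.
Qed.

Let fN (f : nat -> fps K) : small f -> fsum (fun j => - f j) = - fsum f.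
Proof.
move=> sf; rewrite -mulN1r -fsumZ //; congr fsum; apply/funext => j; by rewrite mulN1r.
Qed.
Let eq_fsum (f g : nat -> fps K) : f =1 g -> fsum f = fsum g.
Proof. by move=> /funext ->. Qed.
Let gm_small (z' : K) s : eqm s (gm z' s ^+ 2 + gm z' s) 0.
Proof. by rewrite expr2 -[X in _ + X]mul1r -mulrDl mulrC; apply: eqm0_mulr; apply: eqm_gm. Qed.

Let fsumP : fsum P = (a == 0%N)%:R * gm z 0 + LL (fun m d => (m %% b == a)%N%:R * z ^+ d).
Proof. exact: (fsum_progression ab (@gm_coefs K z) (eqm_gm z)). Qed.
Let fsumgN : fsum (fun j => gm z^-1 (b * j.+1 - a)%N) =
  LL (fun m d => ((m + a) %% b == 0)%N%:R * z^-1 ^+ d).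
Proof. exact: (fsum_progression_neg ab (@gm_coefs K z^-1) (eqm_gm z^-1)). Qed.
Let fsumN : fsum N = - fsum (fun j => gm z^-1 (b * j.+1 - a)%N).
Proof. exact: fN. Qed.

Let lamE_fsum : fsum P + fsum N = lamE.
Proof. by rewrite fsumN fsumP fsumgN /lamE LLB addrA. Qed.

Let F := fsum (fun j => P j ^+ 2 + P j) + fsum (fun j => N j ^+ 2 - N j).
Let lamF_fsum : F = lamF.
Proof.
rewrite /F (fsum_progression ab (@gm1_coefs K z) (gm_small z)).
rewrite (@eq_fsum (fun j => N j ^+ 2 - N j) (fun j => gm z^-1 (b * j.+1 - a) ^+ 2 + gm z^-1 (b * j.+1 - a))); last first.
  by move=> j; rewrite /N; ring.
rewrite (fsum_progression_neg ab (@gm1_coefs K z^-1) (gm_small z^-1)).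
rewrite -addrA -LLD; congr (_ + _); apply: eq_LL => m d _ _; ring.
Qed.

Let gm_small3 (z' : K) s : eqm s (gm z' s ^+ 2 + gm z' s + 6 * (gm z' s ^+ 2 + gm z' s) ^+ 2) 0.
Proof.
rewrite (_ : _ + _ = (gm z' s ^+ 2 + gm z' s) * (1 + 6 * (gm z' s ^+ 2 + gm z' s))); last by ring.
by apply: eqm0_mulr; apply: gm_small.
Qed.

Let lamR_fsum : F + 6 * (fsum (fun j => (P j ^+ 2 + P j) ^+ 2) + fsum (fun j => (N j ^+ 2 - N j) ^+ 2)) = lamR.
Proof.
pose f j := P j ^+ 2 + P j; pose g j := N j ^+ 2 - N j.
have sf : small f by apply: smallD => //; apply: (smallM P).
have sg : small g by apply: smallD; [apply: (smallM N)|apply: smallN].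
have sf2 : small (fun j => f j ^+ 2) by move=> j; rewrite expr2; apply: eqm0_mulr; apply: sf.
have sg2 : small (fun j => g j ^+ 2) by move=> j; rewrite expr2; apply: eqm0_mulr; apply: sg.
have sf6 : small (fun j => 6 * f j ^+ 2) by apply: (smallM (fun=> 6)).
have sg6 : small (fun j => 6 * g j ^+ 2) by apply: (smallM (fun=> 6)).
rewrite /F mulrDr addrACA -(fsumZ _ sf2) -(fsumZ _ sg2) -(fsumD sf sf6) -(fsumD sg sg6).
rewrite (fsum_progression ab (@gm3_coefs K z) (gm_small3 z)).
rewrite (@eq_fsum (fun j => g j + 6 * g j ^+ 2) (fun j => gm z^-1 (b * j.+1 - a) ^+ 2 +
   gm z^-1 (b * j.+1 - a) + 6 * (gm z^-1 (b * j.+1 - a) ^+ 2 + gm z^-1 (b * j.+1 - a)) ^+ 2)); last first.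
  by move=> j; rewrite /g /N; ring.
rewrite (fsum_progression_neg ab (@gm3_coefs K z^-1) (gm_small3 z^-1)).
rewrite -addrA -LLD; congr (_ + _); apply: eq_LL => m d _ _; ring.
Qed.

Let gms_coefs (z' : K) : lambert_coefs (fun s => s%:R * gm z' s) (fun s d => s%:R * z' ^+ d).
Proof.
move=> s M s0; apply: (eqm_trans (s%:R * \sum_(1 <= d < M) fC (z' ^+ d) * X (s * d))).
  by apply: eqmM => //; apply: gm_coefs.
rewrite mulr_sumr => n _; congr (cf _ n); apply: eq_bigr => d _.
by rewrite rmorphM /= rmorph_nat mulrA.
Qed.
Let gms_small (z' : K) s : eqm s (s%:R * gm z' s) 0.
Proof. by rewrite mulrC; apply: eqm0_mulr; apply: eqm_gm. Qed.

Let T := fsum (fun j => j%:R * P j) - fsum (fun j => j.+1%:R * N j).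
(** t_k has exponent a + b k, so b k e_k is the difference of (a + b k) e_k, summed in U, and a e_k.
    This is the origin of the term -2 a/b in the square relation. *)
Let lamT : b%:R * T = lamU - a%:R * lamE.
Proof.
have sjP : small (fun j => j%:R * P j) by apply: smallM.
have sjN : small (fun j => j.+1%:R * N j) by apply: (smallM (fun j => j.+1%:R)).
rewrite /T mulrBr -!fsumZ //.
have -> : fsum (fun j => b%:R * (j%:R * P j)) =
    fsum (fun j => (a + b * j)%:R * P j) - a%:R * fsum P.
  have s1 : small (fun j => (a + b * j)%:R * P j) by apply: (smallM (fun j => (a + b * j)%:R)).
  have s2 : small (fun j => a%:R * P j) by apply: (smallM (fun=> a%:R)).
  rewrite -fsumZ // -fN // -fsumD //; last exact: smallN.
  by apply: eq_fsum => j; rewrite natrD natrM; ring.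
have -> : fsum (fun j => b%:R * (j.+1%:R * N j)) =
    a%:R * fsum N - fsum (fun j => (b * j.+1 - a)%:R * gm z^-1 (b * j.+1 - a)).
  have s1 : small (fun j => (b * j.+1 - a)%:R * gm z^-1 (b * j.+1 - a)).
    by apply: (smallM (fun j => (b * j.+1 - a)%:R)).
  have s2 : small (fun j => a%:R * N j) by apply: (smallM (fun=> a%:R)).
  rewrite -fsumZ // -fN // -fsumD //; last exact: smallN.
  apply: eq_fsum => j; rewrite /N natrB ?natrM; last by nia.
  by ring.
rewrite (fsum_progression ab (@gms_coefs z) (gms_small z)) mul0r mulr0 add0r.
rewrite (fsum_progression_neg ab (@gms_coefs z^-1) (gms_small z^-1)).
rewrite -lamE_fsum /lamU.
rewrite (@eq_LL _ (fun m d => m%:R * _) (fun m d => (m %% b == a)%N%:R * (m%:R * z ^+ d) +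
  ((m + a) %% b == 0)%N%:R * (m%:R * z^-1 ^+ d))); last by move=> m d _ _; ring.
by rewrite LLD; ring.
Qed.

Let fsub_S : b%:R * fsub b S = LL (fun m d => (b %| m)%N%:R * m%:R).
Proof.
rewrite fsub_LL // -LLMn [RHS]LL_swap; apply: eq_LL => m d _ _.
by case: (boolP (b %| d)%N) => [/dvdnP[i ->]|]; rewrite ?mul0r ?mulr0 // !mul1r mulnK // -natrM mulnC.
Qed.
Let fsub_S2 : fsub b S = LL (fun m d => (b %| m)%N%:R * d%:R).
Proof. by rewrite /S LL_swap fsub_LL // LL_swap. Qed.

Let kap_progression (h : nat -> fps K) c : lambert_coefs h c -> (forall s, eqm s (h s) 0) -> h 0%N = 0 ->
  fsum (fun k => h (b * k)%N) = LL (fun m d => (b %| m)%N%:R * c m d).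
Proof.
move=> hc h0 h00; have := fsum_progression b0 hc h0; rewrite h00 mulr0 add0r => <-.
by apply: eq_fsum => k; rewrite add0n.
Qed.

Let gm10 : gm (1 : K) 0 = 0. Proof. by have := kap0; rewrite /kap muln0. Qed.

Let fsum_kap1 : fsum (fun k => k%:R * kap k) = fsub b S.
Proof.
have nzb : b%:R != 0 :> fps K by case: b b0 => // n _; apply: fps_natr_neq0.
apply: (mulfI nzb); rewrite fsub_S -fsumZ; last by apply: (smallM (fun k => k%:R)).
have h : (0%:R * gm (1 : K) 0 : fps K) = 0 by rewrite mul0r.
rewrite -(@eq_LL _ (fun m d => (b %| m)%N%:R * (m%:R * 1 ^+ d))); last first.
  by move=> m d _ _; rewrite expr1n mulr1.
rewrite -(kap_progression (@gms_coefs 1) (gms_small 1) h).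
by apply: eq_fsum => k; rewrite natrM mulrA.
Qed.

Let fsum_kap2 : fsum (fun k => kap k ^+ 2 + kap k) = fsub b S.
Proof.
have h : (gm (1 : K) 0 ^+ 2 + gm 1 0 : fps K) = 0 by rewrite gm10 expr0n add0r.
rewrite fsub_S2 -(@eq_LL _ (fun m d => (b %| m)%N%:R * (d%:R * 1 ^+ d))); last first.
  by move=> m d _ _; rewrite expr1n mulr1.
by rewrite -(kap_progression (@gm1_coefs K 1) (gm_small 1) h).
Qed.

Lemma lambert_square :
  b%:R * lamE ^+ 2 + (b%:R - 2 * a%:R) * lamE =
  b%:R * lamF - 2 * lamU - 2 * b%:R * fsub b S.
Proof.
have h := window_square sP sN sk pairs.
rewrite lamE_fsum -/F -/T lamF_fsum fsum_kap1 in h.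
apply: (lincomb2 (c1 := b%:R) (c2 := -2) h lamT); ring.
Qed.

Lemma lambert_quartic :
  lamR = lamF + 6 * lamF ^+ 2 - 24 * fsub b S * lamF -
    12 * fsum (fun k => k%:R * ((kap k ^+ 2 + kap k) * (1 + 2 * kap k))).
Proof.
have := window_quartic sP sN sk pairs kap0.
by rewrite -/F lamR_fsum lamF_fsum fsum_kap2.
Qed.

End LambertIdentities.

(** The sum over k in [lambert_quartic] depends on b only and cancels; what remains is divisible by
    F_1 - F_2. *)
Lemma lambert_quartic_diff (K : numFieldType) (z z' : K) a a' b :
  z != 0 -> (a < b)%N -> reg z a -> z' != 0 -> (a' < b)%N -> reg z' a' ->
  lamR z a b - lamR z' a' b = (lamF z a b - lamF z' a' b) *
    (6 * (lamF z a b + lamF z' a' b) + 1 - 24 * fsub b (sigma_series K)).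
Proof.
move=> z0 ab rz z0' ab' rz'.
have h := lambert_quartic z0 ab rz; have h' := lambert_quartic z0' ab' rz'.
apply: (lincomb2 (c1 := 1) (c2 := -1) h h'); ring.
Qed.

(** * Characters modulo 12 and powers of a twelfth root of unity *)

Section Characters.
Variable K : numFieldType.

Definition c12 n : K := (chi12 n)%:~R.
Definition c3 n : K := (chim3 n)%:~R.
Definition c4 n : K := (chim4 n)%:~R.
Definition dv k n : K := (k %| n)%N%:R.

Lemma c12_mod n : c12 n = c12 (n %% 12).
Proof. by rewrite /c12 /chi12 modn_mod. Qed.
Lemma c3_mod n : c3 n = c3 (n %% 12).
Proof. by rewrite /c3 /chim3 modn_dvdm. Qed.
Lemma c4_mod n : c4 n = c4 (n %% 12).
Proof. by rewrite /c4 /chim4 modn_dvdm. Qed.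
Lemma dv_mod k n : (k %| 12)%N -> dv k n = dv k (n %% 12).
Proof. by move=> k12; rewrite /dv {1}(divn_eq n 12) dvdn_addr // dvdn_mull. Qed.

Ltac mod12 n := move: (n %% 12)%N (ltn_pmod n (isT : (0 < 12)%N)) =>
  [_|[_|[_|[_|[_|[_|[_|[_|[_|[_|[_|[_|//]]]]]]]]]]]];
  rewrite /c12 /c3 /c4 /dv /chi12 /chim3 /chim4 /=.

Lemma c4_3 n : c4 (3 * n) = - c4 n.
Proof.
rewrite (c4_mod n) (c4_mod (3 * n)) -modnMmr; mod12 n; rewrite ?rmorphN ?rmorph1 ?rmorph0 ?opprK ?oppr0 //.
Qed.
Lemma c3_2 n : c3 (2 * n) = - c3 n.
Proof.
rewrite (c3_mod n) (c3_mod (2 * n)) -modnMmr; mod12 n; rewrite ?rmorphN ?rmorph1 ?rmorph0 ?opprK ?oppr0 //.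
Qed.

Section TwelfthRoot.
Variable z : K.
(** z is a root of the cyclotomic polynomial x^4 - x^2 + 1, that is, a primitive twelfth root of
    unity. *)
Hypothesis z4 : z ^+ 4 = z ^+ 2 - 1.

(** For z = exp(pi i / 6), this and the next three definitions are sqrt 3, i, exp(2 pi i / 3) and
    sqrt(-3); here z - z^3 is the inverse of z. *)
Definition rt3 := z + (z - z ^+ 3).
Definition im := z ^+ 3.
Definition om := z ^+ 4.
Definition rtm3 := 2 * z ^+ 2 - 1.

Lemma root12 : z ^+ 12 = 1.
Proof. ring: z4. Qed.
Lemma root_neq0 : z != 0.
Proof.
apply/eqP => h; have := root12; rewrite h expr0n /= => /eqP.
by rewrite eq_sym oner_eq0.
Qed.
Lemma rootV : z^-1 = z - z ^+ 3.
Proof.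
apply: (mulfI root_neq0); rewrite mulfV ?root_neq0 //; ring: z4.
Qed.
Lemma rt3_sqr : rt3 ^+ 2 = 3. Proof. rewrite /rt3; ring: z4. Qed.
Lemma im_sqr : im ^+ 2 = -1. Proof. rewrite /im; ring: z4. Qed.
Lemma rtm3_sqr : rtm3 ^+ 2 = -3. Proof. rewrite /rtm3; ring: z4. Qed.
Lemma imV : im^-1 = - im.
Proof.
have i0 : im != 0 by rewrite expf_neq0 // root_neq0.
apply: (mulfI i0); rewrite mulfV // mulrN -expr2 im_sqr opprK //.
Qed.
Lemma omV : om^-1 = - z ^+ 2.
Proof.
have o0 : om != 0 by rewrite expf_neq0 // root_neq0.
apply: (mulfI o0); rewrite mulfV // /om; ring: z4.
Qed.

Let zmod (x : K) d : x ^+ 12 = 1 -> x ^+ d = x ^+ (d %% 12).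
Proof. by move=> h; rewrite expr_mod. Qed.

(** A finite Fourier expansion, checked on twelve residues. Such expansions turn Lambert series at
    roots of unity into series with characters and dilated divisor sums. *)
Lemma root_powB d : z ^+ d - z^-1 ^+ d =
  im * (c4 d - 3 * (dv 3 d * c4 d) + rt3 * (2 * (dv 4 d * c3 d) - dv 2 d * c3 d)).
Proof.
have zi12 : z^-1 ^+ 12 = 1 by rewrite exprVn root12 invr1.
rewrite (zmod d root12) (zmod d zi12) (c4_mod d) (c3_mod d).
rewrite (@dv_mod 3 d) // (@dv_mod 2 d) // (@dv_mod 4 d) // rootV /im /rt3.
mod12 d; ring: z4.
Qed.
Lemma root_powD d : z ^+ d + z^-1 ^+ d =
  dv 2 d - 2 * dv 4 d - 3 * dv 6 d + 6 * dv 12 d + rt3 * c12 d.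
Proof.
have zi12 : z^-1 ^+ 12 = 1 by rewrite exprVn root12 invr1.
rewrite (zmod d root12) (zmod d zi12) (c12_mod d).
rewrite (@dv_mod 2 d) // (@dv_mod 4 d) // (@dv_mod 6 d) // (@dv_mod 12 d) // rootV /rt3.
mod12 d; ring: z4.
Qed.
Lemma im_powB d : im ^+ d - im^-1 ^+ d = 2 * im * c4 d.
Proof.
have i12 : im ^+ 12 = 1 by rewrite /im -exprM mulnC exprM root12 expr1n.
have ii12 : im^-1 ^+ 12 = 1 by rewrite exprVn i12 invr1.
rewrite (zmod d i12) (zmod d ii12) (c4_mod d) imV.
mod12 d; ring: im_sqr.
Qed.
Lemma im_powD d : im ^+ d + im^-1 ^+ d = 4 * dv 4 d - 2 * dv 2 d.
Proof.
have i12 : im ^+ 12 = 1 by rewrite /im -exprM mulnC exprM root12 expr1n.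
have ii12 : im^-1 ^+ 12 = 1 by rewrite exprVn i12 invr1.
rewrite (zmod d i12) (zmod d ii12) (@dv_mod 2 d) // (@dv_mod 4 d) // imV.
mod12 d; ring: im_sqr.
Qed.
Lemma om_powB d : om ^+ d - om^-1 ^+ d = rtm3 * c3 d.
Proof.
have i12 : om ^+ 12 = 1 by rewrite /om -exprM mulnC exprM root12 expr1n.
have ii12 : om^-1 ^+ 12 = 1 by rewrite exprVn i12 invr1.
rewrite (zmod d i12) (zmod d ii12) (c3_mod d) omV /om /rtm3.
mod12 d; ring: z4.
Qed.
Lemma om_powD d : om ^+ d + om^-1 ^+ d = 3 * dv 3 d - 1.
Proof.
have i12 : om ^+ 12 = 1 by rewrite /om -exprM mulnC exprM root12 expr1n.
have ii12 : om^-1 ^+ 12 = 1 by rewrite exprVn i12 invr1.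
rewrite (zmod d i12) (zmod d ii12) (@dv_mod 3 d) // omV /om.
mod12 d; ring: z4.
Qed.

(** z^5 is the conjugate of z that fixes i = z^3 and changes the sign of sqrt 3, so comparing z with
    z^5 isolates the coefficient of sqrt 3. *)
Lemma root5_minpoly : (z ^+ 5) ^+ 4 = (z ^+ 5) ^+ 2 - 1.
Proof. ring: z4. Qed.

End TwelfthRoot.
End Characters.

(** * Relations in weights 1, 2 and 4 at roots of unity *)

Section LambertRelations.
Variable K : numFieldType.
Local Notation S := (sigma_series K).
Local Notation c12 := (c12 K).
Local Notation c3 := (c3 K).
Local Notation c4 := (c4 K).
Local Notation dv := (dv K).

Definition lam_char (chi : nat -> K) := LL (fun _ d => chi d).
(** E_{k+1,chi,psi} up to its constant term: d is the divisor that carries psi, m the complementary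
    one. *)
Definition eisL (chi psi : nat -> K) k := LL (fun m d => chi m * psi d * d%:R ^+ k).
Definition one_ (n : nat) : K := 1.
Local Notation L3 := (lam_char c3).
Local Notation L4 := (lam_char c4).
Local Notation W1 := (eisL one_ c12 1).
Local Notation W2 := (eisL c12 one_ 1).
Local Notation W3 := (eisL c4 c3 1).
Local Notation W4 := (eisL c3 c4 1).
Local Notation H1 := (eisL one_ c12 3).
Local Notation H2 := (eisL c12 one_ 3).
Local Notation H3 := (eisL c4 c3 3).
Local Notation H4 := (eisL c3 c4 3).

Lemma LL_dvm j f : (0 < j)%N ->
  LL (fun m d => dv j m * f d) = fsub j (LL (fun _ d => f d)).
Proof. by move=> j0; rewrite [in RHS]LL_swap fsub_LL // LL_swap. Qed.

Lemma LL_dv_id k : (0 < k)%N -> LL (fun _ d => dv k d * d%:R) = k%:R * fsub k S.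
Proof.
move=> k0; rewrite /sigma_series fsub_LL // -LLMn; apply: eq_LL => m d _ _.
rewrite /dv; case: (boolP (k %| d)%N) => [/dvdnP[i ->]|]; last by rewrite !mul0r mulr0.
by rewrite !mul1r mulnK // mulnC natrM.
Qed.

Let fsub_nat j k : (0 < j)%N -> fsub j (k%:R : fps K) = k%:R.
Proof. by case: j => // j _; rewrite rmorph_nat. Qed.

Lemma LL_dvm_dv_id j k : (0 < j)%N -> (0 < k)%N ->
  LL (fun m d => dv j m * (dv k d * d%:R)) = k%:R * fsub (j * k) S.
Proof.
by move=> j0 k0; rewrite LL_dvm // LL_dv_id // fsubM // fsub_nat // fsub_fsub.
Qed.

Lemma LL_m_dv k : (0 < k)%N -> LL (fun m d => dv k d * m%:R) = fsub k S.
Proof. by move=> k0; rewrite LL_swap LL_dvm. Qed.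

Lemma LL_d : LL (fun _ d => d%:R) = S. Proof. by []. Qed.
Lemma LL_m : LL (fun m _ => m%:R) = S. Proof. by rewrite LL_swap. Qed.

Lemma LL_dv_char j (chi : nat -> K) (e : K) : (0 < j)%N ->
  (forall n, chi (j * n)%N = e * chi n) ->
  LL (fun _ d => dv j d * chi d) = fC e * fsub j (lam_char chi).
Proof.
move=> j0 h; rewrite /lam_char fsub_LL // -LLZ; apply: eq_LL => m d _ _.
rewrite /dv; case: (boolP (j %| d)%N) => [/dvdnP[i ->]|]; last by rewrite !mul0r mulr0.
by rewrite !mul1r mulnK // mulnC h.
Qed.

Let L4_dv3 : LL (fun _ d => dv 3 d * c4 d) = - fsub 3 L4.
Proof. by rewrite (@LL_dv_char 3 _ (-1)) ?rmorphN ?rmorph1 ?mulN1r // => n; rewrite c4_3 mulN1r. Qed.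
Let L3_dv2 : LL (fun _ d => dv 2 d * c3 d) = - fsub 2 L3.
Proof. by rewrite (@LL_dv_char 2 _ (-1)) ?rmorphN ?rmorph1 ?mulN1r // => n; rewrite c3_2 mulN1r. Qed.
Let L3_dv4 : LL (fun _ d => dv 4 d * c3 d) = fsub 4 L3.
Proof.
rewrite (@LL_dv_char 4 _ 1) ?rmorph1 ?mul1r // => n.
by rewrite (_ : 4 * n = 2 * (2 * n))%N; [rewrite !c3_2 opprK mul1r|rewrite mulnA].
Qed.

Let mod3B m : (m %% 3 == 1)%N%:R - ((m + 1) %% 3 == 0)%N%:R = c3 m.
Proof.
rewrite /c3 /chim3 -modnDml; move: (m %% 3)%N (ltn_pmod m (isT : (0 < 3)%N)).
by case=> [|[|[|//]]] _; rewrite ?subr0 ?subrr ?sub0r ?rmorphN ?rmorph1 ?rmorph0.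
Qed.
Let mod3D m : (m %% 3 == 1)%N%:R + ((m + 1) %% 3 == 0)%N%:R = 1 - dv 3 m.
Proof.
rewrite /dv /dvdn -modnDml; move: (m %% 3)%N (ltn_pmod m (isT : (0 < 3)%N)).
by case=> [|[|[|//]]] _ /=; rewrite ?addr0 ?add0r ?subr0 ?subrr.
Qed.
Let mod4B m : (m %% 4 == 1)%N%:R - ((m + 1) %% 4 == 0)%N%:R = c4 m.
Proof.
rewrite /c4 /chim4 -modnDml; move: (m %% 4)%N (ltn_pmod m (isT : (0 < 4)%N)).
by case=> [|[|[|[|//]]]] _; rewrite ?subr0 ?subrr ?sub0r ?rmorphN ?rmorph1 ?rmorph0.
Qed.
Let mod4D m : (m %% 4 == 1)%N%:R + ((m + 1) %% 4 == 0)%N%:R = 1 - dv 2 m.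
Proof.
rewrite -modnDml (_ : dv 2 m = dv 2 (m %% 4)); last by rewrite /dv {1}(divn_eq m 4) dvdn_addr // dvdn_mull.
move: (m %% 4)%N (ltn_pmod m (isT : (0 < 4)%N)); rewrite /dv.
by case=> [|[|[|[|//]]]] _ /=; rewrite ?addr0 ?add0r ?subr0 ?subrr.
Qed.

Section RootPoint.
Variable z : K.
Hypothesis z4 : z ^+ 4 = z ^+ 2 - 1.
Local Notation I := (fC (im z)).
Local Notation t := (fC (rt3 z)).
Local Notation g := (gm z 0).

Let z1 : z != 1.
Proof.
apply/eqP => h; have /eqP := z4; rewrite h !expr1n subrr oner_eq0 //.
Qed.
Let rz0 : reg z 0. Proof. by rewrite /reg eqxx. Qed.
Let fz4 : fC z ^+ 4 = fC z ^+ 2 - 1.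
Proof. by rewrite -!rmorphXn z4 rmorphB rmorph1. Qed.
Let IE : I = fC z ^+ 3. Proof. by rewrite /im rmorphXn. Qed.
Let tE : t = 2 * fC z - fC z ^+ 3.
Proof. by rewrite /rt3 !rmorphD rmorphN rmorphXn /=; ring. Qed.

(** The value (1 + z)/(1 - z) = i cot(pi/12). *)
Let gE : 2 * g + 1 = I * (2 + t).
Proof.
have h := gm_eq rz0; have u := unit_tm rz0; rewrite /tm fX0 mulr1 in h u.
have n0 : 1 - fC z != 0 by apply: contraTneq u => ->; rewrite unitr0.
apply: (mulfI n0); rewrite IE tE.
transitivity (1 + fC z); first by apply: (lincomb1 (c1 := 2) h); ring.
ring: fz4.
Qed.

Definition sig2 := 2 * fsub 2 S - 8 * fsub 4 S - 18 * fsub 6 S + 72 * fsub 12 S.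
Let sigm := fsub 2 S - 2 * fsub 4 S - 3 * fsub 6 S + 6 * fsub 12 S.

Lemma lamE_root : lamE z 0 1 =
  g + I * (L4 + 3 * fsub 3 L4 + t * (fsub 2 L3 + 2 * fsub 4 L3)).
Proof.
rewrite /lamE mul1r; congr (_ + _).
rewrite (@eq_LL _ _ (fun _ d => im z * c4 d + (- 3 * im z) * (dv 3 d * c4 d) +
  (2 * im z * rt3 z) * (dv 4 d * c3 d) + (- (im z * rt3 z)) * (dv 2 d * c3 d))); last first.
  by move=> m d _ _; rewrite !modn1 !mul1r root_powB //; ring.
rewrite !LLD !LLZ L4_dv3 L3_dv2 L3_dv4 -/(lam_char c4); ring.
Qed.

Lemma lamF_root : lamF z 0 1 = g ^+ 2 + g + sig2 + t * W1.
Proof.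
rewrite /lamF mul1r -[RHS]addrA; congr (_ + _).
rewrite (@eq_LL _ _ (fun m d => dv 2 d * d%:R + (- 2%:R) * (dv 4 d * d%:R) +
  (- 3%:R) * (dv 6 d * d%:R) + 6%:R * (dv 12 d * d%:R) + rt3 z * (one_ m * c12 d * d%:R ^+ 1))); last first.
  by move=> m d _ _; rewrite !modn1 !mul1r root_powD // /one_; ring.
rewrite !LLD (LLZ (rt3 z)) -/(eisL one_ c12 1) !LLZ !LL_dv_id // /sig2; ring.
Qed.

Lemma lamU_root : lamU z 0 1 = sigm + t * W2.
Proof.
rewrite /lamU.
rewrite (@eq_LL _ _ (fun m d => dv 2 d * m%:R + (- 2%:R) * (dv 4 d * m%:R) +
  (- 3%:R) * (dv 6 d * m%:R) + 6%:R * (dv 12 d * m%:R) + rt3 z * (c12 d * one_ m * m%:R ^+ 1))); last first.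
  by move=> m d _ _; rewrite !modn1 !mul1r root_powD // /one_; ring.
rewrite !LLD (LLZ (rt3 z)) -(LL_swap (fun m d => c12 m * one_ d * d%:R ^+ 1)).
rewrite -/(eisL c12 one_ 1) !LLZ !LL_m_dv // /sigm; ring.
Qed.

Lemma lamR_root : lamR z 0 1 = g ^+ 2 + g + 6 * (g ^+ 2 + g) ^+ 2 +
  LL (fun _ d => d%:R ^+ 3 * (dv 2 d - 2 * dv 4 d - 3 * dv 6 d + 6 * dv 12 d)) + t * H1.
Proof.
rewrite /lamR mul1r -[RHS]addrA; congr (_ + _).
rewrite -LLZ -LLD; apply: eq_LL => m d _ _.
by rewrite !modn1 !mul1r root_powD // /one_; ring.
Qed.

Let I2 : I ^+ 2 = -1.
Proof. by rewrite -rmorphXn im_sqr // rmorphN rmorph1. Qed.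
Let t2 : t ^+ 2 = 3.
Proof. by rewrite -rmorphXn rt3_sqr // rmorph_nat. Qed.

Let gN : g ^+ 2 + g = - (2 + t).
Proof.
apply: (mulfI (fps_natr_neq0 K 3)).
apply: (lincomb3 (c1 := 2 * g + 1 + I * (2 + t)) (c2 := (2 + t) ^+ 2) (c3 := -1) gE I2 t2); ring.
Qed.

Let Xr := L4 + 3 * fsub 3 L4 + t * (fsub 2 L3 + 2 * fsub 4 L3).

(** With E = g + i X and 2 g + 1 = i (2 + sqrt 3), one has E^2 + E = g^2 + g - X^2 - (2 + sqrt 3) X:
    i drops out. *)
Lemma square_root : Xr ^+ 2 + (2 + t) * Xr = - (sig2 + t * W1) + 2 * (sigm + t * W2) + 2 * S.
Proof.
have h := lambert_square (root_neq0 z4) (isT : (0 < 1)%N) rz0.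
rewrite fsub1 lamE_root lamF_root lamU_root -/Xr in h.
apply: (lincomb3 (c1 := -1) (c2 := I * Xr) (c3 := Xr ^+ 2 + (2 + t) * Xr) h gE I2); ring.
Qed.

Lemma lamF_root' : lamF z 0 1 = - (2 + t) + sig2 + t * W1.
Proof. by rewrite lamF_root gN. Qed.
Lemma lamR_root' : lamR z 0 1 = - (2 + t) + 6 * (2 + t) ^+ 2 +
  LL (fun _ d => d%:R ^+ 3 * (dv 2 d - 2 * dv 4 d - 3 * dv 6 d + 6 * dv 12 d)) + t * H1.
Proof. by rewrite lamR_root gN sqrrN. Qed.
Lemma reg_root : reg z 0. Proof. exact: rz0. Qed.

End RootPoint.

Section Relations.
Variable z : K.
Hypothesis z4 : z ^+ 4 = z ^+ 2 - 1.
Local Notation t := (fC (rt3 z)).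
Let z5 := root5_minpoly z4.
Let rt5 : rt3 (z ^+ 5) = - rt3 z. Proof. rewrite /rt3; ring: z4. Qed.
Let t2 : t ^+ 2 = 3.
Proof. by rewrite -rmorphXn rt3_sqr // rmorph_nat. Qed.
Let nz n := fps_natr_neq0 K n.
Let fC_neq0 (c : K) : c != 0 -> fC c != 0.
Proof. by move=> c0; apply: ct_neq0; rewrite /ct cfC mul1r. Qed.
Let two_t : 2 * t != 0.
Proof.
rewrite mulf_neq0 ?nz //; apply/eqP => h; have := t2; rewrite h expr0n /= => /eqP.
by rewrite eq_sym (negbTE (nz 2)).
Qed.

(** The coefficient of sqrt 3 in [square_root], isolated by subtracting the relations at z and
    z^5. *)
Lemma rel1 : W1 - 1 - 2 * W2 =
  - ((1 + 2 * (fsub 2 L3 + 2 * fsub 4 L3)) * (1 + (L4 + 3 * fsub 3 L4))).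
Proof.
have h := square_root z4; have h' := square_root z5.
rewrite rt5 rmorphN in h'; apply: (mulfI two_t).
apply: (lincomb2 (c1 := 1) (c2 := -1) h h'); ring.
Qed.

(** The coefficient of sqrt 3 in [lambert_quartic_diff] at z and z^5. The constant 23 = 24 - 1 is
    that of t = sqrt 3 in - (2 + t) + 6 (2 + t)^2, and the -1 beside W1 that in - (2 + t). *)
Lemma H1_rel : 23 + H1 = (W1 - 1) * (-23 + 12 * sig2 - 24 * S).
Proof.
have h := lambert_quartic_diff (root_neq0 z4) (isT : (0 < 1)%N) (reg_root z4)
  (root_neq0 z5) (isT : (0 < 1)%N) (reg_root z5).
rewrite fsub1 !lamF_root' // !lamR_root' // rt5 rmorphN in h.
apply: (mulfI two_t); apply: (lincomb1 (c1 := 1) h); ring.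
Qed.

(** [lambert_square] at i, where (1 + i)/(1 - i) = i. The right side is the series of the
    four-square theorem. *)
Lemma L4_sqr : (1 + 4 * L4) ^+ 2 = 1 + 8 * S - 32 * fsub 4 S.
Proof.
pose i := im z; have i2 : i ^+ 2 = -1 := im_sqr z4.
have i0 : i != 0 by rewrite expf_neq0 // (root_neq0 z4).
have i1 : i != 1.
  apply/eqP => h; have /eqP := i2; rewrite h expr1n -subr_eq0 opprK -mulr2n.
  by rewrite pnatr_eq0.
have ri : reg i 0 by rewrite /reg eqxx.
have hg := gm_eq ri; rewrite /tm fX0 mulr1 in hg.
have I2 : fC i ^+ 2 = -1 by rewrite -rmorphXn i2 rmorphN rmorph1.
have gE : 2 * gm i 0 + 1 = fC i.
  by apply: (lincomb2 (c1 := 1 + fC i) (c2 := gm i 0 + 1) hg I2); ring.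
have hE : lamE i 0 1 = gm i 0 + fC i * (2 * L4).
  rewrite /lamE mul1r; congr (_ + _).
  rewrite (@eq_LL _ _ (fun _ d => (2 * i) * c4 d)).
    by rewrite LLZ -/(lam_char c4); ring.
  by move=> m d _ _; rewrite !modn1 !mul1r im_powB.
have hF : lamF i 0 1 = gm i 0 ^+ 2 + gm i 0 + (16 * fsub 4 S - 4 * fsub 2 S).
  rewrite /lamF mul1r; congr (_ + _).
  rewrite (@eq_LL _ _ (fun _ d => 4%:R * (dv 4 d * d%:R) + (- 2%:R) * (dv 2 d * d%:R))).
    by rewrite LLD !LLZ !LL_dv_id //; ring.
  by move=> m d _ _; rewrite !modn1 !mul1r im_powD //; ring.
have hU : lamU i 0 1 = 4 * fsub 4 S - 2 * fsub 2 S.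
  rewrite /lamU (@eq_LL _ _ (fun m d => 4%:R * (dv 4 d * m%:R) + (- 2%:R) * (dv 2 d * m%:R))).
    by rewrite LLD !LLZ !LL_m_dv //; ring.
  by move=> m d _ _; rewrite !modn1 !mul1r im_powD //; ring.
have h := lambert_square i0 (isT : (0 < 1)%N) ri.
rewrite fsub1 hE hF hU in h.
apply: (lincomb3 (c1 := -4) (c2 := 8 * fC i * L4) (c3 := 8 * L4 + 16 * L4 ^+ 2) h gE I2); ring.
Qed.

(** [lambert_square] at the cube root of unity [om z], where (1 + om)/(1 - om) = sqrt(-3)/3. *)
Lemma L3_sqr : (1 + 6 * L3) ^+ 2 = 1 + 12 * S - 36 * fsub 3 S.
Proof.
pose w := om z; pose th := rtm3 z; have th2 : th ^+ 2 = -3 := rtm3_sqr z4.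
have w0 : w != 0 by rewrite expf_neq0 // (root_neq0 z4).
have wE : w = z ^+ 2 - 1 by rewrite /w /om z4.
have w1 : w != 1.
  apply/eqP => h; have := th2; rewrite /th /rtm3.
  have e : z ^+ 2 = 2 by rewrite wE in h; apply: (lincomb1 (c1 := 1) h); ring.
  rewrite e => h3; have /eqP : 12%:R = 0 :> K by apply: (lincomb1 (c1 := 1) h3); ring.
  by rewrite pnatr_eq0.
have rw : reg w 0 by rewrite /reg eqxx.
have hg := gm_eq rw; rewrite /tm fX0 mulr1 in hg.
have fw : fC w = fC z ^+ 2 - 1 by rewrite wE rmorphB rmorph1 rmorphXn.
have fth : fC th = 2 * fC z ^+ 2 - 1 by rewrite /th /rtm3 rmorphB rmorph1 rmorphM rmorphXn rmorph_nat.
have fz4 : fC z ^+ 4 = fC z ^+ 2 - 1 by rewrite -!rmorphXn z4 rmorphB rmorph1.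
have T2 : fC th ^+ 2 = -3 by rewrite -rmorphXn th2 rmorphN rmorph_nat.
have gE : 3 * (2 * gm w 0 + 1) = fC th.
  rewrite fth; rewrite fw in hg; move: (gm w 0) hg => G hg.
  apply: (lincomb2 (c1 := 2 * (1 + fC z ^+ 2)) (c2 := 2 * G + 2) hg fz4); ring.
have hE : lamE w 0 1 = gm w 0 + fC th * L3.
  rewrite /lamE mul1r; congr (_ + _).
  rewrite (@eq_LL _ _ (fun _ d => th * c3 d)); first by rewrite LLZ.
  by move=> m d _ _; rewrite !modn1 !mul1r om_powB.
have hF : lamF w 0 1 = gm w 0 ^+ 2 + gm w 0 + (9 * fsub 3 S - S).
  rewrite /lamF mul1r; congr (_ + _).
  rewrite (@eq_LL _ _ (fun _ d => 3%:R * (dv 3 d * d%:R) - d%:R)).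
    by rewrite LLB !LLZ !LL_dv_id // LL_d; ring.
  by move=> m d _ _; rewrite !modn1 !mul1r om_powD //; ring.
have hU : lamU w 0 1 = 3 * fsub 3 S - S.
  rewrite /lamU (@eq_LL _ _ (fun m d => 3%:R * (dv 3 d * m%:R) - m%:R)).
    by rewrite LLB !LLZ !LL_m_dv // LL_m; ring.
  by move=> m d _ _; rewrite !modn1 !mul1r om_powD //; ring.
have h := lambert_square w0 (isT : (0 < 1)%N) rw.
rewrite fsub1 hE hF hU in h.
apply: (lincomb3 (c1 := -12) (c2 := 4 * fC th * L3) (c3 := 4 * L3 + 12 * L3 ^+ 2) h gE T2); ring.
Qed.

Section ConjugatePair.
Variables (x : K) (a b : nat).
Hypothesis a0 : (0 < a)%N.
Let A m : K := (m %% b == a)%N%:R.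
Let B m : K := ((m + a) %% b == 0)%N%:R.
Let an0 : (a == 0)%N = false. Proof. by case: a a0. Qed.

(** Sums and differences over x and x^-1 separate even and odd functions of m and of d; at the
    chosen points the odd ones are characters and the even ones divisibility indicators. *)
Lemma lamE_pairB : lamE x a b - lamE x^-1 a b =
  LL (fun m d => (A m + B m) * (x ^+ d - x^-1 ^+ d)).
Proof.
rewrite /lamE an0 !mul0r !add0r -LLB; apply: eq_LL => m d _ _.
by rewrite invrK -/(A m) -/(B m); ring.
Qed.
Lemma lamE_pairD : lamE x a b + lamE x^-1 a b =
  LL (fun m d => (A m - B m) * (x ^+ d + x^-1 ^+ d)).
Proof.
rewrite /lamE an0 !mul0r !add0r -LLD; apply: eq_LL => m d _ _.
by rewrite invrK -/(A m) -/(B m); ring.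
Qed.
Lemma lamF_pairB : lamF x a b - lamF x^-1 a b =
  LL (fun m d => (A m - B m) * (x ^+ d - x^-1 ^+ d) * d%:R ^+ 1).
Proof.
rewrite /lamF an0 !mul0r !add0r -LLB; apply: eq_LL => m d _ _.
by rewrite invrK -/(A m) -/(B m); ring.
Qed.
Lemma lamF_pairD : lamF x a b + lamF x^-1 a b =
  LL (fun m d => (A m + B m) * ((x ^+ d + x^-1 ^+ d) * d%:R)).
Proof.
rewrite /lamF an0 !mul0r !add0r -LLD; apply: eq_LL => m d _ _.
by rewrite invrK -/(A m) -/(B m); ring.
Qed.
Lemma lamR_pairB : lamR x a b - lamR x^-1 a b =
  LL (fun m d => (A m - B m) * (x ^+ d - x^-1 ^+ d) * d%:R ^+ 3).
Proof.
rewrite /lamR an0 !mul0r !add0r -LLB; apply: eq_LL => m d _ _.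
by rewrite invrK -/(A m) -/(B m); ring.
Qed.
Lemma lamU_pairB : lamU x a b - lamU x^-1 a b =
  LL (fun m d => (x ^+ m - x^-1 ^+ m) * (A d - B d) * d%:R ^+ 1).
Proof.
rewrite [RHS]LL_swap /lamU -LLB; apply: eq_LL => m d _ _.
by rewrite invrK -/(A m) -/(B m); ring.
Qed.
End ConjugatePair.

Let i0 : im z != 0. Proof. by rewrite expf_neq0 // (root_neq0 z4). Qed.
Let w0 : om z != 0. Proof. by rewrite expf_neq0 // (root_neq0 z4). Qed.
Let r1 (x : K) : reg x 1. Proof. by []. Qed.
Let two_I : 2 * fC (im z) != 0 :> fps K.
Proof. by rewrite mulf_neq0 ?nz ?fC_neq0. Qed.
Let th0 : fC (rtm3 z) != 0 :> fps K.
Proof.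
apply: fC_neq0; apply/eqP => h; have := rtm3_sqr z4; rewrite h expr0n /= => /eqP.
by rewrite eq_sym oppr_eq0 pnatr_eq0.
Qed.

Let F4 : lamF (im z) 1 3 - lamF (im z)^-1 1 3 = 2 * fC (im z) * W4.
Proof.
rewrite lamF_pairB // (_ : 2 * _ = fC (2 * im z)); last by ring.
by rewrite -LLZ; apply: eq_LL => m d _ _; rewrite mod3B im_powB //; ring.
Qed.
Let R4 : lamR (im z) 1 3 - lamR (im z)^-1 1 3 = 2 * fC (im z) * H4.
Proof.
rewrite lamR_pairB // (_ : 2 * _ = fC (2 * im z)); last by ring.
by rewrite -LLZ; apply: eq_LL => m d _ _; rewrite mod3B im_powB //; ring.
Qed.

(** [lambert_quartic_diff] at i and i^-1 with a = 1, b = 3: differences are odd in m and in d and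
    give H4 and W4, while F_1 + F_2 is even and gives divisor sums. *)
Lemma H4_rel : H4 = W4 * (6 * (16 * fsub 4 S - 4 * fsub 2 S - 16 * fsub 12 S + 4 * fsub 6 S) + 1 - 24 * fsub 3 S).
Proof.
have h := lambert_quartic_diff i0 (isT : (1 < 3)%N) (r1 _) (invr_neq0 i0) (isT : (1 < 3)%N) (r1 _).
have hD : lamF (im z) 1 3 + lamF (im z)^-1 1 3 =
    16 * fsub 4 S - 4 * fsub 2 S - 16 * fsub 12 S + 4 * fsub 6 S.
  rewrite lamF_pairD // (@eq_LL _ _ (fun m d => 4%:R * (dv 4 d * d%:R) + (- 2%:R) * (dv 2 d * d%:R) +
    (- 4%:R) * (dv 3 m * (dv 4 d * d%:R)) + 2%:R * (dv 3 m * (dv 2 d * d%:R)))).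
    by rewrite !LLD !LLZ !LL_dvm_dv_id // !LL_dv_id //; ring.
  by move=> m d _ _; rewrite mod3D im_powD //; ring.
rewrite R4 F4 hD in h; apply: (mulfI two_I); rewrite h; ring.
Qed.

(** Subtracting the square relations at i and i^-1 leaves (E_1 - E_2)(E_1 + E_2), whose factors are
    weight 1 series for chi_-4 and chi_-3. *)
Lemma rel4 : (L4 - fsub 3 L4) * (3 * (4 * fsub 4 L3 - 2 * fsub 2 L3) + 1) = 3 * W4 - 2 * W3.
Proof.
have h := lambert_square i0 (isT : (1 < 3)%N) (r1 _).
have h' := lambert_square (invr_neq0 i0) (isT : (1 < 3)%N) (r1 _).
have eB : lamE (im z) 1 3 - lamE (im z)^-1 1 3 = 2 * fC (im z) * (L4 - fsub 3 L4).
  rewrite lamE_pairB // (@eq_LL _ _ (fun m d => (2 * im z) * c4 d + (- (2 * im z)) * (dv 3 m * c4 d))).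
    by rewrite LLD !LLZ LL_dvm // -/(lam_char c4); ring.
  by move=> m d _ _; rewrite mod3D im_powB //; ring.
have eD : lamE (im z) 1 3 + lamE (im z)^-1 1 3 = 4 * fsub 4 L3 - 2 * fsub 2 L3.
  rewrite lamE_pairD // LL_swap.
  rewrite (@eq_LL _ _ (fun m d => 4%:R * (dv 4 m * c3 d) + (- 2%:R) * (dv 2 m * c3 d))).
    by rewrite LLD !LLZ !LL_dvm //; ring.
  by move=> m d _ _; rewrite mod3B im_powD //; ring.
have eU : lamU (im z) 1 3 - lamU (im z)^-1 1 3 = 2 * fC (im z) * W3.
  rewrite lamU_pairB (_ : 2 * _ = fC (2 * im z)); last by ring.
  by rewrite -LLZ; apply: eq_LL => m d _ _; rewrite mod3B im_powB //; ring.
apply: (mulfI two_I); have eF := F4.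
move: (lamE _ _ _) (lamE _^-1 _ _) (lamF _ _ _) (lamF _^-1 _ _) (lamU _ _ _) (lamU _^-1 _ _) h h' eB eD eU eF
  => e e' f f' u u' h h' eB eD eU eF.
have hh : 3 * ((e - e') * (e + e')) + (e - e') = 3 * (f - f') - 2 * (u - u').
  by apply: (lincomb2 (c1 := 1) (c2 := -1) h h'); ring.
by rewrite eB eD eF eU in hh; apply: (lincomb1 (c1 := 1) hh); ring.
Qed.

Let F3 : lamF (om z) 1 4 - lamF (om z)^-1 1 4 = fC (rtm3 z) * W3.
Proof.
rewrite lamF_pairB // -LLZ; apply: eq_LL => m d _ _; rewrite mod4B om_powB //; ring.
Qed.
Let R3 : lamR (om z) 1 4 - lamR (om z)^-1 1 4 = fC (rtm3 z) * H3.
Proof.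
rewrite lamR_pairB // -LLZ; apply: eq_LL => m d _ _; rewrite mod4B om_powB //; ring.
Qed.

(** As for H4, now at [om z] and its inverse with b = 4, which exchanges the roles of chi_-3 and
    chi_-4. *)
Lemma H3_rel : H3 = W3 * (6 * (9 * fsub 3 S - S - 9 * fsub 6 S + fsub 2 S) + 1 - 24 * fsub 4 S).
Proof.
have h := lambert_quartic_diff w0 (isT : (1 < 4)%N) (r1 _) (invr_neq0 w0) (isT : (1 < 4)%N) (r1 _).
have hD : lamF (om z) 1 4 + lamF (om z)^-1 1 4 = 9 * fsub 3 S - S - 9 * fsub 6 S + fsub 2 S.
  rewrite lamF_pairD // (@eq_LL _ _ (fun m d => 3%:R * (dv 3 d * d%:R) - d%:R +
    (- 3%:R) * (dv 2 m * (dv 3 d * d%:R)) + dv 2 m * d%:R)).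
    by rewrite !LLD LLN !LLZ !LL_dvm_dv_id // LL_dvm // !LL_dv_id // LL_d; ring.
  by move=> m d _ _; rewrite mod4D om_powD //; ring.
rewrite R3 F3 hD in h; apply: (mulfI th0); rewrite h; ring.
Qed.

Lemma rel3 : (L3 - fsub 2 L3) * (2 * (3 * fsub 3 L4 - L4) + 1) = 2 * W3 - W4.
Proof.
have h := lambert_square w0 (isT : (1 < 4)%N) (r1 _).
have h' := lambert_square (invr_neq0 w0) (isT : (1 < 4)%N) (r1 _).
have eB : lamE (om z) 1 4 - lamE (om z)^-1 1 4 = fC (rtm3 z) * (L3 - fsub 2 L3).
  rewrite lamE_pairB // (@eq_LL _ _ (fun m d => (rtm3 z) * c3 d + (- (rtm3 z)) * (dv 2 m * c3 d))).
    by rewrite LLD !LLZ LL_dvm // -/(lam_char c3); ring.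
  by move=> m d _ _; rewrite mod4D om_powB //; ring.
have eD : lamE (om z) 1 4 + lamE (om z)^-1 1 4 = 3 * fsub 3 L4 - L4.
  rewrite lamE_pairD // LL_swap.
  rewrite (@eq_LL _ _ (fun m d => 3%:R * (dv 3 m * c4 d) - c4 d)).
    by rewrite LLB !LLZ !LL_dvm // -/(lam_char c4); ring.
  by move=> m d _ _; rewrite mod4B om_powD //; ring.
have eU : lamU (om z) 1 4 - lamU (om z)^-1 1 4 = fC (rtm3 z) * W4.
  by rewrite lamU_pairB -LLZ; apply: eq_LL => m d _ _; rewrite mod4B om_powB //; ring.
apply: (mulfI (mulf_neq0 (nz 1) th0)); have eF := F3.
move: (lamE _ _ _) (lamE _^-1 _ _) (lamF _ _ _) (lamF _^-1 _ _) (lamU _ _ _) (lamU _^-1 _ _) h h' eB eD eU eF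
  => e e' f f' u u' h h' eB eD eU eF.
have hh : 4 * ((e - e') * (e + e')) + 2 * (e - e') = 4 * (f - f') - 2 * (u - u').
  by apply: (lincomb2 (c1 := 1) (c2 := -1) h h'); ring.
by rewrite eB eD eF eU in hh; apply: (lincomb1 (c1 := 1) hh); ring.
Qed.

End Relations.

Let ind a m : K := (m %% 12 == a)%N%:R.
Let indC a m : K := ((m + a) %% 12 == 0)%N%:R.

Let ind12 m : [/\ ind 1 m - indC 1 m + (ind 5 m - indC 5 m) = c4 m - dv 3 m * c4 m,
  ind 1 m - indC 1 m - (ind 5 m - indC 5 m) = c3 m - dv 2 m * c3 m,
  ind 1 m + indC 1 m - (ind 5 m + indC 5 m) = c12 m &
  ind 1 m + indC 1 m + (ind 5 m + indC 5 m) = 1 - dv 2 m - dv 3 m + dv 6 m].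
Proof.
rewrite /ind /indC -!(modnDml m) (c12_mod _ m) (c3_mod _ m) (c4_mod _ m).
rewrite (@dv_mod _ 2 m) // (@dv_mod _ 3 m) // (@dv_mod _ 6 m) //.
move: (m %% 12)%N (ltn_pmod m (isT : (0 < 12)%N)) =>
  [_|[_|[_|[_|[_|[_|[_|[_|[_|[_|[_|[_|//]]]]]]]]]]]];
  rewrite /c12 /c3 /c4 /dv /chi12 /chim3 /chim4 /=; split; ring.
Qed.

Let r12 a : (0 < a)%N -> reg (1 : K) a. Proof. exact: reg_pos. Qed.
Let E12 a : (0 < a)%N -> lamE 1 a 12 = LL (fun m _ => ind a m - indC a m).
Proof.
case: a => // a _; rewrite /lamE mul0r add0r; apply: eq_LL => m d _ _.
by rewrite invr1 !expr1n !mulr1.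
Qed.
Let F12 a : (0 < a)%N -> lamF 1 a 12 = LL (fun m d => (ind a m + indC a m) * d%:R ^+ 1).
Proof.
case: a => // a _; rewrite /lamF mul0r add0r; apply: eq_LL => m d _ _.
by rewrite invr1 !expr1n !mulr1 mulrC.
Qed.
Let R12 a : (0 < a)%N -> lamR 1 a 12 = LL (fun m d => (ind a m + indC a m) * d%:R ^+ 3).
Proof.
case: a => // a _; rewrite /lamR mul0r add0r; apply: eq_LL => m d _ _.
by rewrite invr1 !expr1n !mulr1 mulrC.
Qed.
Let U12 a : (0 < a)%N -> lamU 1 a 12 = LL (fun m d => (ind a d + indC a d) * d%:R ^+ 1).
Proof.
case: a => // a _; rewrite [RHS]LL_swap /lamU; apply: eq_LL => m d _ _.
by rewrite invr1 !expr1n !mulr1 mulrC.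
Qed.

Let F12B : lamF 1 1 12 - lamF 1 5 12 = W2.
Proof.
rewrite !F12 // -LLB; apply: eq_LL => m d _ _; rewrite -mulrBl.
by have [_ _ -> _] := ind12 m; rewrite /one_ mulr1.
Qed.

(** Here z = 1 and the two points are the classes a = 1 and a = 5 modulo 12: chi_12 is the indicator
    of 1, -1 minus that of 5, -5, now in the variable m. *)
Lemma H2_rel : H2 = W2 * (6 * (S - fsub 2 S - fsub 3 S + fsub 6 S) + 1 - 24 * fsub 12 S).
Proof.
have h := lambert_quartic_diff (oner_neq0 K) (isT : (1 < 12)%N) (@r12 1 isT)
  (oner_neq0 K) (isT : (5 < 12)%N) (@r12 5 isT).
have hD : lamF 1 1 12 + lamF 1 5 12 = S - fsub 2 S - fsub 3 S + fsub 6 S.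
  rewrite !F12 // -LLD.
  rewrite (@eq_LL _ _ (fun m d => d%:R - dv 2 m * d%:R - dv 3 m * d%:R + dv 6 m * d%:R)).
    by rewrite LLD !LLB !LL_dvm.
  by move=> m d _ _; rewrite -mulrDl; have [_ _ _ ->] := ind12 m; ring.
have hR : lamR 1 1 12 - lamR 1 5 12 = H2.
  rewrite !R12 // -LLB; apply: eq_LL => m d _ _; rewrite -mulrBl.
  by have [_ _ -> _] := ind12 m; rewrite /one_ mulr1.
by rewrite hR F12B hD in h.
Qed.

Lemma rel2 : (2 * (L4 + fsub 3 L4) + 1) * (3 * (L3 + fsub 2 L3) + 1) = 6 * W2 - (W1 - 1).
Proof.
have h := lambert_square (oner_neq0 K) (isT : (1 < 12)%N) (@r12 1 isT).
have h' := lambert_square (oner_neq0 K) (isT : (5 < 12)%N) (@r12 5 isT).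
have eD : lamE 1 1 12 + lamE 1 5 12 = L4 + fsub 3 L4.
  rewrite !E12 // -LLD LL_swap.
  rewrite (@eq_LL _ _ (fun _ d => c4 d - dv 3 d * c4 d)); first by rewrite LLB L4_dv3 opprK.
  by move=> m d _ _; have [-> _ _ _] := ind12 d.
have eB : lamE 1 1 12 - lamE 1 5 12 = L3 + fsub 2 L3.
  rewrite !E12 // -LLB LL_swap.
  rewrite (@eq_LL _ _ (fun _ d => c3 d - dv 2 d * c3 d)); first by rewrite LLB L3_dv2 opprK.
  by move=> m d _ _; have [_ -> _ _] := ind12 d.
have eU : lamU 1 1 12 - lamU 1 5 12 = W1.
  rewrite !U12 // -LLB; apply: eq_LL => m d _ _; rewrite -mulrBl.
  by have [_ _ -> _] := ind12 d; rewrite /one_ mul1r.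
apply: (mulfI (fps_natr_neq0 K 1)); have eF := F12B.
move: (lamE _ 1 _) (lamE _ 5 _) (lamF _ 1 _) (lamF _ 5 _) (lamU _ 1 _) (lamU _ 5 _) h h' eB eD eU eF
  => e e' f f' u u' h h' eB eD eU eF.
(* b - 2 a is 10 for a = 1 and 2 for a = 5, and 10 e - 2 e' = 4 (e + e') + 6 (e - e'). *)
have hh : 12 * ((e - e') * (e + e')) + 4 * (e + e') + 6 * (e - e') = 12 * (f - f') - 2 * (u - u').
  by apply: (lincomb2 (c1 := 1) (c2 := -1) h h'); ring.
by rewrite eB eD eF eU in hh; apply: (lincomb1 (c1 := 1) hh); ring.
Qed.

End LambertRelations.

(** * Eisenstein series as polynomials in theta functions *)

Section EisensteinTheta.
Variable K : numFieldType.
Local Notation X := (fX K).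
Local Notation S := (sigma_series K).
Local Notation A := (phi K).
Local Notation C := (phim K).
Local Notation B := (fsub 3 (phi K)).
Local Notation D := (fsub 3 (phim K)).
Local Notation a := (hexa K).
Local Notation eul := (eul K).
Local Notation L3 := (lam_char (c3 K)).
Local Notation L4 := (lam_char (c4 K)).
Local Notation one_ := (@one_ K).
Local Notation W1 := (eisL one_ (c12 K) 1).
Local Notation W2 := (eisL (c12 K) one_ 1).
Local Notation W3 := (eisL (c4 K) (c3 K) 1).
Local Notation W4 := (eisL (c3 K) (c4 K) 1).
Local Notation H1 := (eisL one_ (c12 K) 3).
Local Notation H2 := (eisL (c12 K) one_ 3).
Local Notation H3 := (eisL (c4 K) (c3 K) 3).
Local Notation H4 := (eisL (c3 K) (c4 K) 3).
Let nz n := fps_natr_neq0 K n.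

Lemma fD_eul : fD eul = - S * eul.
Proof.
apply: eqmP => N; case: N => [|N] //.
pose Sn n := \sum_(1 <= m < n.+1) m%:R * gm (1 : K) m.
have eS : eqm N.+1 S (Sn N).
  rewrite /sigma_series LL_swap.
  apply: (eqm_trans _ (eqm_LL _ (leqnn N.+1) (leqnn N.+1))) => n lt.
  rewrite !cf_sum; apply: eq_big_nat => m /andP[m0 _].
  rewrite (_ : \sum_(1 <= d < N.+1) _ = m%:R * \sum_(1 <= d < N.+1) fC (1 ^+ d) * X (m * d)%N).
    by move: n lt; apply: eqmM => //; apply/eqm_sym/gm_coefs.
  by rewrite mulr_sumr; apply: eq_bigr => d _; rewrite expr1n rmorph1 mul1r rmorph_nat.
have eD n : fD (eul_upto K n) = - Sn n * eul_upto K n.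
  elim: n => [|n IH]; first by rewrite /eul_upto /Sn !big_geq // fD1 oppr0 mul0r.
  rewrite eul_uptoS fDM IH raddfB /= fD1 sub0r /Sn (big_nat_recr n.+1) //= -/(Sn n).
  have h := gm_eq (reg_pos (1 : K) (isT : (0 < n.+1)%N)); rewrite /tm rmorph1 mul1r in h.
  have -> : fD (X n.+1) = n.+1%:R * X n.+1.
    apply: fpsP => k; rewrite mulr_natl cfMn /=.
    by case: eqP => [->|]; rewrite ?mulr1 ?mulr0 ?mul0rn.
  by apply: (lincomb1 (c1 := n.+1%:R * eul_upto K n) h); ring.
have ee := @eqm_eul K N.
apply: (eqm_trans (fD (eul_upto K N))); first by move=> n lt; rewrite !cf_fD ee.
rewrite eD; apply: eqmM; last exact: eqm_sym.
by apply/eqmN/eqm_sym.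
Qed.

Let e0 j : cf (fsub j eul) 0 != 0.
Proof. by rewrite -/(ct _) ct_fsub ct_eul oner_eq0. Qed.
Let dl_eul j : (0 < j)%N -> dl (fsub j eul) = - j%:R * fsub j S.
Proof.
move=> j0; rewrite dl_fsub //; last by rewrite -/(ct _) ct_eul oner_eq0.
have -> : dl eul = - S by apply: dlE; [rewrite -/(ct _) ct_eul oner_eq0 | exact: fD_eul].
by rewrite raddfN mulrN mulNr.
Qed.
Let dl_eul1 : dl eul = - S.
Proof. by have := dl_eul (isT : (0 < 1)%N); rewrite !fsub1 mulN1r. Qed.

Let A0 : cf A 0 != 0. Proof. by rewrite phi0 oner_eq0. Qed.
Let C0 : cf C 0 != 0. Proof. by rewrite phim0 oner_eq0. Qed.
Let T0 : cf (trig K) 0 != 0. Proof. by rewrite trig0 pnatr_eq0. Qed.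
Let E0 : cf eul 0 != 0. Proof. by rewrite -/(ct _) ct_eul oner_eq0. Qed.
Let p0 (f : fps K) n : cf f 0 != 0 -> cf (f ^+ n) 0 != 0.
Proof. by move=> f0; rewrite cf0X expf_neq0. Qed.
Let m0 (f g : fps K) : cf f 0 != 0 -> cf g 0 != 0 -> cf (f * g) 0 != 0.
Proof. by move=> f0 g0; rewrite cf0M mulf_neq0. Qed.

Let dl_C : dl C = - 2 * S + 2 * fsub 2 S.
Proof.
have := congr1 dl (phim_eul K); rewrite (dlM C0 (e0 2)) (dlX 2 E0) dl_eul // dl_eul1 => h.
by apply: (lincomb1 (c1 := 1) h); ring.
Qed.
Let dl_A : dl A = 2 * S - 10 * fsub 2 S + 8 * fsub 4 S.
Proof.
have := congr1 dl (phi_eul K).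
rewrite (dlM (m0 A0 (p0 2 E0)) (p0 2 (e0 4))) (dlM A0 (p0 2 E0)) (dlX 2 E0) (dlX 2 (e0 4)) (dlX 5 (e0 2)).
rewrite !dl_eul // dl_eul1 => h.
by apply: (lincomb1 (c1 := 1) h); ring.
Qed.
Let dl_T : dl (trig K) = 2 * fsub 2 S - 8 * fsub 4 S.
Proof.
have two0 : cf (2 : fps K) 0 != 0 by rewrite cf0nat pnatr_eq0.
have dl2 : dl (2 : fps K) = 0.
  by apply: dlE => //; rewrite mul0r -(rmorph_nat (@fC K)) fDC.
have := congr1 dl (trig_eul K).
rewrite (dlM T0 (e0 2)) (dlM two0 (p0 2 (e0 4))) (dlX 2 (e0 4)) !dl_eul // dl2 => h.
by apply: (lincomb1 (c1 := 1) h); ring.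
Qed.

(** The products give dl T and dl C as divisor sums, and [dl_trig] then gives A^4: Jacobi's
    four-square theorem. *)
Lemma phi4_sigma : A ^+ 4 = 1 + 8 * S - 32 * fsub 4 S.
Proof. by have h := dl_trig K; rewrite dl_T dl_C in h; apply: (lincomb1 (c1 := -1) h); ring. Qed.
Lemma phim4_sigma : C ^+ 4 = 1 - 8 * S + 48 * fsub 2 S - 64 * fsub 4 S.
Proof.
have h := dl_phi_sub_dl_phim K; rewrite dl_A dl_C phi4_sigma in h.
by apply: (lincomb1 (c1 := 1) h); ring.
Qed.

Let fsub_nat j k : (0 < j)%N -> fsub j (k%:R : fps K) = k%:R.
Proof. by case: j => // j _; rewrite rmorph_nat. Qed.
Let fs1 j : (0 < j)%N -> fsub j (1 : fps K) = 1.
Proof. by case: j => // j _; rewrite rmorph1. Qed.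

Let f3B f g : fsub 3 (f - g) = fsub 3 f - fsub 3 g :> fps K. Proof. exact: raddfB. Qed.
Let f3D f g : fsub 3 (f + g) = fsub 3 f + fsub 3 g :> fps K. Proof. exact: raddfD. Qed.
Let f3Z n f : fsub 3 (n%:R * f) = n%:R * fsub 3 f :> fps K. Proof. by rewrite fsubM // fsub_nat. Qed.
Let f3S j : (0 < j)%N -> fsub 3 (fsub j S) = fsub (3 * j) S. Proof. by move=> j0; rewrite fsub_fsub. Qed.
Let f3S2 : fsub 3 (fsub 2 S) = fsub 6 S. Proof. exact: f3S. Qed.
Let f3S4 : fsub 3 (fsub 4 S) = fsub 12 S. Proof. exact: f3S. Qed.
Let f3Z1 n : fsub 3 (n%:R * S) = n%:R * fsub 3 S. Proof. exact: f3Z. Qed.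
Let f3Z2 n : fsub 3 (n%:R * fsub 2 S) = n%:R * fsub 6 S. Proof. by rewrite f3Z f3S2. Qed.
Let f3Z4 n : fsub 3 (n%:R * fsub 4 S) = n%:R * fsub 12 S. Proof. by rewrite f3Z f3S4. Qed.
Let phi4_3 : B ^+ 4 = 1 + 8 * fsub 3 S - 32 * fsub 12 S.
Proof.
rewrite -(fsubXn A 4 (isT : (0 < 3)%N)) phi4_sigma f3B f3D.
by congr (_ + _ - _); [exact: fs1 | exact: f3Z1 | exact: f3Z4].
Qed.
Let phim4_3 : D ^+ 4 = 1 - 8 * fsub 3 S + 48 * fsub 6 S - 64 * fsub 12 S.
Proof.
rewrite -(fsubXn C 4 (isT : (0 < 3)%N)) phim4_sigma f3B f3D f3B.
by congr (_ - _ + _ - _); [exact: fs1 | exact: f3Z1 | exact: f3Z2 | exact: f3Z4].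
Qed.
Let dl_B : dl B = 6 * fsub 3 S - 30 * fsub 6 S + 24 * fsub 12 S.
Proof.
rewrite dl_fsub // dl_A f3D f3B.
have -> : fsub 3 (2 * S) = 2 * fsub 3 S by exact: f3Z1.
rewrite [fsub 3 (_ * fsub 2 S)]f3Z2 [fsub 3 (_ * fsub 4 S)]f3Z4.
ring.
Qed.

Local Notation r := (rho K).
Local Notation t := (tau K).
Local Notation m := (mu K).
Local Notation x := (rho K ^+ 2).
Let A4 : A ^+ 4 = (8 * r ^+ 3 * t) ^+ 2. Proof. by rewrite -phi_sqr -exprM. Qed.
Let B4 : B ^+ 4 = (8 * r * t) ^+ 2. Proof. by rewrite -phi3_sqr -exprM. Qed.
Let C4 : C ^+ 4 = (2 * t * m * (3 - x)) ^+ 2. Proof. by rewrite -phim_sqr -exprM. Qed.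
Let D4 : D ^+ 4 = (2 * t * m * (1 + x)) ^+ 2. Proof. by rewrite -phim3_sqr -exprM. Qed.

(** A^4 and C^4 involve only S(q), S(q^2), S(q^4), and B^4 and D^4 the same at q^3; S - 3 S(q^3)
    mixes the two families, and [dl_rho] supplies the link. *)
Lemma hexa_sqr_sigma : a ^+ 2 = 1 + 12 * S - 36 * fsub 3 S.
Proof.
have h := dl_rho K; rewrite dl_A dl_B in h.
have e : 2 * a ^+ 2 = 4 * A ^+ 4 - 5 * C ^+ 4 - 12 * B ^+ 4 + 15 * D ^+ 4 -
    24 * (2 * t ^+ 2 * m ^+ 2 * (x - 1) * (x + 3)).
  rewrite A4 B4 C4 D4 hexaE; ring: (mu_sqr K).
apply: (mulfI (nz 1)); rewrite e -h phi4_sigma phim4_sigma phi4_3 phim4_3; ring.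
Qed.

Section Root.
Variable z : K.
Hypothesis z4 : z ^+ 4 = z ^+ 2 - 1.

(** Both sides have the same square by the four-square theorem and [L4_sqr], and the constant term
    selects the root: the two-square theorem. Its analogue for a(q) follows in the same way. *)
Lemma lambert_chi4 : 1 + 4 * L4 = A ^+ 2.
Proof.
apply: eq_sqr_ct; first by rewrite (L4_sqr z4) -exprM phi4_sigma.
  by rewrite ctX ct_phi /ct cfD cf1 mulr_natl cfMn /= big_geq // mul0rn addr0 expr1n.
by rewrite /ct cfD cf1 mulr_natl cfMn /= big_geq // mul0rn addr0 oner_eq0.
Qed.
Lemma lambert_chi3 : 1 + 6 * L3 = a.
Proof.
apply: eq_sqr_ct; first by rewrite (L3_sqr z4) hexa_sqr_sigma.
  by rewrite ct_hexa /ct cfD cf1 mulr_natl cfMn /= big_geq // mul0rn addr0.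
by rewrite /ct cfD cf1 mulr_natl cfMn /= big_geq // mul0rn addr0 oner_eq0.
Qed.

Let L4_3 : 1 + 4 * fsub 3 L4 = B ^+ 2.
Proof. by have := congr1 (fsub 3) lambert_chi4; rewrite raddfD /= (fsubM 4) // fs1 // fsub_nat // fsubXn. Qed.
Let L3_j j : (0 < j)%N -> 1 + 6 * fsub j L3 = fsub j a.
Proof. by move=> j0; rewrite -lambert_chi3 raddfD /= (fsubM 6) // fs1 // fsub_nat. Qed.

Definition thP := (A ^+ 2 + 3 * B ^+ 2) * (fsub 2 a + 2 * fsub 4 a).
Definition thQ := (A ^+ 2 + B ^+ 2) * (a + fsub 2 a).
Definition thR := (a - fsub 2 a) * (3 * B ^+ 2 - A ^+ 2).
Definition thT := (A ^+ 2 - B ^+ 2) * (2 * fsub 4 a - fsub 2 a).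

(** [rel1] and [rel2] are a linear system for W1 - 1 and W2, [rel3] and [rel4] one for W3 and W4;
    the weight 1 Lambert series in them are theta functions. *)
Let weight2 : [/\ 8 * (W1 - 1) = thQ - thP, 48 * W2 = 3 * thQ - thP,
  16 * W3 = thR + thT & 24 * W4 = thR + 3 * thT].
Proof.
have r1 := rel1 z4; have r2 := rel2 K; have r3 := rel3 z4; have r4 := rel4 z4.
rewrite /thP /thQ /thR /thT -(L3_j (isT : (0 < 2)%N)) -(L3_j (isT : (0 < 4)%N)).
rewrite -lambert_chi3 -L4_3 -lambert_chi4.
split.
- by apply: (lincomb2 (c1 := 12) (c2 := -4) r1 r2); ring.
- by apply: (lincomb2 (c1 := 12) (c2 := -12) r1 r2); ring.
- by apply: (lincomb2 (c1 := -12) (c2 := -4) r3 r4); ring.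
- by apply: (lincomb2 (c1 := -12) (c2 := -12) r3 r4); ring.
Qed.

(** The combination of the S(q^j) in [H1_rel], with its constant -23, is matched by theta fourth
    powers and a(q)^2. *)
Lemma H1_theta : 16 * (23 + H1) =
  (thQ - thP) * (4 * A ^+ 4 + C ^+ 4 - 36 * B ^+ 4 - 9 * D ^+ 4 - 6 * a ^+ 2).
Proof.
have [w _ _ _] := weight2; rewrite -w (H1_rel z4).
by rewrite phi4_sigma phim4_sigma phi4_3 phim4_3 hexa_sqr_sigma /sig2; ring.
Qed.
Lemma H2_theta : 384 * H2 =
  (3 * thQ - thP) * (2 * A ^+ 4 - C ^+ 4 + 4 * B ^+ 4 + D ^+ 4 + 2 * a ^+ 2).
Proof.
have [_ w _ _] := weight2; rewrite -w H2_rel.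
by rewrite phi4_sigma phim4_sigma phi4_3 phim4_3 hexa_sqr_sigma; ring.
Qed.
Lemma H3_theta : 128 * H3 =
  (thR + thT) * (4 * A ^+ 4 + C ^+ 4 + 18 * B ^+ 4 - 9 * D ^+ 4 - 6 * a ^+ 2).
Proof.
have [_ _ w _] := weight2; rewrite -w (H3_rel z4).
by rewrite phi4_sigma phim4_sigma phi4_3 phim4_3 hexa_sqr_sigma; ring.
Qed.
Lemma H4_theta : 48 * H4 =
  (thR + 3 * thT) * (- 4 * A ^+ 4 - C ^+ 4 + 4 * B ^+ 4 + D ^+ 4 + 2 * a ^+ 2).
Proof.
have [_ _ _ w] := weight2; rewrite -w (H4_rel z4).
by rewrite phi4_sigma phim4_sigma phi4_3 phim4_3 hexa_sqr_sigma; ring.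
Qed.

End Root.
End EisensteinTheta.

(** * Eta quotients as theta products *)

Section EtaTheta.
Variable K : numFieldType.
Local Notation X := (fX K).
Local Notation A := (phi K).
Local Notation C := (phim K).
Local Notation B := (fsub 3 (phi K)).
Local Notation D := (fsub 3 (phim K)).
Local Notation T := (trig K).
Local Notation E j := (fsub j (eul K)).

Definition eta_shift (l : seq (nat * int)) : nat := absz (\sum_(p <- l) p.1%:Z * p.2) %/ 24.
Definition eta_fps (l : seq (nat * int)) : fps K := X (eta_shift l) * \prod_(p <- l) E p.1 ^ p.2.

Let uE j : E j * (E j)^-1 = 1.
Proof.
exact/divrr/unit_eul.
Qed.
Let eC : C = eul K ^+ 2 * (E 2)^-1.
Proof. by rewrite -(phim_eul K); ring: (uE 2). Qed.
Let eT : T = 2 * E 4 ^+ 2 * (E 2)^-1.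
Proof. by rewrite -(trig_eul K); ring: (uE 2). Qed.
Let eD : D = E 3 ^+ 2 * (E 6)^-1.
Proof.
have h := congr1 (fsub 3) (phim_eul K).
rewrite (fsubM (phim K) (E 2)) // (fsubXn (eul K) 2) // fsub_fsub // in h.
by rewrite -h; ring: (uE 6).
Qed.
Let eB : B = E 6 ^+ 5 * (E 3)^-1 ^+ 2 * (E 12)^-1 ^+ 2.
Proof.
have h := congr1 (fsub 3) (phi_eul K).
rewrite (fsubM (phi K * eul K ^+ 2)) // (fsubM (phi K)) // !fsubXn // !fsub_fsub // in h.
by rewrite -h; ring: (uE 3) (uE 12).
Qed.
Let eT3 : fsub 3 T = 2 * E 12 ^+ 2 * (E 6)^-1.
Proof.
have h := congr1 (fsub 3) (trig_eul K).
rewrite (fsubM T) // (fsubM 2) // fsubXn // !fsub_fsub // (_ : fsub 3 2 = 2) ?rmorph_nat // in h.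
by rewrite -h; ring: (uE 6).
Qed.
Let eC2 : fsub 2 C = E 2 ^+ 2 * (E 4)^-1.
Proof.
have h := congr1 (fsub 2) (phim_eul K).
rewrite (fsubM (phim K) (E 2)) // (fsubXn (eul K) 2) // fsub_fsub // in h.
by rewrite -h; ring: (uE 4).
Qed.
Let eD2 : fsub 6 C = E 6 ^+ 2 * (E 12)^-1.
Proof.
have h := congr1 (fsub 6) (phim_eul K).
rewrite (fsubM (phim K) (E 2)) // (fsubXn (eul K) 2) // fsub_fsub // in h.
by rewrite -h; ring: (uE 12).
Qed.
Let subAB : A * B - C * D = X 1 * T * fsub 3 T.
Proof. by apply: (lincomb1 (c1 := 1) (phi_phim_trig K)); ring. Qed.
Let f3B f g : fsub 3 (f - g) = fsub 3 f - fsub 3 g :> fps K. Proof. exact: raddfB. Qed.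
Let f3D f g : fsub 3 (f + g) = fsub 3 f + fsub 3 g :> fps K. Proof. exact: raddfD. Qed.
Let subB4 : B ^+ 4 - D ^+ 4 = X 3 * fsub 3 T ^+ 4.
Proof.
have h := congr1 (fsub 3) (phi_sqr_sub_phim_sqr K).
have h' := congr1 (fsub 3) (phi_sqr_add_phim_sqr K).
have h'' := congr1 (fsub 3) (trig_sqr K).
rewrite (fsubM (2 * X 1)) // (fsubM 2) // fsub_fX // f3B (fsubXn A) // (fsubXn C) // (fsubXn (fsub 2 T)) // fsub_fsub // in h.
rewrite (fsubM 2) // f3D (fsubXn A) // (fsubXn C) // (fsubXn (fsub 2 A)) // fsub_fsub // in h'.
rewrite (fsubM (2 * fsub 2 A)) // (fsubM 2) // fsubXn // !fsub_fsub // in h''.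
rewrite (_ : fsub 3 2 = 2) ?rmorph_nat // in h h' h''.
rewrite (_ : _ - _ = (B ^+ 2 - D ^+ 2) * (B ^+ 2 + D ^+ 2)); last by ring.
rewrite -[(3 * 1)%N]/3%N -[(3 * 2)%N]/6%N in h h' h''.
by rewrite h h' -[4%N]/(2 * 2)%N exprM h''; ring.
Qed.

Local Notation m12 := (fsub 2 (phim K) * fsub 6 (phim K)).

(** With AB - CD read as q T T(q^3), and B^4 - D^4 as q^3 T(q^3)^4 in [eta_fps_v3] and [eta_fps_v4],
    both sides are monomials in the Euler products; the powers of 2 come from the factor 2 in T. *)
Lemma eta_fps_v1 : 4 * eta_fps v1 = B ^+ 2 * D ^+ 4 * (A * B - C * D).
Proof.
have -> : eta_fps v1 = X 1 * \prod_(p <- [:: (2, Negz 0); (3, Posz 4); (4, Posz 2); (6, Posz 5); (12, Negz 1)]%N) E p.1 ^ p.2.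
  by rewrite /eta_fps (_ : eta_shift v1 = 1%N) // /eta_shift /v1 unlock.
rewrite !big_cons big_nil subAB eB eD eT3 eT /exprz /= -!exprVn expr1.
by ring: (uE 2) (uE 3) (uE 4) (uE 6) (uE 12).
Qed.

Lemma eta_fps_v2 : 16 * eta_fps v2 = D ^+ 2 * m12 * (A * B - C * D) ^+ 2.
Proof.
have -> : eta_fps v2 = X 1 ^+ 2 * \prod_(p <- [:: (3, Posz 4); (4, Posz 3); (6, Negz 1); (12, Posz 3)]%N) E p.1 ^ p.2.
  by rewrite -fXM /eta_fps (_ : eta_shift v2 = 2%N) // /eta_shift /v2 unlock.
rewrite !big_cons big_nil subAB eC2 eD2 eD eT3 eT /exprz /= -!exprVn.
by ring: (uE 2) (uE 3) (uE 4) (uE 6) (uE 12).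
Qed.

Lemma eta_fps_v3 : 16 * eta_fps v3 = D ^+ 2 * m12 * (B ^+ 4 - D ^+ 4).
Proof.
have -> : eta_fps v3 = X 3 * \prod_(p <- [:: (2, Posz 2); (3, Posz 4); (4, Negz 0); (6, Negz 3); (12, Posz 7)]%N) E p.1 ^ p.2.
  by rewrite /eta_fps (_ : eta_shift v3 = 3%N) // /eta_shift /v3 unlock.
rewrite !big_cons big_nil subB4 eC2 eD2 eD eT3 /exprz /= -!exprVn expr1.
by ring: (uE 2) (uE 3) (uE 4) (uE 6) (uE 12).
Qed.

Lemma eta_fps_v4 : 16 * eta_fps v4 = C ^+ 2 * m12 * (B ^+ 4 - D ^+ 4).
Proof.
have -> : eta_fps v4 = X 3 * \prod_(p <- [:: (1, Posz 4); (4, Negz 0); (6, Negz 1); (12, Posz 7)]%N) E p.1 ^ p.2.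
  by rewrite /eta_fps (_ : eta_shift v4 = 3%N) // /eta_shift /v4 unlock.
rewrite !big_cons big_nil fsub1 subB4 eC2 eD2 eC eT3 /exprz /= -!exprVn expr1.
by ring: (uE 2) (uE 3) (uE 4) (uE 6) (uE 12).
Qed.

End EtaTheta.

(** * Theta forms in abstract variables and their images under morphisms *)

Section ThetaForms.
Variable R : comNzRingType.
Implicit Types A B C D a b c : R.
(** The variables stand for A^2, B^2, C^4, D^4, a(q), a(q^2) and 2 a(q^4), so that [fsub 2] carries
    the formula to q^2. The factor 2 in the last one fits [hexa8E], which gives 2 a(q^8). *)
Definition eis_form1 A B C D a b c : R :=
  ((A + B) * (a + b) - (A + 3 * B) * (b + c)) *
  (4 * A ^+ 2 + C - 36 * B ^+ 2 - 9 * D - 6 * a ^+ 2).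
Definition eis_form2 A B C D a b c : R :=
  (3 * ((A + B) * (a + b)) - (A + 3 * B) * (b + c)) *
  (2 * A ^+ 2 - C + 4 * B ^+ 2 + D + 2 * a ^+ 2).
Definition eis_form3 A B C D a b c : R :=
  ((a - b) * (3 * B - A) + (A - B) * (c - b)) *
  (4 * A ^+ 2 + C + 18 * B ^+ 2 - 9 * D - 6 * a ^+ 2).
Definition eis_form4 A B C D a b c : R :=
  ((a - b) * (3 * B - A) + 3 * ((A - B) * (c - b))) *
  (4 * B ^+ 2 + D + 2 * a ^+ 2 - 4 * A ^+ 2 - C).
End ThetaForms.

Section MapForms.
Variables (R S : comNzRingType) (f : {rmorphism R -> S}).
Implicit Types A B C D a b c h : R.
Let mapE := (rmorphM f, rmorphB f, rmorphD f, rmorphXn f, rmorph_nat f).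
Lemma eis_form1_map n h A B C D a b c : n%:R * h = eis_form1 A B C D a b c ->
  n%:R * f h = eis_form1 (f A) (f B) (f C) (f D) (f a) (f b) (f c).
Proof. by move=> /(congr1 f); rewrite /eis_form1 !mapE. Qed.
Lemma eis_form2_map n h A B C D a b c : n%:R * h = eis_form2 A B C D a b c ->
  n%:R * f h = eis_form2 (f A) (f B) (f C) (f D) (f a) (f b) (f c).
Proof. by move=> /(congr1 f); rewrite /eis_form2 !mapE. Qed.
Lemma eis_form3_map n h A B C D a b c : n%:R * h = eis_form3 A B C D a b c ->
  n%:R * f h = eis_form3 (f A) (f B) (f C) (f D) (f a) (f b) (f c).
Proof. by move=> /(congr1 f); rewrite /eis_form3 !mapE. Qed.
Lemma eis_form4_map n h A B C D a b c : n%:R * h = eis_form4 A B C D a b c ->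
  n%:R * f h = eis_form4 (f A) (f B) (f C) (f D) (f a) (f b) (f c).
Proof. by move=> /(congr1 f); rewrite /eis_form4 !mapE. Qed.
Lemma cusp_map n k h u p q : n%:R * h = u * (p - q) ^+ k -> n%:R * f h = f u * (f p - f q) ^+ k.
Proof. by move=> /(congr1 f); rewrite !mapE. Qed.
End MapForms.

(** * Theta values at q^2 *)

Section Level24.
Variable K : numFieldType.
Local Notation A := (phi K).
Local Notation C := (phim K).
Local Notation B := (fsub 3 (phi K)).
Local Notation D := (fsub 3 (phim K)).
Local Notation m12 := (fsub 2 (phim K) * fsub 6 (phim K)).
Local Notation r := (rho K).
Local Notation t := (tau K).
Local Notation m := (mu K).
Local Notation x := (rho K ^+ 2).

Let f2M f g : fsub 2 (f * g) = fsub 2 f * fsub 2 g :> fps K. Proof. exact: fsubM. Qed.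
Let f2X f n : fsub 2 (f ^+ n) = fsub 2 f ^+ n :> fps K. Proof. exact: fsubXn. Qed.
Let f2B : fsub 2 B = fsub 6 A. Proof. by rewrite fsub_fsub. Qed.
Let f2D : fsub 2 D = fsub 6 C. Proof. by rewrite fsub_fsub. Qed.

Let C2 : fsub 2 C ^+ 2 = A * C. Proof. by rewrite phi_mul_phim. Qed.
Let D2 : fsub 6 C ^+ 2 = B * D.
Proof.
have := congr1 (fsub 3) (phi_mul_phim K).
by rewrite (fsubM A) // fsubXn // fsub_fsub // => ->.
Qed.

Lemma fsub2_phi_sqr : fsub 2 (A ^+ 2) = t * (4 * r ^+ 3 + m * (3 - x)).
Proof. by rewrite f2X phi2_sqr. Qed.
Lemma fsub2_phi3_sqr : fsub 2 (B ^+ 2) = t * (4 * r + m * (1 + x)).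
Proof. by rewrite f2X f2B phi6_sqr. Qed.
Lemma fsub2_phi_phi3 : fsub 2 (A * B) = t * (x ^+ 2 + 3 + 2 * r * m).
Proof. by rewrite f2M f2B phi2_phi6. Qed.
Lemma fsub2_phim_phim3 : fsub 2 (C * D) = 4 * r * t * m.
Proof. by rewrite f2M f2D phim2_phim6. Qed.
Lemma fsub2_phim_pow4 : fsub 2 (C ^+ 4) = 16 * r ^+ 3 * t ^+ 2 * m * (3 - x).
Proof.
rewrite f2X (_ : fsub 2 C ^+ 4 = (fsub 2 C ^+ 2) ^+ 2); last by rewrite -exprM.
by rewrite C2 exprMn phi_sqr phim_sqr; ring.
Qed.
Lemma fsub2_phim3_pow4 : fsub 2 (D ^+ 4) = 16 * r * t ^+ 2 * m * (1 + x).
Proof.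
rewrite f2X f2D (_ : fsub 6 C ^+ 4 = (fsub 6 C ^+ 2) ^+ 2); last by rewrite -exprM.
by rewrite D2 exprMn phi3_sqr phim3_sqr; ring.
Qed.

Let m12_sqr : fsub 2 m12 ^+ 2 = t * (x ^+ 2 + 3 + 2 * r * m) * (4 * r * t * m).
Proof.
rewrite -f2X exprMn C2 D2 (_ : A * C * (B * D) = A * B * (C * D)); last by ring.
by rewrite f2M fsub2_phi_phi3 fsub2_phim_phim3.
Qed.
Let ct8 : 64 * ct t ^+ 2 = 1.
Proof. by have := congr1 (fun u => u ^+ 2) (ct_tau K); rewrite exprMn expr1n -natrX. Qed.
Let ctm12 : ct m12 = 1. Proof. by rewrite ctM !ct_fsub ct_phim mulr1. Qed.

(** Neither D(q^2)^2 = BD nor [m12] at q^2 has been parametrized by itself; the square of their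
    product is, and the constant term 1 fixes the root. *)
Lemma fsub2_phim3_m12 : fsub 2 (D ^+ 2 * m12) = 8 * r * t ^+ 2 * (1 + x) * (r * m + 3 - x).
Proof.
have c1 : ct (D ^+ 2 * m12) = 1 by rewrite ctM ctX ct_fsub ct_phim ctm12 expr1n mulr1.
apply: eq_sqr_ct.
- rewrite f2M f2X f2D D2 exprMn m12_sqr exprMn phi3_sqr phim3_sqr; ring: (mu_sqr K).
- have e (R S : comNzRingType) (f : {rmorphism R -> S}) (r t m : R) :
      f (8 * r * t ^+ 2 * (1 + r ^+ 2) * (r * m + 3 - r ^+ 2)) =
      8 * f r * f t ^+ 2 * (1 + f r ^+ 2) * (f r * f m + 3 - f r ^+ 2).
    by rewrite !(rmorphM f, rmorphB f, rmorphD f, rmorphXn f, rmorph_nat f, rmorph1 f).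
  have {}e : ct (8 * r * t ^+ 2 * (1 + x) * (r * m + 3 - x)) =
      8 * ct r * ct t ^+ 2 * (1 + ct r ^+ 2) * (ct r * ct m + 3 - ct r ^+ 2) := e _ _ (@ct K) r t m.
  by rewrite ct_fsub c1 e ct_rho ct_mu -[LHS]ct8; ring.
- by rewrite ct_fsub c1 oner_eq0.
Qed.
Lemma fsub2_phim_m12 : fsub 2 (C ^+ 2 * m12) = 8 * x * t ^+ 2 * (3 - x) * (r * (1 + x) + m).
Proof.
have c1 : ct (C ^+ 2 * m12) = 1 by rewrite ctM ctX ct_phim ctm12 expr1n mulr1.
apply: eq_sqr_ct.
- rewrite f2M f2X C2 exprMn m12_sqr exprMn phi_sqr phim_sqr; ring: (mu_sqr K).
- have e (R S : comNzRingType) (f : {rmorphism R -> S}) (r t m : R) :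
      f (8 * r ^+ 2 * t ^+ 2 * (3 - r ^+ 2) * (r * (1 + r ^+ 2) + m)) =
      8 * f r ^+ 2 * f t ^+ 2 * (3 - f r ^+ 2) * (f r * (1 + f r ^+ 2) + f m).
    by rewrite !(rmorphM f, rmorphB f, rmorphD f, rmorphXn f, rmorph_nat f, rmorph1 f).
  have {}e : ct (8 * x * t ^+ 2 * (3 - x) * (r * (1 + x) + m)) =
      8 * ct r ^+ 2 * ct t ^+ 2 * (3 - ct r ^+ 2) * (ct r * (1 + ct r ^+ 2) + ct m) := e _ _ (@ct K) r t m.
  by rewrite ct_fsub c1 e ct_rho ct_mu -[LHS]ct8; ring.
- by rewrite ct_fsub c1 oner_eq0.
Qed.
End Level24.

(** * The sixteen basis functions as polynomials *)

Section Polynomials.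
Variable R : comNzRingType.
(* 8 h_i = tau^4 * basis_poly i rho mu, where h_i is the i-th function of the paper;
   large numerals are split in base 4096 because they are unary. *)
Definition basis_poly (i : nat) (r m : R) : R :=
  match i with
  | 1 => (7 * 4096 + 2432) * r + (68 * 4096 + 1408) * r ^+ 3 + (95 * 4096 + 1408) * r ^+ 5 + (27 * 4096
      + 3456) * r ^+ 7 - (10 * 4096 + 3968) * r ^+ 9 - (4 * 4096 + 896) * r ^+ 11 + 128 * r ^+ 13
      + 128 * r ^+ 15
  | 2 => 144 * r + 48 * r ^+ 3 - 2160 * r ^+ 5 - 1872 * r ^+ 7 + 1584 * r ^+ 9 + 1808 * r ^+ 11 + 432 * r ^+ 13
      + 16 * r ^+ 15
  | 3 => 3888 * r - (8 * 4096 + 2224) * r ^+ 3 + (11 * 4096 + 3760) * r ^+ 5 - (3 * 4096 + 1968) * r ^+ 7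
      - (4096 + 1520) * r ^+ 9 + 2160 * r ^+ 11 + 16 * r ^+ 13 - 16 * r ^+ 15
  | 4 => 1152 * r - 384 * r ^+ 3 - (4 * 4096 + 896) * r ^+ 5 + (3 * 4096 + 2688) * r ^+ 7 + (3 * 4096
      + 384) * r ^+ 9 - (3 * 4096 + 2176) * r ^+ 11 + 3456 * r ^+ 13 - 128 * r ^+ 15
  | 5 => (3 * 4096 + 3264) * r + (10 * 4096 + 512) * r ^+ 2 * m + (34 * 4096 + 704) * r ^+ 3 + (23 * 4096
      + 2560) * r ^+ 4 * m + (47 * 4096 + 2752) * r ^+ 5 + (13 * 4096 + 2048) * r ^+ 6 * m + (13 * 4096
      + 3776) * r ^+ 7 - (5 * 4096 + 1984) * r ^+ 9 - (4096 + 512) * r ^+ 10 * m - (2 * 4096 + 448) * r ^+ 11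
      - 512 * r ^+ 12 * m + 64 * r ^+ 13 + 64 * r ^+ 15
  | 6 => 207 * m + 9 * r - 66 * r ^+ 2 * m + 3 * r ^+ 3 - 207 * r ^+ 4 * m - 135 * r ^+ 5 + 36 * r ^+ 6 * m
      - 117 * r ^+ 7 + 33 * r ^+ 8 * m + 99 * r ^+ 9 - 2 * r ^+ 10 * m + 113 * r ^+ 11 - r ^+ 12 * m
      + 27 * r ^+ 13 + r ^+ 15
  | 7 => - 243 * r + 81 * r ^+ 2 * m + 2187 * r ^+ 3 - 54 * r ^+ 4 * m - 3051 * r ^+ 5 - 297 * r ^+ 6 * m
      + 891 * r ^+ 7 + 108 * r ^+ 8 * m + 351 * r ^+ 9 + 207 * r ^+ 10 * m - 135 * r ^+ 11 - 22 * r ^+ 12 * m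
      - r ^+ 13 - 23 * r ^+ 14 * m + r ^+ 15
  | 8 => - 576 * r + 1536 * r ^+ 2 * m + 192 * r ^+ 3 - (4096 + 512) * r ^+ 4 * m + (2 * 4096 + 448) * r ^+ 5
      - (4096 + 3392) * r ^+ 7 + (4096 + 2048) * r ^+ 8 * m - (4096 + 2240) * r ^+ 9 - 3584 * r ^+ 10 * m
      + (4096 + 3136) * r ^+ 11 + 512 * r ^+ 12 * m - 1728 * r ^+ 13 + 64 * r ^+ 15
  | 9 => - 1152 * r - 2304 * r ^+ 3 + 128 * r ^+ 5 + 2560 * r ^+ 7 + 1152 * r ^+ 9 - 256 * r ^+ 11
      - 128 * r ^+ 13
  | 10 => 432 * r + 144 * r ^+ 3 - 912 * r ^+ 5 - 304 * r ^+ 7 + 528 * r ^+ 9 + 176 * r ^+ 11 - 48 * r ^+ 13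
      - 16 * r ^+ 15
  | 11 => - 144 * r + 144 * r ^+ 3 + 304 * r ^+ 5 - 304 * r ^+ 7 - 176 * r ^+ 9 + 176 * r ^+ 11 + 16 * r ^+ 13
      - 16 * r ^+ 15
  | 12 => - 432 * r + 1008 * r ^+ 3 - 240 * r ^+ 5 - 976 * r ^+ 7 + 752 * r ^+ 9 - 48 * r ^+ 11 - 80 * r ^+ 13
      + 16 * r ^+ 15
  | 13 => 288 * r + 192 * r ^+ 2 * m - 128 * r ^+ 4 * m - 608 * r ^+ 5 - 256 * r ^+ 6 * m + 128 * r ^+ 8 * m
      + 352 * r ^+ 9 + 64 * r ^+ 10 * m - 32 * r ^+ 13
  | 14 => 108 * r - 108 * r ^+ 2 * m + 72 * r ^+ 3 - 12 * r ^+ 4 * m - 12 * r ^+ 5 + 104 * r ^+ 6 * m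
      - 80 * r ^+ 7 + 8 * r ^+ 8 * m - 108 * r ^+ 9 + 4 * r ^+ 10 * m + 8 * r ^+ 11 + 4 * r ^+ 12 * m
      + 12 * r ^+ 13
  | 15 => 36 * r - 84 * r ^+ 2 * m + 216 * r ^+ 3 - 52 * r ^+ 4 * m - 4 * r ^+ 5 + 88 * r ^+ 6 * m
      - 240 * r ^+ 7 + 56 * r ^+ 8 * m - 36 * r ^+ 9 - 4 * r ^+ 10 * m + 24 * r ^+ 11 - 4 * r ^+ 12 * m
      + 4 * r ^+ 13
  | 16 => 36 * r ^+ 2 * m - 252 * r ^+ 3 + 180 * r ^+ 4 * m - 72 * r ^+ 5 - 184 * r ^+ 6 * m + 316 * r ^+ 7
      - 56 * r ^+ 8 * m + 80 * r ^+ 9 + 20 * r ^+ 10 * m - 68 * r ^+ 11 + 4 * r ^+ 12 * m - 8 * r ^+ 13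
      + 4 * r ^+ 15
  | _ => 0
  end%R.
End Polynomials.

Section BasisFunctions.
Variable K : numFieldType.
Variable z : K.
Hypothesis z4 : z ^+ 4 = z ^+ 2 - 1.
Local Notation A := (phi K).
Local Notation C := (phim K).
Local Notation B := (fsub 3 (phi K)).
Local Notation D := (fsub 3 (phim K)).
Local Notation a := (hexa K).
Local Notation r := (rho K).
Local Notation t := (tau K).
Local Notation m := (mu K).
Local Notation x := (rho K ^+ 2).
Let nz n := fps_natr_neq0 K n.

Definition basis_base (i : nat) : fps K :=
  match i with
  | 1 => 23 + eisL (@one_ K) (c12 K) 3
  | 2 => eisL (c12 K) (@one_ K) 3
  | 3 => eisL (c4 K) (c3 K) 3
  | 4 => eisL (c3 K) (c4 K) 3
  | 5 => eta_fps K v1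
  | 6 => eta_fps K v2
  | 7 => eta_fps K v3
  | 8 => eta_fps K v4
  | _ => 0
  end.

Arguments basis_base : simpl never.

Definition basis_fun (i : nat) : fps K :=
  match i with
  | 1 | 2 | 3 | 4 => basis_base i
  | 5 | 6 | 7 | 8 => fsub 2 (basis_base (i - 4)%N)
  | 9 | 10 | 11 | 12 => basis_base (i - 4)%N
  | _ => fsub 2 (basis_base (i - 8)%N)
  end.

Let C4 : C ^+ 4 = (2 * t * m * (3 - x)) ^+ 2. Proof. by rewrite -phim_sqr -exprM. Qed.
Let D4 : D ^+ 4 = (2 * t * m * (1 + x)) ^+ 2. Proof. by rewrite -phim3_sqr -exprM. Qed.
Let c4 : fsub 2 (2 * fsub 4 a) = t * (x ^+ 2 + 3 + 6 * r * m).
Proof. by rewrite fsubM // fsub_fsub // -(hexa8E K); congr (_ * _); exact: rmorph_nat. Qed.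
Let a2 : fsub 2 (fsub 2 a) = t * (3 + 6 * x - x ^+ 2).
Proof. by rewrite fsub_fsub // hexa4E. Qed.

Let form1 : 16 * basis_base 1 =
  eis_form1 (A ^+ 2) (B ^+ 2) (C ^+ 4) (D ^+ 4) a (fsub 2 a) (2 * fsub 4 a).
Proof. rewrite (H1_theta z4) /thQ /thP /eis_form1; ring. Qed.
Let form2 : 384 * basis_base 2 =
  eis_form2 (A ^+ 2) (B ^+ 2) (C ^+ 4) (D ^+ 4) a (fsub 2 a) (2 * fsub 4 a).
Proof. rewrite (H2_theta z4) /thQ /thP /eis_form2; ring. Qed.
Let form3 : 128 * basis_base 3 =
  eis_form3 (A ^+ 2) (B ^+ 2) (C ^+ 4) (D ^+ 4) a (fsub 2 a) (2 * fsub 4 a).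
Proof. rewrite (H3_theta z4) /thR /thT /eis_form3; ring. Qed.
Let form4 : 48 * basis_base 4 =
  eis_form4 (A ^+ 2) (B ^+ 2) (C ^+ 4) (D ^+ 4) a (fsub 2 a) (2 * fsub 4 a).
Proof. rewrite (H4_theta z4) /thR /thT /eis_form4; ring. Qed.

Let subAB : A * B - C * D = 8 * x * t - 2 * t * m ^+ 2.
Proof. by rewrite phi_phi3 phim_phim3. Qed.
Let subB4 : B ^+ 4 - D ^+ 4 = (8 * r * t) ^+ 2 - (2 * t * m * (1 + x)) ^+ 2.
Proof. by rewrite D4 -phi3_sqr -exprM. Qed.
Let fsub2_phi3_pow4 : fsub 2 (B ^+ 4) = (t * (4 * r + m * (1 + x))) ^+ 2.
Proof. by rewrite -(fsub2_phi3_sqr K) -(fsubXn (B ^+ 2) 2 (isT : (0 < 2)%N)) -exprM. Qed.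

Let form5 : 4 * basis_base 5 = B ^+ 2 * D ^+ 4 * (A * B - C * D) ^+ 1.
Proof. exact: eta_fps_v1. Qed.
Let form6 : 16 * basis_base 6 = D ^+ 2 * (fsub 2 C * fsub 6 C) * (A * B - C * D) ^+ 2.
Proof. exact: eta_fps_v2. Qed.
Let form7 : 16 * basis_base 7 = D ^+ 2 * (fsub 2 C * fsub 6 C) * (B ^+ 4 - D ^+ 4) ^+ 1.
Proof. exact: eta_fps_v3. Qed.
Let form8 : 16 * basis_base 8 = C ^+ 2 * (fsub 2 C * fsub 6 C) * (B ^+ 4 - D ^+ 4) ^+ 1.
Proof. exact: eta_fps_v4. Qed.
Let fsub2_v1 : fsub 2 (B ^+ 2 * D ^+ 4) = t * (4 * r + m * (1 + x)) * (16 * r * t ^+ 2 * m * (1 + x)).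
Proof. by rewrite fsubM // fsub2_phi3_sqr fsub2_phim3_pow4. Qed.
Lemma basis_param i : (0 < i < 17)%N -> 8 * basis_fun i = t ^+ 4 * basis_poly i r m.
Proof.
(* After multiplication by 48 the left factor is 384, a common multiple of the denominators 16, 384,
   128, 48 and 4 of the forms. *)
case: i => [|[|[|[|[|[|[|[|[|[|[|[|[|[|[|[|[|]]]]]]]]]]]]]]]]] // _; apply: (mulfI (nz 47)).
- have e := form1; rewrite phi_sqr phi3_sqr C4 D4 hexa2E hexa4E hexaE /eis_form1 in e.
  rewrite -[basis_fun 1]/(basis_base 1) /basis_poly.
  by apply: (lincomb1 (c1 := 24) e); ring: (mu_sqr K).
- have e := form2; rewrite phi_sqr phi3_sqr C4 D4 hexa2E hexa4E hexaE /eis_form2 in e.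
  rewrite -[basis_fun 2]/(basis_base 2) /basis_poly.
  by apply: (lincomb1 (c1 := 1) e); ring: (mu_sqr K).
- have e := form3; rewrite phi_sqr phi3_sqr C4 D4 hexa2E hexa4E hexaE /eis_form3 in e.
  rewrite -[basis_fun 3]/(basis_base 3) /basis_poly.
  by apply: (lincomb1 (c1 := 3) e); ring: (mu_sqr K).
- have e := form4; rewrite phi_sqr phi3_sqr C4 D4 hexa2E hexa4E hexaE /eis_form4 in e.
  rewrite -[basis_fun 4]/(basis_base 4) /basis_poly.
  by apply: (lincomb1 (c1 := 8) e); ring: (mu_sqr K).
- have e := eis_form1_map (fsub 2) form1; rewrite /= fsub2_phi_sqr fsub2_phi3_sqr fsub2_phim_pow4 fsub2_phim3_pow4 a2 c4 hexa2E /eis_form1 in e.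
  rewrite -[basis_fun 5]/(fsub 2 (basis_base 1)) /basis_poly.
  by apply: (lincomb1 (c1 := 24) e); ring: (mu_sqr K).
- have e := eis_form2_map (fsub 2) form2; rewrite /= fsub2_phi_sqr fsub2_phi3_sqr fsub2_phim_pow4 fsub2_phim3_pow4 a2 c4 hexa2E /eis_form2 in e.
  rewrite -[basis_fun 6]/(fsub 2 (basis_base 2)) /basis_poly.
  by apply: (lincomb1 (c1 := 1) e); ring: (mu_sqr K).
- have e := eis_form3_map (fsub 2) form3; rewrite /= fsub2_phi_sqr fsub2_phi3_sqr fsub2_phim_pow4 fsub2_phim3_pow4 a2 c4 hexa2E /eis_form3 in e.
  rewrite -[basis_fun 7]/(fsub 2 (basis_base 3)) /basis_poly.
  by apply: (lincomb1 (c1 := 3) e); ring: (mu_sqr K).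
- have e := eis_form4_map (fsub 2) form4; rewrite /= fsub2_phi_sqr fsub2_phi3_sqr fsub2_phim_pow4 fsub2_phim3_pow4 a2 c4 hexa2E /eis_form4 in e.
  rewrite -[basis_fun 8]/(fsub 2 (basis_base 4)) /basis_poly.
  by apply: (lincomb1 (c1 := 8) e); ring: (mu_sqr K).
- have e := form5; rewrite subAB D4 phi3_sqr in e.
  rewrite -[basis_fun 9]/(basis_base 5) /basis_poly.
  by apply: (lincomb1 (c1 := 96) e); ring: (mu_sqr K).
- have e := form6; rewrite subAB phim3_sqr phim2_phim6 in e.
  rewrite -[basis_fun 10]/(basis_base 6) /basis_poly.
  by apply: (lincomb1 (c1 := 24) e); ring: (mu_sqr K).
- have e := form7; rewrite subB4 phim3_sqr phim2_phim6 in e.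
  rewrite -[basis_fun 11]/(basis_base 7) /basis_poly.
  by apply: (lincomb1 (c1 := 24) e); ring: (mu_sqr K).
- have e := form8; rewrite subB4 phim_sqr phim2_phim6 in e.
  rewrite -[basis_fun 12]/(basis_base 8) /basis_poly.
  by apply: (lincomb1 (c1 := 24) e); ring: (mu_sqr K).
- have e := cusp_map (fsub 2) form5; rewrite /= fsub2_v1 fsub2_phi_phi3 fsub2_phim_phim3 in e.
  rewrite -[basis_fun 13]/(fsub 2 (basis_base 5)) /basis_poly.
  by apply: (lincomb1 (c1 := 96) e); ring: (mu_sqr K).
- have e := cusp_map (fsub 2) form6; rewrite /= fsub2_phim3_m12 fsub2_phi_phi3 fsub2_phim_phim3 in e.
  rewrite -[basis_fun 14]/(fsub 2 (basis_base 6)) /basis_poly.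
  by apply: (lincomb1 (c1 := 24) e); ring: (mu_sqr K).
- have e := cusp_map (fsub 2) form7; rewrite /= fsub2_phim3_m12 fsub2_phi3_pow4 fsub2_phim3_pow4 in e.
  rewrite -[basis_fun 15]/(fsub 2 (basis_base 7)) /basis_poly.
  by apply: (lincomb1 (c1 := 24) e); ring: (mu_sqr K).
- have e := cusp_map (fsub 2) form8; rewrite /= fsub2_phim_m12 fsub2_phi3_pow4 fsub2_phim3_pow4 in e.
  rewrite -[basis_fun 16]/(fsub 2 (basis_base 8)) /basis_poly.
  by apply: (lincomb1 (c1 := 24) e); ring: (mu_sqr K).
Qed.

End BasisFunctions.

(** * The eighteen polynomial identities *)

Section PolynomialIdentity.
Variable R : comNzRingType.
(** tau^-2 times the product of the four unary theta functions; a2 and a3 suffice to tell the three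
    quadruples apart. *)
Definition quad_poly (a2 a3 : nat) (r m : R) : R :=
  match a2, a3 with
  | 1%N, 1%N => 64 * r ^+ 5
  | 2%N, 2%N => 8 * r ^+ 2 * (4 * r ^+ 3 + m * (3 - r ^+ 2))
  | _, _ => 64 * r ^+ 3
  end.
Definition hexa_poly (b : nat) (r : R) : R :=
  match b with
  | 1%N => 2 * (r ^+ 4 + 6 * r ^+ 2 - 3)
  | 2%N => 2 * (r ^+ 4 + 3)
  | _ => 3 + 6 * r ^+ 2 - r ^+ 4
  end.

Let sum16 (F : nat -> R) : \sum_(1 <= i < 17) F i =
  F 1%N + F 2%N + F 3%N + F 4%N + F 5%N + F 6%N + F 7%N + F 8%N +
  F 9%N + F 10%N + F 11%N + F 12%N + F 13%N + F 14%N + F 15%N + F 16%N.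
Proof. by rewrite /index_iota /= !big_cons big_nil addr0 !addrA. Qed.

Ltac check_identity h :=
  rewrite sum16 /gamma_num /quad_poly /hexa_poly /basis_poly /=; ring: h.

(** 184 = 8 times 23, from the normalization of [basis_poly] and the common denominator of the
    gamma_i. Each case is an identity modulo the equation of m^2. *)
Lemma theta_poly_identity a1 a2 a3 a4 b1 b2 (r m : R) :
  m ^+ 2 = (3 - r ^+ 2) * (1 + r ^+ 2) ->
  (a1, a2, a3, a4) \in [:: (1, 1, 1, 3); (1, 2, 2, 3); (1, 3, 3, 3)]%N ->
  (b1, b2) \in [:: (1, 1); (1, 2); (1, 4); (2, 2); (2, 4); (4, 4)]%N ->
  184 * (quad_poly a2 a3 r m * hexa_poly b1 r * hexa_poly b2 r) =
  \sum_(1 <= i < 17) ((gamma_num a1 a2 a3 a4 b1 b2)`_i.-1)%:~R * basis_poly i r m.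
Proof.
move=> hm; rewrite !inE.
move=> /or3P[] /eqP[-> -> -> ->] /or4P[/eqP[-> ->]|/eqP[-> ->]|/eqP[-> ->]|/or3P[] /eqP[-> ->]].
- abstract check_identity hm.
- abstract check_identity hm.
- abstract check_identity hm.
- abstract check_identity hm.
- abstract check_identity hm.
- abstract check_identity hm.
- abstract check_identity hm.
- abstract check_identity hm.
- abstract check_identity hm.
- abstract check_identity hm.
- abstract check_identity hm.
- abstract check_identity hm.
- abstract check_identity hm.
- abstract check_identity hm.
- abstract check_identity hm.
- abstract check_identity hm.
- abstract check_identity hm.
- abstract check_identity hm.
Qed.
End PolynomialIdentity.

(** * Theta products as combinations of the basis functions *)

Section ThetaIdentity.
Variable K : numFieldType.
Variable z : K.
Hypothesis z4 : z ^+ 4 = z ^+ 2 - 1.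

Definition theta_prod (a1 a2 a3 a4 b1 b2 : nat) : fps K :=
  fsub a1 (phi K) * fsub a2 (phi K) * fsub a3 (phi K) * fsub a4 (phi K) *
  (fsub b1 (hexa K) * fsub b2 (hexa K)).

Let hexa_param b : b \in [:: 1; 2; 4]%N -> fsub b (hexa K) = tau K * hexa_poly b (rho K).
Proof.
rewrite !inE => /or3P[] /eqP->; rewrite /hexa_poly; [rewrite fsub1 hexaE|rewrite hexa2E|rewrite hexa4E]; ring.
Qed.

Let quad_param a1 a2 a3 a4 : (a1, a2, a3, a4) \in [:: (1, 1, 1, 3); (1, 2, 2, 3); (1, 3, 3, 3)]%N ->
  fsub a1 (phi K) * fsub a2 (phi K) * fsub a3 (phi K) * fsub a4 (phi K) =
  tau K ^+ 2 * quad_poly a2 a3 (rho K) (mu K).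
Proof.
rewrite !inE => /or3P[] /eqP[-> -> -> ->]; rewrite !fsub1 /quad_poly.
- rewrite (_ : _ * _ * _ * _ = phi K ^+ 2 * (phi K * fsub 3 (phi K))); last by ring.
  by rewrite phi_sqr phi_phi3; ring.
- rewrite (_ : _ * _ * _ * _ = fsub 2 (phi K) ^+ 2 * (phi K * fsub 3 (phi K))); last by ring.
  by rewrite phi2_sqr phi_phi3; ring.
- rewrite (_ : _ * _ * _ * _ = phi K * fsub 3 (phi K) * fsub 3 (phi K) ^+ 2); last by ring.
  by rewrite phi3_sqr phi_phi3; ring.
Qed.

Lemma theta_identity a1 a2 a3 a4 b1 b2 :
  (a1, a2, a3, a4) \in [:: (1, 1, 1, 3); (1, 2, 2, 3); (1, 3, 3, 3)]%N ->
  (b1, b2) \in [:: (1, 1); (1, 2); (1, 4); (2, 2); (2, 4); (4, 4)]%N ->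
  23 * theta_prod a1 a2 a3 a4 b1 b2 =
  \sum_(1 <= i < 17) ((gamma_num a1 a2 a3 a4 b1 b2)`_i.-1)%:~R * basis_fun K i.
Proof.
move=> ha hb.
have [hb1 hb2] : b1 \in [:: 1; 2; 4]%N /\ b2 \in [:: 1; 2; 4]%N.
  by move: hb; rewrite !inE => /or4P[/eqP[-> ->]|/eqP[-> ->]|/eqP[-> ->]|/or3P[] /eqP[-> ->]].
have h := theta_poly_identity (mu_sqr K) ha hb.
apply: (mulfI (fps_natr_neq0 K 7)).
rewrite /theta_prod quad_param // !hexa_param //.
transitivity (tau K ^+ 4 * (184 * (quad_poly a2 a3 (rho K) (mu K) *
  hexa_poly b1 (rho K) * hexa_poly b2 (rho K)))); first by ring.
rewrite h !mulr_sumr; apply: eq_big_nat => i /andP[i0 i17].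
by rewrite [RHS]mulrCA (basis_param z4) ?i0 // mulrCA.
Qed.
End ThetaIdentity.

(** * Truncated eta products and their limits *)

Section TruncatedSeries.
Variable K : numFieldType.
Local Notation X := (fX K).
Implicit Types (s : tser) (f g : fps K).

Definition represents N s f := forall k, (k <= N)%N -> cf f k = (nth 0 s k)%:~R.

Lemma eqm_inv N f g : f \is a GRing.unit -> g \is a GRing.unit -> eqm N f g -> eqm N f^-1 g^-1.
Proof.
move=> uf ug e; have := eqmM (fun k (_ : (k < N)%N) => erefl (cf (f^-1 * g^-1) k)) (eqm_sym e).
by rewrite mulrVK // mulrAC mulVr // mul1r.
Qed.

Lemma eqm_exprz N f g (r : int) : f \is a GRing.unit -> g \is a GRing.unit ->
  eqm N f g -> eqm N (f ^ r) (g ^ r).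
Proof.
move=> uf ug e; case: r => k; first exact: (eqmX k e).
exact: (eqm_inv (unitrX k.+1 uf) (unitrX k.+1 ug) (eqmX k.+1 e)).
Qed.

Lemma represents_one N : represents N (tone N) 1.
Proof. by move=> k le; rewrite /tone nth_mkseq //= cf1; case: (k == _). Qed.

Lemma represents_mul N s s' f g : represents N s f -> represents N s' g ->
  represents N (tmul N s s') (f * g).
Proof.
move=> rs rs' k le; rewrite /tmul nth_mkseq // cfM rmorph_sum /= big_mkord.
apply: eq_bigr => i _; have := ltn_ord i => lt.
by rewrite rmorphM /= rs ?rs' //; lia.
Qed.

Lemma represents_foldr (I : eqType) N (r : seq I) (F : I -> tser) (G : I -> fps K) :
  {in r, forall i, represents N (F i) (G i)} ->
  represents N (foldr (tmul N) (tone N) [seq F i | i <- r]) (\prod_(i <- r) G i).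
Proof.
elim: r => [|i r IH] h /=; first by rewrite big_nil; apply: represents_one.
rewrite big_cons; apply: represents_mul; first by apply: h; rewrite mem_head.
by apply: IH => j jr; apply: h; rewrite in_cons jr orbT.
Qed.

Lemma represents_one_sub N d : (0 < d)%N -> represents N (t1mX N d) (1 - X d).
Proof.
move=> d0 k le; rewrite /t1mX nth_mkseq // cfB cf1 rmorphB /=.
by case: (k == 0)%N; case: (k == d).
Qed.

Lemma unit_one_sub d : (0 < d)%N -> 1 - X d \is a GRing.unit.
Proof. by move=> d0; rewrite unit_fps cfB cf1 /= (_ : (0 == d)%N = false) ?subr0 ?oner_eq0 //; lia. Qed.

Lemma represents_geom N d : (0 < d)%N -> represents N (tgeom N d) (1 - X d)^-1.
Proof.
move=> d0; pose G : fps K := Fps (fun k => (d %| k)%:R).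
have e : (1 - X d) * G = 1.
  apply: fpsP => k; rewrite mulrBl mul1r cfB cfXM cf1 /=.
  case: leqP => le; first by rewrite dvdn_subl // subrr; case: eqP le d0 => // -> le; rewrite ltnNge le.
  by rewrite subr0; case: k le => [|k] le; rewrite ?dvdn0 // gtnNdvd.
have -> : (1 - X d)^-1 = G by rewrite -[LHS]mulr1 -{2}e mulKr ?unit_one_sub.
by move=> k le; rewrite /tgeom nth_mkseq //=; case: (d %| k)%N.
Qed.

Lemma represents_fac N d r : (0 < d)%N -> represents N (tfac N d r) ((1 - X d) ^ r).
Proof.
move=> d0; have it s f k : represents N s f -> represents N (iter k (tmul N s) (tone N)) (f ^+ k).
  move=> h; elim: k => [|k IH]; first by rewrite expr0; apply: represents_one.
  by rewrite exprS; apply: represents_mul.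
case: r => k; rewrite /tfac /exprz; first exact/it/represents_one_sub.
by rewrite -exprVn; apply/it/represents_geom.
Qed.

Lemma prod_exprz (I : eqType) (s : seq I) (F : I -> fps K) r :
  {in s, forall i, F i \is a GRing.unit} ->
  (\prod_(i <- s) F i) ^ r = \prod_(i <- s) F i ^ r.
Proof.
elim: s => [|i s IH] u; first by rewrite !big_nil exp1rz.
rewrite !big_cons exprzMl ?IH ?u ?mem_head //; first by move=> j js; rewrite u // in_cons js orbT.
by rewrite big_seq; apply: rpred_prod => j js; rewrite u // in_cons js orbT.
Qed.

Let fac m k : fps K := 1 - X (m * k).
Let unit_fac m n : (0 < m)%N -> {in iota 1 n, forall k, fac m k \is a GRing.unit}.
Proof.
by move=> m0 k; rewrite mem_iota => /andP[k0 _]; apply: unit_one_sub; rewrite muln_gt0 m0.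
Qed.

(** As m > 0, the factors 1 - q^(m k) with k > n are 1 modulo q^(n+1), and congruence of units
    passes to negative powers. *)
Let eqm_eul_prod m r n : (0 < m)%N ->
  eqm n.+1 (fsub m (eul K) ^ r) (\prod_(k <- iota 1 n) fac m k ^ r).
Proof.
move=> m0; have u := unit_fac (n := n) m0; rewrite -(prod_exprz r u).
apply: eqm_exprz; first exact: unit_eul.
  by rewrite big_seq; apply: rpred_prod.
have -> : \prod_(k <- iota 1 n) fac m k = fsub m (eul_upto K n).
  rewrite /eul_upto /index_iota subn1; case: m m0 {u} => // m m0.
  by rewrite rmorph_prod; apply: eq_bigr => k _; rewrite rmorphB rmorph1 /= fsub_fX.
by apply: eqm_fsub1 => //; apply: eqm_eul.
Qed.

Lemma etaprod_coefE (l : seq (nat * int)) n : all (fun p => (0 < p.1)%N) l ->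
  (etaprod_coef l n)%:~R = cf (\prod_(p <- l) fsub p.1 (eul K) ^ p.2) n.
Proof.
move=> pos; pose G p := \prod_(k <- iota 1 n) fac p.1 k ^ p.2.
have e : eqm n.+1 (\prod_(p <- l) fsub p.1 (eul K) ^ p.2) (\prod_(p <- l) G p).
  move: pos; elim: l => [|p l IH] /= => [_|/andP[m0 pos]]; first by rewrite !big_nil.
  by rewrite !big_cons; apply: eqmM; [exact: eqm_eul_prod | exact: IH].
rewrite e //; apply/esym/represents_foldr => // p pl.
apply: represents_foldr => k; rewrite mem_iota => /andP[k0 _].
by apply: represents_fac; rewrite muln_gt0 k0 (allP pos).
Qed.

Lemma etaq_coefE (l : seq (nat * int)) (s n : nat) : all (fun p => (0 < p.1)%N) l ->
  \sum_(p <- l) p.1%:Z * p.2 = (24 * s)%:Z ->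
  ratr (etaq_coef l n) = cf (eta_fps K l) n.
Proof.
move=> pos e; rewrite /etaq_coef /eta_fps /eta_shift e absz_nat mulKn // cfXM.
have [le|lt] := leqP s n.
  have -> : 24 * n%:Z - (24 * s)%:Z = (24 * (n - s))%:Z by lia.
  by rewrite le0z_nat absz_nat dvdn_mulr // mulKn // ratr_int etaprod_coefE.
by rewrite (_ : (0 <= _) = false) /= ?rmorph0 //; lia.
Qed.
End TruncatedSeries.

(** * Coefficients of the basis functions *)

Section EisensteinCoefficients.
Variable K : numFieldType.
Implicit Types (chi psi : nat -> int) (g : nat -> nat -> K).

Lemma cf_LL_divisors g n : (0 < n)%N ->
  cf (LL g) n = \sum_(d <- divisors n) g (n %/ d)%N d.
Proof.
move=> n0; rewrite (cf_LL g (ltnSn n) (ltnSn n)) exchange_big_nat /=.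
have inner d : (0 < d)%N -> \sum_(1 <= m < n.+1) (m * d == n)%N%:R * g m d =
    if (d %| n)%N then g (n %/ d)%N d else 0.
  move=> d0; case: ifP => [/dvdnP[k nE]|nd].
    have k0 : (0 < k)%N by move: n0; rewrite nE muln_gt0 => /andP[].
    rewrite (bigD1_seq k) ?iota_uniq //=; last first.
      by rewrite mem_index_iota k0 ltnS nE leq_pmulr.
    rewrite nE eqxx mul1r mulnK // big1 ?addr0 // => m /negPf mk.
    by rewrite eqn_pmul2r // mk mul0r.
  rewrite big_nat big1 // => m _; case: eqP => [e|]; last by rewrite mul0r.
  by rewrite -e dvdn_mull in nd.
rewrite (eq_big_nat _ _ (F2 := fun d => if (d %| n)%N then g (n %/ d)%N d else 0)); last first.
  by move=> d /andP[d0 _]; apply: inner.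
rewrite -big_mkcond -big_filter; apply/perm_big/uniq_perm; rewrite ?filter_uniq ?iota_uniq ?divisors_uniq //.
move=> d; rewrite mem_filter mem_index_iota -dvdn_divisors //.
by case dn : (d %| n)%N => //=; rewrite (dvdn_gt0 n0 dn) ltnS (dvdn_leq n0 dn).
Qed.

Lemma ratr_eis4 chi psi M f n : (0 < n)%N ->
  ratr (eis4 chi M psi f n) = cf (eisL (fun k => (chi k)%:~R) (fun k => (psi k)%:~R : K) 3) n.
Proof.
move=> n0; rewrite /eisL cf_LL_divisors // /eis4 -[n == _]negbK -lt0n n0 /= rmorph_sum /=.
apply: eq_bigr => d _.
by rewrite rmorphM rmorphXn /= ratr_int ratr_nat rmorphM /= [_%:~R * _%:~R]mulrC.
Qed.

Lemma cf0_LL g : cf (LL g) 0 = 0.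
Proof. by rewrite /= big_geq. Qed.

(** Gives the constant term 184/8 = 23 of h_1, in agreement with the 23 that sqrt 3 produced in
    [H1_rel]. *)
Lemma genbern4_chi12 : genbern4 chi12 12 = - 184.
Proof.
rewrite /genbern4 /index_iota /= !big_cons big_nil /chi12 /bern4 /=.
by field.
Qed.
Lemma ratr_at2z (c : nat -> rat) (f : fps K) : (forall n, ratr (c n) = cf f n) ->
  forall n, ratr (at2z c n) = cf (fsub 2 f) n.
Proof. by move=> h n; rewrite /at2z /= dvdn2 divn2; case: (odd n); rewrite ?rmorph0. Qed.

Lemma ratr_Ccoef i n : (0 < i < 17)%N -> ratr (Ccoef i n) = cf (basis_fun K i) n.
Proof.
have one_E : (fun k => (chi_one k)%:~R) = @one_ K by [].
have h1 k : ratr (eis4 chi_one 1 chi12 12 k) = cf (basis_base K 1) k.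
  rewrite /basis_base cfD; case: k => [|k]; last first.
    rewrite ratr_eis4 // one_E [X in X + _](_ : _ = 0) ?add0r //.
    by rewrite -(rmorph_nat (@fC K)) cfC mul0r.
  by rewrite cf0_LL addr0 cf0nat /eis4 /= genbern4_chi12 (_ : _ / _ = 23) ?ratr_nat.
have h2 k : ratr (eis4 chi12 12 chi_one 1 k) = cf (basis_base K 2) k.
  by case: k => [|k]; [rewrite rmorph0 cf0_LL | exact: ratr_eis4].
have h3 k : ratr (eis4 chim4 4 chim3 3 k) = cf (basis_base K 3) k.
  by case: k => [|k]; [rewrite rmorph0 cf0_LL | exact: ratr_eis4].
have h4 k : ratr (eis4 chim3 3 chim4 4 k) = cf (basis_base K 4) k.
  by case: k => [|k]; [rewrite rmorph0 cf0_LL | exact: ratr_eis4].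
have h5 k : ratr (etaq_coef v1 k) = cf (basis_base K 5) k.
  by apply: (@etaq_coefE _ _ 1%N); rewrite // /v1 unlock.
have h6 k : ratr (etaq_coef v2 k) = cf (basis_base K 6) k.
  by apply: (@etaq_coefE _ _ 2%N); rewrite // /v2 unlock.
have h7 k : ratr (etaq_coef v3 k) = cf (basis_base K 7) k.
  by apply: (@etaq_coefE _ _ 3%N); rewrite // /v3 unlock.
have h8 k : ratr (etaq_coef v4 k) = cf (basis_base K 8) k.
  by apply: (@etaq_coefE _ _ 3%N); rewrite // /v4 unlock.
case: i => [|[|[|[|[|[|[|[|[|[|[|[|[|[|[|[|[|]]]]]]]]]]]]]]]]] // _.
- exact: h1.
- exact: h2.
- exact: h3.
- exact: h4.
- exact: ratr_at2z h1 n.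
- exact: ratr_at2z h2 n.
- exact: ratr_at2z h3 n.
- exact: ratr_at2z h4 n.
- exact: h5.
- exact: h6.
- exact: h7.
- exact: h8.
- exact: ratr_at2z h5 n.
- exact: ratr_at2z h6 n.
- exact: ratr_at2z h7 n.
- exact: ratr_at2z h8 n.
Qed.
End EisensteinCoefficients.

(** * Representation numbers as coefficients of theta products *)

Section RepresentationCount.
Variable K : numFieldType.
Variables a1 a2 a3 a4 b1 b2 : nat.
Hypotheses (a1_gt0 : (0 < a1)%N) (a2_gt0 : (0 < a2)%N) (a3_gt0 : (0 < a3)%N) (a4_gt0 : (0 < a4)%N).
Hypotheses (b1_gt0 : (0 < b1)%N) (b2_gt0 : (0 < b2)%N).

(** The eight coordinates, nested in the way that repeated products of [gsum] series produce
    them. *)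
Let I8 := ((int * int * int * int) * ((int * int) * (int * int)))%type.
Let tup (x : 'I_8 -> int) : I8 :=
  ((x (inord 0), x (inord 1), x (inord 2), x (inord 3)),
   ((x (inord 4), x (inord 5)), (x (inord 6), x (inord 7)))).
Let Q8 (p : I8) : int :=
  a1%:Z * sqz p.1.1.1.1 + a2%:Z * sqz p.1.1.1.2 + a3%:Z * sqz p.1.1.2 + a4%:Z * sqz p.1.2 +
  (b1%:Z * hexz p.2.1 + b2%:Z * hexz p.2.2).

Lemma qform_tup x : qform a1 a2 a3 a4 b1 b2 x = Q8 (tup x).
Proof. by rewrite /qform /Q8 /= /sqz /hexz /= addrA. Qed.

Let gsum1M (I J : choiceType) (Q : I -> int) (Q' : J -> int) : posfinite Q -> posfinite Q' ->
  gsum (@one_wt K I) Q * gsum (@one_wt K J) Q' =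
  gsum (@one_wt K (I * J)%type) (fun p => Q p.1 + Q' p.2).
Proof. by move=> pQ pQ'; rewrite gsumM //; apply: eq_gsum => // p; rewrite /one_wt mulr1. Qed.

Lemma theta_prod_gsum : theta_prod K a1 a2 a3 a4 b1 b2 = gsum (@one_wt K I8) Q8.
Proof.
have ps a (a0 : (0 < a)%N) := posfinite_scale a0 posfinite_sqz1.
have ph b (b0 : (0 < b)%N) := posfinite_scale b0 posfinite_hexz.
have p12 := posfinite_pair (ps _ a1_gt0) (ps _ a2_gt0).
have p123 := posfinite_pair p12 (ps _ a3_gt0).
rewrite /theta_prod /phi /hexa !fsub_gsum //.
rewrite (gsum1M (ps _ a1_gt0) (ps _ a2_gt0)) (gsum1M p12 (ps _ a3_gt0)).
rewrite (gsum1M p123 (ps _ a4_gt0)) (gsum1M (ph _ b1_gt0) (ph _ b2_gt0)).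
exact: (gsum1M (posfinite_pair p123 (ps _ a4_gt0)) (posfinite_pair (ph _ b1_gt0) (ph _ b2_gt0))).
Qed.

Lemma sqz_bound (a n : nat) (x : int) : (0 < a)%N -> a%:Z * sqz x <= n%:Z -> `|x| <= n%:Z.
Proof.
move=> a0 le; have h : `|x| <= sqz x by rewrite /sqz; nia.
by have : sqz x <= a%:Z * sqz x; [have : 0 <= sqz x by rewrite /sqz sqr_ge0 | ]; nia.
Qed.

Lemma hexz_bound (b n : nat) (p : int * int) : (0 < b)%N -> b%:Z * hexz p <= n%:Z ->
  `|p.1| <= n%:Z /\ `|p.2| <= n%:Z.
Proof.
move=> b0 le; have h0 : 0 <= hexz p by case: posfinite_hexz => h _; apply: h.
have {}le : hexz p <= n%:Z by nia.
case: p h0 le => x y; rewrite /hexz /= => _ le.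
have bound (u v : int) : u ^+ 2 + u * v + v ^+ 2 <= n%:Z -> `|u| <= n%:Z.
  move=> {}le; rewrite leNgt; apply/negP => lt.
  have : 3 * `|u| ^+ 2 <= 4 * n%:Z.
    by rewrite real_normK ?num_real //; have := sqr_ge0 (u + 2 * v); lia.
  by nia.
by split; [exact: bound le | apply: (bound y x); lia].
Qed.

Let Q8_bound (n : nat) p : Q8 p = n%:Z ->
  [/\ `|p.1.1.1.1| <= n%:Z, `|p.1.1.1.2| <= n%:Z, `|p.1.1.2| <= n%:Z & `|p.1.2| <= n%:Z] /\
  [/\ `|p.2.1.1| <= n%:Z, `|p.2.1.2| <= n%:Z, `|p.2.2.1| <= n%:Z & `|p.2.2.2| <= n%:Z].
Proof.
rewrite /Q8 => e.
have s0 (a : nat) x : 0 <= a%:Z * sqz x by rewrite mulr_ge0 ?sqr_ge0.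
have h0 (b : nat) q : 0 <= b%:Z * hexz q.
  by rewrite mulr_ge0 //; case: posfinite_hexz => h _; apply: h.
have := s0 a1 p.1.1.1.1; have := s0 a2 p.1.1.1.2; have := s0 a3 p.1.1.2; have := s0 a4 p.1.2.
have := h0 b1 p.2.1; have := h0 b2 p.2.2 => q2 q1 e4 e3 e2 e1.
have [|u1 u2] := @hexz_bound b1 n p.2.1 b1_gt0; first by lia.
have [|u3 u4] := @hexz_bound b2 n p.2.2 b2_gt0; first by lia.
by split; split=> //; [apply: sqz_bound a1_gt0 _|apply: sqz_bound a2_gt0 _|
  apply: sqz_bound a3_gt0 _|apply: sqz_bound a4_gt0 _]; lia.
Qed.

Let box_inj n : injective (fun y : {ffun 'I_8 -> 'I_(2 * n).+1} => tup (box_vec y)).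
Proof.
move=> y y' [] e0 e1 e2 e3 e4 e5 e6 e7; apply/ffunP => i; apply/val_inj => /=.
have ok k : box_vec y (inord k) = box_vec y' (inord k) -> y (inord k) = y' (inord k) :> nat.
  by rewrite /box_vec; lia.
rewrite -(inord_val i); case: i => -[|[|[|[|[|[|[|[|]]]]]]]] //= _; exact: ok.
Qed.

Let box_onto (n : nat) p : Q8 p = n%:Z ->
  exists y : {ffun 'I_8 -> 'I_(2 * n).+1}, tup (box_vec y) = p.
Proof.
move=> /Q8_bound; case: p => -[[[x0 x1] x2] x3] [[x4 x5] [x6 x7]] /=.
move=> [[h0 h1 h2 h3] [h4 h5 h6 h7]].
exists [ffun i : 'I_8 => inord (absz (nth 0 [:: x0; x1; x2; x3; x4; x5; x6; x7] i + n%:Z))].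
have ok (k : nat) : (k < 8)%N -> `|nth 0 [:: x0; x1; x2; x3; x4; x5; x6; x7] k| <= n%:Z ->
    @box_vec n [ffun i : 'I_8 => inord (absz (nth 0 [:: x0; x1; x2; x3; x4; x5; x6; x7] i + n%:Z))]
      (inord k) = nth 0 [:: x0; x1; x2; x3; x4; x5; x6; x7] k :> int.
  move=> k8; rewrite /box_vec ffunE (inordK k8); move: (nth _ _ k) => u le.
  by rewrite inordK; lia.
by rewrite /tup (ok 0%N) // (ok 1%N) // (ok 2%N) // (ok 3%N) // (ok 4%N) // (ok 5%N) // (ok 6%N) // (ok 7%N).
Qed.

Lemma Nrep_cf n : (Nrep a1 a2 a3 a4 b1 b2 n)%:R = cf (theta_prod K a1 a2 a3 a4 b1 b2) n.
Proof.
rewrite theta_prod_gsum.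
rewrite (@cf_gsum _ _ _ _ [seq tup (box_vec y) | y <- enum {: {ffun 'I_8 -> 'I_(2 * n).+1}}] n).
- rewrite big_map big_enum /= /Nrep -sum1_card natr_sum big_mkcond /=.
  by apply: eq_bigr => y _; rewrite inE qform_tup /one_wt mulr1; case: eqP.
- by rewrite map_inj_uniq ?enum_uniq //; apply: box_inj.
- by move=> p /box_onto[y <-]; apply/map_f; rewrite mem_enum.
Qed.
End RepresentationCount.

(** * Conclusion over the rationals *)

Lemma root_cyclotomic12 : exists z : algC, z ^+ 4 = z ^+ 2 - 1.
Proof.
have [z h] := @solve_monicpoly algC 4 (fun i => nth 0 [:: -1; 0; 1; 0] i) isT.
exists z; rewrite h !big_ord_recr big_ord0 /=; ring.
Qed.

Lemma Nrep_Ccoef (K : numFieldType) (z : K) (a1 a2 a3 a4 b1 b2 : nat) :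
  z ^+ 4 = z ^+ 2 - 1 ->
  (a1, a2, a3, a4) \in [:: (1, 1, 1, 3); (1, 2, 2, 3); (1, 3, 3, 3)]%N ->
  (b1, b2) \in [:: (1, 1); (1, 2); (1, 4); (2, 2); (2, 4); (4, 4)]%N ->
  forall n : nat, 23 * (Nrep a1 a2 a3 a4 b1 b2 n)%:R =
    \sum_(1 <= i < 17) ((gamma_num a1 a2 a3 a4 b1 b2)`_i.-1)%:~R * ratr (Ccoef i n) :> K.
Proof.
move=> z4 ha hb n.
have [pa1 pa2 pa3 pa4] : [/\ 0 < a1, 0 < a2, 0 < a3 & 0 < a4]%N.
  by move: ha; rewrite !inE => /or3P[] /eqP[-> -> -> ->].
have [pb1 pb2] : (0 < b1 /\ 0 < b2)%N.
  by move: hb; rewrite !inE => /or4P[/eqP[-> ->]|/eqP[-> ->]|/eqP[-> ->]|/or3P[] /eqP[-> ->]].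
rewrite (Nrep_cf K) // -cfCM rmorph_nat (theta_identity z4 ha hb) cf_sum.
apply: eq_big_nat => i ib.
by rewrite -(rmorph_int (@fC K)) cfCM ratr_Ccoef.
Qed.

Theorem theorem2p1 (a1 a2 a3 a4 b1 b2 : nat) :
  (a1, a2, a3, a4) \in [:: (1, 1, 1, 3); (1, 2, 2, 3); (1, 3, 3, 3)]%N ->
  (b1, b2) \in [:: (1, 1); (1, 2); (1, 4); (2, 2); (2, 4); (4, 4)]%N ->
  forall n : nat,
    (Nrep a1 a2 a3 a4 b1 b2 n)%:R =
    \sum_(1 <= i < 17) gamma a1 a2 a3 a4 b1 b2 i * Ccoef i n :> rat.
Proof.
move=> ha hb n; have [z z4] := root_cyclotomic12.
have h := Nrep_Ccoef z4 ha hb n.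
have n23 : (23 : rat) != 0 by rewrite pnatr_eq0.
apply: (mulfI n23); apply: (fmorph_inj (@ratr algC)).
rewrite [LHS]rmorphM /= !ratr_nat h mulr_sumr rmorph_sum /=.
apply: eq_big_nat => i _; rewrite /gamma.
have -> (g c : rat) : 23 * (g / 23 * c) = g * c by field.
by rewrite [RHS]rmorphM /= ratr_int.
Qed.
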